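(* Let $\mathcal H_0$ be a separable Hilbert space with dimension $N\in\{1,\dots,+\infty\}$. Let $\nu$ be a trace-class p.o.v.m. on $(\Lambda,\mathcal A,\mathcal H_0)$, where $(\Lambda,\mathcal A)$ is a measurable space, and $\mu$ a $\sigma$-finite dominating measure of $\nu$ (e.g. its variation norm $\|\nu\|_1$). Then there exist sequences $(\sigma_n)_{0\le n<N}$ and $(\phi_n)_{0\le n<N}$ of measurable functions $\sigma_n:(\Lambda,\mathcal A)\to(\mathbb R_+,\mathcal B(\mathbb R_+))$ and $\phi_n:(\Lambda,\mathcal A)\to(\mathcal H_0,\mathcal B(\mathcal H_0))$ such that: (i) for all $\lambda\in\Lambda$, $(\sigma_n(\lambda))_{0\le n<N}$ is non-increasing and $\sum_{0\le n<N}\sigma_n(\lambda)<\infty$; (ii) for all $\lambda\in\Lambda$, $(\phi_n(\lambda))_{0\le n<N}$ is orthonormal; (iii) $\nu$ admits the density $f:\lambda\mapsto\sum_{0\le n<N}\sigma_n(\lambda)\,\phi_n(\lambda)\otimes\phi_n(\lambda)$ with respect to $\mu$, where the convergence holds absolutely in $\mathcal S_1(\mathcal H_0)$ for each $\lambda\in\Lambda$. Moreover, with $\phi_n^{\mathsf H}:\lambda\mapsto\phi_n(\lambda)^{\mathsf H}$ and $\phi_n\otimes\phi_n:\lambda\mapsto\phi_n(\lambda)\otimes\phi_n(\lambda)$, the following hold: (iv) the sequence $(\phi_n^{\mathsf H})_{0\le n<N}$ is orthogonal in $\mathsf L^2(\Lambda,\mathcal A,\mathcal O(\mathcal H_0,\mathbb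 C),\nu)$; (v) the sequence $(\phi_n\otimes\phi_n)_{0\le n<N}$ is Gramian-orthogonal in $\mathsf L^2(\Lambda,\mathcal A,\mathcal O(\mathcal H_0),\nu)$; (vi) the $\mathcal L_b(\mathcal H_0)$-valued mapping $\sum_{0\le n<N}\phi_n\otimes\phi_n$ is equal to the mapping $\lambda\mapsto\mathrm{Id}_{\mathcal H_0}$ in $\mathsf L^2(\Lambda,\mathcal A,\mathcal O(\mathcal H_0),\nu)$.
   Context: Operators. Hilbert spaces are complex. $\mathcal O(\mathcal H,\mathcal G)$ is the set of linear operators $\mathrm Q$ with values in $\mathcal G$ defined on a linear subspace $\mathcal D(\mathrm Q)\subset\mathcal H$; $\mathcal L_b(\mathcal H,\mathcal G)$, $\mathcal S_1(\mathcal H,\mathcal G)$, $\mathcal S_2(\mathcal H,\mathcal G)$ are the bounded, trace-class and Hilbert-Schmidt operators ($\mathcal G$ omitted if $\mathcal G=\mathcal H$), $\|\cdot\|_p$ the norm of $\mathcal S_p$, superscript $+$ denotes positive operators, $\mathrm Q^{\mathsf H}$ the adjoint, $\mathrm{Im}$ the range. For $x\in\mathcal H_0$, $x^{\mathsf H}$ is the functional $z\mapsto\langle z,x\rangle$; $(x\otimes y)z=\langle z,y\rangle x$. Measurability. $\Phi:\Lambda\to\mathcal L_b(\mathcal H,\mathcal G)$ is simply measurable if $\lambda\mapsto\Phi(\lambda)x$ is measurable for every $x\in\mathcal H$. $\Phi:\Lambda\to\mathcal O(\mathcal H,\mathcal G)$ is $\mathcal O$-measurable, written $\Phi\in\mathbb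 F_{\mathcal O}(\Lambda,\mathcal A,\mathcal H,\mathcal G)$, if $\{\lambda: x\in\mathcal D(\Phi(\lambda))\}\in\mathcal A$ for all $x\in\mathcal H$ and there are simply measurable $\Phi_n:\Lambda\to\mathcal L_b(\mathcal H,\mathcal G)$ with $\Phi_n(\lambda)x\to\Phi(\lambda)x$ for all $\lambda$ and all $x\in\mathcal D(\Phi(\lambda))$. Trace-class p.o.v.m. A trace-class p.o.v.m. on $(\Lambda,\mathcal A,\mathcal H_0)$ is a map $\nu:\mathcal A\to\mathcal S_1^+(\mathcal H_0)$ countably additive in weak operator topology. Its variation measure is $\|\nu\|_1(A)=\|\nu(A)\|_1$, a finite measure; $\mu$ dominates $\nu$ if $\|\nu\|_1\ll\mu$; the density $g=\frac{\mathrm d\nu}{\mathrm d\mu}$ is the function in $L^1(\Lambda,\mathcal A,\mathcal S_1(\mathcal H_0),\mu)$ with $\nu(A)=\int_A g\,\mathrm d\mu$ for all $A\in\mathcal A$. Square-integrable functions. Let $\mathcal G_0$ be a separable Hilbert space and $f_0=\frac{\mathrm d\nu}{\mathrm d\|\nu\|_1}$. $\mathscr L^2(\Lambda,\mathcal A,\mathcal O(\mathcal H_0,\mathcal G_0),\nu)$ is the set of $\Phi\in\mathbb F_{\mathcal O}(\Lambda,\mathcal A,\mathcal H_0,\mathcal G_0)$ such that, $\|\nu\|_1$-a.e., $\mathrm{Im}(f_0^{1/2})\subset\mathcal D(\Phi)$ and $\Phi f_0^{1/2}\in\mathcal S_2(\mathcal H_0,\mathcal G_0)$, and $(\Phi f_0^{1/2})(\Phi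 f_0^{1/2})^{\mathsf H}\in\mathcal L^1(\Lambda,\mathcal A,\mathcal S_1(\mathcal G_0),\|\nu\|_1)$. It carries the (pseudo-)Gramian $[\Phi,\Psi]_\nu:=\int(\Phi f_0^{1/2})(\Psi f_0^{1/2})^{\mathsf H}\,\mathrm d\|\nu\|_1\in\mathcal S_1(\mathcal G_0)$, scalar product $\langle\Phi,\Psi\rangle_\nu=\mathrm{Tr}[\Phi,\Psi]_\nu$ and $\|\Phi\|_\nu=\|[\Phi,\Phi]_\nu\|_1^{1/2}$. $\mathsf L^2(\Lambda,\mathcal A,\mathcal O(\mathcal H_0,\mathcal G_0),\nu)$ is its quotient by $\{\|\cdot\|_\nu=0\}$. Orthogonal refers to $\langle\cdot,\cdot\rangle_\nu$; Gramian-orthogonal means $[\Phi_n,\Phi_p]_\nu=0$ for $n\ne p$. The sum in (vi) is taken pointwise in $\lambda$ (strong convergence). *)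

(* Defs.v *)
From HB Require Import structures.
From mathcomp Require Import all_boot all_order all_algebra complex.
From mathcomp Require Import all_classical all_reals all_analysis.
From mathcomp Require Import ring.
Set Implicit Arguments.
Unset Strict Implicit.
Unset Printing Implicit Defensive.
Import Order.TTheory GRing.Theory Num.Theory.
Import numFieldNormedType.Exports.
Local Open Scope classical_set_scope.
Local Open Scope ring_scope.
Local Open Scope complex_scope.

(* R[i] as a complete normed space, and then as a Hilbert space, over itself. *)
Lemma complex_complete (R : realType) (F : set_system R[i]^o) :
  ProperFilter F -> cauchy F -> cvg F.
Proof.
move=> FF /cauchyP Fc.
have key (p : R[i] -> R) : (forall x y, `|p x - p y| <= complex.Re `|x - y|) ->
  exists l, forall e : R, 0 < e -> \forall x \near F, `|l - p x| < e.
  move=> pl.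
  have /cauchy_cvg/cvg_ex[l Hl] : cauchy (p @ F).
    apply/cauchyP => e e0.
    have e0' : 0 < e%:C by rewrite ltcR.
    have [x Fx] := Fc e%:C e0'.
    exists (p x); rewrite -ball_normE; move: Fx; rewrite -ball_normE.
    rewrite nbhs_simpl/=; apply: filterS => y /= xy.
    by apply: le_lt_trans (pl _ _) _; move: xy; rewrite ltcE/= => /andP[_].
  by exists l => e e0; move/cvgrPdist_lt : Hl; apply.
have [|a Ha] := key (@complex.Re R).
  move=> [x1 x2] [y1 y2]; rewrite normc_def /=.
  by rewrite -sqrtr_sqr ler_wsqrtr// lerDl sqr_ge0.
have [|b Hb] := key (@complex.Im R).
  move=> [x1 x2] [y1 y2]; rewrite normc_def /=.
  by rewrite -sqrtr_sqr ler_wsqrtr// lerDr sqr_ge0.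
apply/cvg_ex; exists (a +i* b : R[i]^o); apply/cvgrPdist_lt => e e0.
have [e' e'0 ->] : exists2 e', 0 < e' & e = e'%:C.
  by case: e e0 => e1 e2; rewrite ltcE/= => /andP[/eqP -> h]; exists e1.
have h : 0 < e' / 2 by rewrite divr_gt0.
apply: filterS2 (Ha _ h) (Hb _ h) => -[x y] /= ax by_.
have -> : a +i* b - (x +i* y) = (a - x)%:C + 'i * (b - y)%:C.
  by apply/eqP; rewrite eq_complex; apply/andP; split; apply/eqP=> /=; ring.
apply: le_lt_trans (ler_normD _ _) _; rewrite normrM.
have -> : `|'i : R[i]| = 1 by rewrite normc_def/= expr0n expr1n add0r sqrtr1.
rewrite mul1r !normc_def/= expr0n !addr0 !sqrtr_sqr -rmorphD ltcR.
by rewrite [e'](splitr) ltrD.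
Qed.

HB.instance Definition _ (R : realType) := NormedModule.copy R[i] R[i]^o.
HB.instance Definition _ (R : realType) :=
  Uniform_isComplete.Build R[i] (@complex_complete R).

(* The inner product is linear in its first argument and conjugate-linear in
   the second one. *)
HB.mixin Record isHilbert (R : realType) H & CompleteNormedModule R[i] H := {
  hdot : {dot H for (@Num.conj R[i])} ;
  hdot_norm : forall x : H, hdot x x = `|x| ^+ 2 }.

#[short(type="hilbertType")]
HB.structure Definition Hilbert (R : realType) :=
  {H of CompleteNormedModule R[i] H & isHilbert R H}.

Section complex_hilbert.
Variable R : realType.

Definition cdot (x y : R[i]) : R[i] := x * Num.conj y.

Let cdot_bilinear : bilinear_for ( *%R : R[i] -> R[i] -> R[i])
  (Num.conj \; *%R : R[i] -> R[i] -> R[i]) cdot.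
Proof.
split=> [y a x z|x a y z] /=; rewrite /cdot.
  by rewrite mulrDl mulrA.
by rewrite rmorphD rmorphM/= mulrDr !mulrA [x * _]mulrC.
Qed.
HB.instance Definition _ :=
  @bilinear_isBilinear.Build R[i] R[i] R[i] R[i] _ _ cdot cdot_bilinear.

Let cdot_hermitian (x y : R[i]) :
  cdot x y = (-1) ^+ false * Num.conj (cdot y x).
Proof. by rewrite /cdot expr0 mul1r rmorphM/= conjCK mulrC. Qed.
HB.instance Definition _ := @isHermitianSesquilinear.Build R[i] R[i] false
  Num.conj cdot cdot_hermitian.

Let cdot_gt0 (x : R[i]) : x != 0 -> 0 < cdot x x.
Proof. by rewrite /cdot -normCK => x0; rewrite exprn_gt0// normr_gt0. Qed.
HB.instance Definition _ := @isDotProduct.Build R[i] R[i] cdot cdot_gt0.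

Let cdot_norm (x : R[i]) : cdot x x = `|x| ^+ 2.
Proof. by rewrite normCK. Qed.
HB.instance Definition _ := @isHilbert.Build R R[i] cdot cdot_norm.

End complex_hilbert.

Section hilbert_bases.
Context {R : realType} (H : hilbertType R).

Definition orthonormal_set (B : set H) :=
  (forall b, B b -> hdot b b = 1) /\
  (forall b c, B b -> B c -> b <> c -> hdot b c = 0).

Definition lin_span (B : set H) : set H :=
  [set x | exists (A : set H) (c : H -> R[i]),
    [/\ finite_set A, A `<=` B & x = \sum_(b \in A) c b *: b]].

Definition hilbert_basis (B : set H) :=
  orthonormal_set B /\ dense (lin_span B).

(* An arbitrary basis: the traces below do not depend on it. *)
Definition hbasis : set H := get hilbert_basis.

Definition separable_space := exists2 D : set H, countable D & dense D.

End hilbert_bases.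
Arguments hbasis {R} H.
Arguments separable_space {R} H.

(* Elements of {0, 1, ..., +oo} are represented in [option nat], with [None]
   for +oo; [below N n] is n < N. *)
Definition below (N : option nat) (n : nat) : bool :=
  if N is Some m then (n < m)%N else true.

Definition hilbert_dim {R : realType} (H : hilbertType R) (N : option nat) :=
  exists2 B : set H, hilbert_basis B & (B #= [set n | below N n])%card.

Section bounded_operators.
Context {R : realType}.

Definition bounded_op {H G : hilbertType R} (T : H -> G) :=
  linear T /\ continuous T.

Definition adjoint {H G : hilbertType R} (T : H -> G) : G -> H :=
  get [set S | forall x y, hdot (T x) y = hdot x (S y)].

Definition positive_op {H : hilbertType R} (T : H -> H) :=
  bounded_op T /\ forall x, 0 <= hdot (T x) x.

Definition sqrt_op {H : hilbertType R} (T : H -> H) : H -> H :=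
  get [set S | positive_op S /\ S \o S = T].

Definition abs_op {H G : hilbertType R} (T : H -> G) : H -> H :=
  sqrt_op (adjoint T \o T).

(* Trace, in [0, +oo], of a positive operator. *)
Definition trace_pos {H : hilbertType R} (T : H -> H) : \bar R :=
  \esum_(b in hbasis H) (complex.Re (hdot (T b) b))%:E.

(* The trace norm, with value +oo on every map which is not a trace-class
   operator (in particular on maps which are not bounded operators). *)
Definition trace_norm {H G : hilbertType R} (T : H -> G) : \bar R :=
  if `[< bounded_op T >] then trace_pos (abs_op T) else +oo%E.

Definition trace_class {H G : hilbertType R} (T : H -> G) :=
  (trace_norm T < +oo)%E.

Definition hilbert_schmidt {H G : hilbertType R} (T : H -> G) :=
  bounded_op T /\ (trace_pos (adjoint T \o T) < +oo)%E.

(* Sum of a summable family of real numbers. *)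
Definition rsum {I : choiceType} (D : set I) (a : I -> R) : R :=
  fine (\esum_(i in D) (Num.max (a i) 0)%:E) -
  fine (\esum_(i in D) (Num.max (- a i) 0)%:E).

(* Trace of a trace-class operator. *)
Definition trace {H : hilbertType R} (T : H -> H) : R[i] :=
  rsum (hbasis H) (fun b => complex.Re (hdot (T b) b)) +i*
  rsum (hbasis H) (fun b => complex.Im (hdot (T b) b)).

Definition tensor {H G : hilbertType R} (x : G) (y : H) : H -> G :=
  fun z => hdot z y *: x.

Definition dual_vec {H : hilbertType R} (x : H) : H -> R[i] :=
  fun z => hdot z x.

End bounded_operators.

Section bochner.
Context {R : realType} {d : measure_display} {L : measurableType d}.
(* The Banach space is given as the subspace [set v | N v < +oo] of V, with
   norm N. *)
Context {V : lmodType R[i]} (N : V -> \bar R).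
Implicit Types (mu : set L -> \bar R) (g : L -> V) (A : set L) (v : V).

Definition simple_integrable mu (s : L -> V) :=
  [/\ finite_set (range s), forall v, measurable (s @^-1` [set v]),
      forall l, (N (s l) < +oo)%E &
      forall v, v != 0 -> (mu (s @^-1` [set v]) < +oo)%E].

Definition simple_integral mu A (s : L -> V) : V :=
  \sum_(v \in range s) (fine (mu (A `&` s @^-1` [set v])))%:C *: v.

Definition bochner_approx mu g (s : nat -> L -> V) :=
  [/\ forall n, simple_integrable mu (s n),
      {ae mu, forall l, N (s n l - g l) @[n --> \oo] --> (0 : \bar R)} &
      (\int[mu]_l N (s n l - g l))%E @[n --> \oo] --> (0 : \bar R)].

Definition bochner_integrable mu g := exists s, bochner_approx mu g s.

Definition is_bochner_integral mu A g v :=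
  exists2 s, bochner_approx mu g s &
    N (simple_integral mu A (s n) - v) @[n --> \oo] --> (0 : \bar R).

End bochner.

Section povm.
Context {R : realType} {d : measure_display} {L : measurableType d}.
Context {H : hilbertType R}.

Definition tc_povm (nu : set L -> H -> H) :=
  (forall A, measurable A -> positive_op (nu A) /\ trace_class (nu A)) /\
  (forall F : nat -> set L, (forall n, measurable (F n)) -> trivIset setT F ->
    forall x y : H, \sum_(0 <= k < n) hdot (nu (F k) x) y @[n --> \oo] -->
      (hdot (nu (\bigcup_n F n) x) y : R[i])).

Definition povm_variation (nu : set L -> H -> H) : set L -> \bar R :=
  fun A => trace_norm (nu A).

Definition is_density (nu : set L -> H -> H) (mu : set L -> \bar R)
    (g : L -> H -> H) :=
  bochner_integrable trace_norm mu g /\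
  forall A, measurable A -> is_bochner_integral trace_norm mu A g (nu A).

(* A representative of the density of nu with respect to its variation. *)
Definition rn_density (nu : set L -> H -> H) : L -> H -> H :=
  get (is_density nu (povm_variation nu)).

End povm.

Section square_integrable.
Context {R : realType}.

(* The values of [opval Q] outside [opdom Q] are irrelevant. *)
Record partial_op (H G : hilbertType R) := PartialOp {
  opdom : set H ;
  opval : H -> G }.

Definition linear_op {H G : hilbertType R} (Q : partial_op H G) :=
  opdom Q 0 /\
  forall (a : R[i]) x y, opdom Q x -> opdom Q y ->
    opdom Q (a *: x + y) /\ opval Q (a *: x + y) = a *: opval Q x + opval Q y.

Definition total_op {H G : hilbertType R} (T : H -> G) : partial_op H G :=
  PartialOp setT T.

Definition sub_op {H G : hilbertType R} (P Q : partial_op H G) :=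
  PartialOp (opdom P `&` opdom Q) (opval P - opval Q).

Context {d : measure_display} {L : measurableType d}.

Definition borel_measurable {H : hilbertType R} (f : L -> H) :=
  measurable_fun setT (f : L -> g_sigma_algebraType (@open H)).

Definition O_measurable {H G : hilbertType R} (Phi : L -> partial_op H G) :=
  [/\ forall l, linear_op (Phi l),
      forall x, measurable [set l | opdom (Phi l) x] &
      exists T : nat -> L -> H -> G,
        [/\ forall n l, bounded_op (T n l),
            forall n x, borel_measurable (fun l => T n l x) &
            forall l x, opdom (Phi l) x ->
              T n l x @[n --> \oo] --> opval (Phi l) x]].

Context {H G : hilbertType R} (nu : set L -> H -> H).
Implicit Types Phi Psi : L -> partial_op H G.

(* Phi f^(1/2), for f the density of nu with respect to its variation; this is
   meaningful where the range of f^(1/2) is included in the domain of Phi. *)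
Definition mul_sqrt_density Phi (l : L) : H -> G :=
  opval (Phi l) \o sqrt_op (rn_density nu l).

Definition gramian_density Phi Psi (l : L) : G -> G :=
  mul_sqrt_density Phi l \o adjoint (mul_sqrt_density Psi l).

Definition L2 Phi :=
  [/\ O_measurable Phi,
      {ae povm_variation nu, forall l,
        range (sqrt_op (rn_density nu l)) `<=` opdom (Phi l) /\
        hilbert_schmidt (mul_sqrt_density Phi l)} &
      bochner_integrable trace_norm (povm_variation nu)
        (gramian_density Phi Phi)].

Definition gramian Phi Psi : G -> G :=
  get (is_bochner_integral trace_norm (povm_variation nu) setT
    (gramian_density Phi Psi)).

Definition L2_dot Phi Psi : R[i] := trace (gramian Phi Psi).

Definition L2_norm Phi : R := Num.sqrt (fine (trace_norm (gramian Phi Phi))).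

(* Equality in the quotient by the elements of norm 0. *)
Definition L2_eq Phi Psi :=
  [/\ L2 Phi, L2 Psi & L2_norm (fun l => sub_op (Phi l) (Psi l)) = 0].

End square_integrable.

(* Main.v *)
From HB Require Import structures.
Require Import Defs.
From mathcomp Require Import all_boot all_order all_algebra complex.
From mathcomp Require Import all_classical all_reals all_analysis.
From mathcomp Require Import finmap zify ring lra measurable_realfun.
Set Implicit Arguments. Unset Strict Implicit. Unset Printing Implicit Defensive.
Import Order.TTheory GRing.Theory Num.Theory.
Import numFieldNormedType.Exports HBNNSimple.
Local Open Scope classical_set_scope.
Local Open Scope ring_scope.
Local Open Scope complex_scope.

(* The entries <nu(.) x, y> are complex measures dominated by the finite measure
   |nu|_1, so their scalar Radon-Nikodym derivatives exist.  Positivity of nu on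
   a countable family of test vectors makes the matrix of these derivatives, in
   an orthonormal basis, the matrix of a positive trace-class operator f0(l) for
   almost every l; f0 is the density of nu with respect to |nu|_1, and the one
   with respect to mu is the scalar multiple (d|nu|_1 / dmu) f0.  To diagonalize
   f0(l) by measurable functions of l, the top eigenvalue s is a supremum over a
   dense sequence, and the powers (f0 / s)^n converge strongly to the projector
   onto the top eigenspace.  The first basis vector with a nonzero image under
   this projector yields a measurable unit eigenvector; subtracting the
   corresponding rank-one operator and iterating exhausts f0(l).  Once its
   eigenvalue vanishes, f0(l) is replaced by the projector onto the orthogonal
   complement of the vectors found so far, so that the sequence becomes a basis.
   The Gramian densities of (iv)-(vi) are M f0 M'^H for uniformly bounded
   operator families M and M', and vanish because f0 phi_n = s_n phi_n. *)

(** * Real and complex inner products *)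

(** Several objects ([adjoint], [sqrt_op], [hbasis], [rn_density], [gramian]) are selected by [get]:
    existence has to be proved before anything is known about them, and uniqueness wherever the
    value itself matters. The trace norm, defined through a square root, is hard to estimate
    directly, even for a sum of two operators; upper bounds go through the dual quantity
    [nuclear_le], tested on pairs of orthonormal sequences, which is additive in the operator and
    passes under integrals. A Bochner integrable g carries no measurability a priori, so Bochner
    integrals and densities are identified through the scalar functions [rdot (g l x) y].
    Compactness of f0(l) is replaced by the finiteness of its trace: if the limit of the powers
    vanished on a basis, some power would be a strict contraction, against the choice of the top
    eigenvalue. The number of nonzero vectors produced must be the dimension for every l, which is
    obtained by counting squared norms in two orthonormal sequences. Finite and infinite dimension
    are treated together by padding with zero vectors. *)

Section real_inner_product.
Context {R : realType} {H : hilbertType R}.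
Implicit Types (x y z : H) (c : R[i]) (r : R).

(** The imaginary part of [hdot x y] is [rdot x ('i *: y)], so limits, measurability and integrals
    need only be treated for real-valued functions. *)
Definition rdot x y : R := complex.Re (hdot x y).
(** The norm of [H] has its values in [R[i]]; its square, read as a real number, replaces it
    throughout. *)
Definition sqn x : R := rdot x x.
Definition csq c : R := complex.Re c ^+ 2 + complex.Im c ^+ 2.

Lemma hdotC x y : hdot x y = (hdot y x)^*.
Proof. by rewrite hermC /= expr0 mul1r. Qed.

Lemma hdotxx x : hdot x x = (sqn x)%:C.
Proof.
have := dnorm_ge0 (@hdot _ H) x; rewrite /sqn /rdot.
by case: (hdot x x) => a b; rewrite lecE/= => /andP[/eqP ->].
Qed.

Lemma hdotDl x y z : hdot (x + y) z = hdot x z + hdot y z.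
Proof. exact: linearDl. Qed.
Lemma hdotDr x y z : hdot x (y + z) = hdot x y + hdot x z.
Proof. exact: linearDr. Qed.
Lemma hdotZl c x y : hdot (c *: x) y = c * hdot x y.
Proof. exact: linearZl_LR. Qed.
Lemma hdotZr c x y : hdot x (c *: y) = c^* * hdot x y.
Proof. exact: linearZr_LR. Qed.
Lemma hdot0l y : hdot 0 y = 0. Proof. exact: linear0l. Qed.
Lemma hdot0r x : hdot x 0 = 0. Proof. exact: linear0r. Qed.
Lemma hdotNl x y : hdot (- x) y = - hdot x y. Proof. exact: linearNl. Qed.
Lemma hdotNr x y : hdot x (- y) = - hdot x y. Proof. exact: linearNr. Qed.
Lemma hdotBl x y z : hdot (x - y) z = hdot x z - hdot y z.
Proof. exact: linearBl. Qed.
Lemma hdotBr x y z : hdot x (y - z) = hdot x y - hdot x z.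
Proof. exact: linearBr. Qed.
Lemma hdot_suml I s (P : pred I) (F : I -> H) y :
  hdot (\sum_(i <- s | P i) F i) y = \sum_(i <- s | P i) hdot (F i) y.
Proof. exact: linear_sumlz. Qed.
Lemma hdot_sumr I s (P : pred I) (F : I -> H) x :
  hdot x (\sum_(i <- s | P i) F i) = \sum_(i <- s | P i) hdot x (F i).
Proof. exact: linear_sumr. Qed.

Lemma rdotC x y : rdot x y = rdot y x.
Proof. by rewrite /rdot hdotC; case: (hdot y x). Qed.
Lemma rdotDl x y z : rdot (x + y) z = rdot x z + rdot y z.
Proof. by rewrite /rdot hdotDl raddfD. Qed.
Lemma rdotDr x y z : rdot x (y + z) = rdot x y + rdot x z.
Proof. by rewrite /rdot hdotDr raddfD. Qed.
Lemma rdotNl x y : rdot (- x) y = - rdot x y.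
Proof. by rewrite /rdot hdotNl raddfN. Qed.
Lemma rdotNr x y : rdot x (- y) = - rdot x y.
Proof. by rewrite /rdot hdotNr raddfN. Qed.
Lemma rdotBl x y z : rdot (x - y) z = rdot x z - rdot y z.
Proof. by rewrite rdotDl rdotNl. Qed.
Lemma rdotBr x y z : rdot x (y - z) = rdot x y - rdot x z.
Proof. by rewrite rdotDr rdotNr. Qed.
Lemma rdot0l x : rdot 0 x = 0. Proof. by rewrite /rdot hdot0l. Qed.
Lemma rdot0r x : rdot x 0 = 0. Proof. by rewrite /rdot hdot0r. Qed.
Lemma rdotZl r x y : rdot (r%:C *: x) y = r * rdot x y.
Proof. by rewrite /rdot hdotZl; case: (hdot x y) => a b /=; rewrite mul0r subr0. Qed.
Lemma rdotZr r x y : rdot x (r%:C *: y) = r * rdot x y.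
Proof. by rewrite rdotC rdotZl rdotC. Qed.
Lemma rdot_suml I s (P : pred I) (F : I -> H) y :
  rdot (\sum_(i <- s | P i) F i) y = \sum_(i <- s | P i) rdot (F i) y.
Proof. by rewrite /rdot hdot_suml raddf_sum. Qed.
Lemma rdot_sumr I s (P : pred I) (F : I -> H) x :
  rdot x (\sum_(i <- s | P i) F i) = \sum_(i <- s | P i) rdot x (F i).
Proof. by rewrite /rdot hdot_sumr raddf_sum. Qed.

Lemma rdotiZl x y : rdot ('i *: x) y = - rdot x ('i *: y).
Proof. by rewrite /rdot hdotZl hdotZr; case: (hdot x y) => a b /=; ring. Qed.

Lemma hdotE x y : hdot x y = rdot x y +i* rdot x ('i *: y).
Proof.
rewrite /rdot hdotZr; case: (hdot x y) => a b /=.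
by apply/eqP; rewrite eq_complex /=; apply/andP; split; apply/eqP; ring.
Qed.

Lemma hdot_eq x y z t : rdot x y = rdot z t ->
  rdot x ('i *: y) = rdot z ('i *: t) -> hdot x y = hdot z t.
Proof. by move=> e1 e2; rewrite !hdotE e1 e2. Qed.

Lemma sqnE x : rdot x x = sqn x. Proof. by []. Qed.
Lemma sqn_ge0 x : 0 <= sqn x.
Proof. by rewrite -lecR -hdotxx dnorm_ge0. Qed.
Lemma sqn_eq0 x : (sqn x == 0) = (x == 0).
Proof. by rewrite -(dnorm_eq0 (@hdot _ H)) hdotxx -(inj_eq (@complexI R)). Qed.
Lemma sqn0 : sqn 0 = 0. Proof. by rewrite /sqn rdot0l. Qed.
Lemma sqn_gt0 x : (0 < sqn x) = (x != 0).
Proof. by rewrite lt_neqAle sqn_ge0 andbT eq_sym sqn_eq0. Qed.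
Lemma csq_ge0 c : 0 <= csq c.
Proof. by rewrite addr_ge0 ?sqr_ge0. Qed.
Lemma csqJ c : csq c^* = csq c.
Proof. by case: c => a b; rewrite /csq/= sqrrN. Qed.
Lemma csqR r : csq r%:C = r ^+ 2.
Proof. by rewrite /csq /= expr0n addr0. Qed.
Lemma csqi : csq 'i = 1 :> R.
Proof. by rewrite /csq /= expr0n add0r expr1n. Qed.
Lemma hdotZrR r x y : hdot x (r%:C *: y) = r%:C * hdot x y.
Proof. by rewrite hdotZr; congr (_ * _); exact: conjc_real. Qed.
Lemma csqE c : c * c^* = (csq c)%:C.
Proof.
by case: c => a b; apply/eqP; rewrite eq_complex /=; apply/andP; split;
  apply/eqP; rewrite /csq /=; ring.
Qed.
Lemma sqnZ c x : sqn (c *: x) = csq c * sqn x.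
Proof.
apply: (@complexI R); rewrite -hdotxx hdotZl hdotZr mulrA hdotxx csqE.
by rewrite rmorphM.
Qed.
Lemma sqnZr r x : sqn (r%:C *: x) = r ^+ 2 * sqn x.
Proof. by rewrite sqnZ csqR. Qed.
Lemma sqnN x : sqn (- x) = sqn x.
Proof. by rewrite /sqn rdotNl rdotNr opprK. Qed.
Lemma sqnD x y : sqn (x + y) = sqn x + 2 * rdot x y + sqn y.
Proof. by rewrite /sqn rdotDl !rdotDr (rdotC y x); ring. Qed.
Lemma sqnB x y : sqn (x - y) = sqn x - 2 * rdot x y + sqn y.
Proof. by rewrite sqnD rdotNr sqnN; ring. Qed.
Lemma sqnBC x y : sqn (x - y) = sqn (y - x).
Proof. by rewrite -sqnN opprB. Qed.
Lemma sqnD_le x y : sqn (x + y) <= 2 * (sqn x + sqn y).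
Proof. by have := sqn_ge0 (x - y); rewrite sqnB sqnD; lra. Qed.
Lemma sqnB_le x y : sqn (x - y) <= 2 * (sqn x + sqn y).
Proof. by rewrite -(sqnN y) sqnD_le. Qed.
Lemma rdot_le x y : rdot x y <= (sqn x + sqn y) / 2.
Proof. by have := sqn_ge0 (x - y); rewrite sqnB; lra. Qed.
Lemma rdot_norm_le x y : `|rdot x y| <= (sqn x + sqn y) / 2.
Proof.
by rewrite ler_norml rdot_le andbT lerNl -rdotNl (le_trans (rdot_le _ _))// sqnN.
Qed.

End real_inner_product.

(** Source of the three Cauchy-Schwarz inequalities below: for vectors, for the form of a positive
    operator and for finite families. The quadratic polynomial is tested at its minimum
    [- b / c]. *)
Lemma discr_le {R : realType} (a b c : R) : 0 <= a -> 0 <= c ->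
  (forall t, 0 <= a + 2 * t * b + t ^+ 2 * c) -> b ^+ 2 <= a * c.
Proof.
move=> a0; rewrite le_eqVlt => /predU1P[<- h|c0 h].
  rewrite mulr0; have [->|b0] := eqVneq b 0; first by rewrite expr0n.
  (* With [c = 0] the polynomial is affine in [t], and its value at this point is [-1]. *)
  have := h (- (a + 1) / (2 * b)).
  have -> : 2 * (- (a + 1) / (2 * b)) * b = - (a + 1) by field.
  by rewrite mulr0; lra.
have := h (- b / c).
have -> : a + 2 * (- b / c) * b + (- b / c) ^+ 2 * c = a - b ^+ 2 / c.
  by field; rewrite gt_eqF.
by rewrite subr_ge0 ler_pdivrMr.
Qed.

(** * Cauchy-Schwarz inequality and convergence in squared norm *)

Section hilbert_topology.
Context {R : realType} {H : hilbertType R}.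
Implicit Types (x y z : H) (c : R[i]) (r : R).

Lemma CS_rdot x y : rdot x y ^+ 2 <= sqn x * sqn y.
Proof.
apply: discr_le; rewrite ?sqn_ge0// => t.
by have := sqn_ge0 (x + t%:C *: y); rewrite sqnD sqnZr rdotZr mulrA.
Qed.

Lemma CS_hdot x y : csq (hdot x y) <= sqn x * sqn y.
Proof.
have [->|c0] := eqVneq (csq (hdot x y)) 0; first by rewrite mulr_ge0 ?sqn_ge0.
have {}c0 : 0 < csq (hdot x y) by rewrite lt_neqAle eq_sym c0 csq_ge0.
(* The factor [hdot x y] rotates [y] so that the real part of the product becomes the squared
   modulus. *)
have := CS_rdot x (hdot x y *: y).
have -> : rdot x (hdot x y *: y) = csq (hdot x y).
  by rewrite /rdot hdotZr mulrC csqE.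
by rewrite sqnZ mulrCA expr2 ler_pM2l.
Qed.

Lemma normE x : `|x| = (Num.sqrt (sqn x))%:C.
Proof.
have h : 0 <= (Num.sqrt (sqn x))%:C :> R[i] by rewrite lecR sqrtr_ge0.
apply/eqP; rewrite -(@eqrXn2 _ 2) ?normr_ge0//.
by rewrite -hdot_norm hdotxx -rmorphXn/= sqr_sqrtr ?sqn_ge0 ?eqxx.
Qed.

Lemma cvg_sqnP {T : Type} {F : set_system T} {FF : Filter F} (u : T -> H) x :
  u t @[t --> F] --> x <-> sqn (u t - x) @[t --> F] --> (0 : R).
Proof.
split.
  move=> /cvgrPdist_lt h; apply/cvgrPdist_lt => e e0.
  have [e1 e10 e1e] : exists2 e1 : R, 0 < e1 & e1 ^+ 2 <= e.
    exists (Num.sqrt e); first by rewrite sqrtr_gt0.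
    by rewrite sqr_sqrtr // ?ltW.
  have := h e1%:C; rewrite ltcR => /(_ e10); apply: filterS => t.
  rewrite normE ltcR sub0r normrN (ger0_norm (sqn_ge0 _)) sqnBC => ht.
  apply: lt_le_trans e1e; rewrite -(sqr_sqrtr (sqn_ge0 _)).
  by rewrite ltrXn2r// ?nnegrE ?sqrtr_ge0// ltW.
move=> /cvgrPdist_lt h; apply/cvgrPdist_lt => -[e1 e2].
(* A positive element of [R[i]] is real. *)
rewrite ltcE/= => /andP[/eqP -> e0].
have := h (e1 ^+ 2); rewrite exprn_gt0// => /(_ isT); apply: filterS => t.
rewrite sub0r normrN (ger0_norm (sqn_ge0 _)) sqnBC => ht.
rewrite normE ltcR.
by rewrite -(@ltr_pXn2r _ 2)// ?nnegrE ?sqrtr_ge0 ?(ltW e0)// sqr_sqrtr ?sqn_ge0.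
Qed.

End hilbert_topology.

Lemma eq_cvg_seq {T : topologicalType} (f g : nat -> T) (l : T) : f =1 g ->
  f n @[n --> \oo] --> l -> g n @[n --> \oo] --> l.
Proof. by move=> /funext ->. Qed.

Section real_sequences.
Context {R : realType}.
Implicit Types (a b : nat -> R) (x y : R).

Lemma cvg_squeeze0 a b : (forall n, 0 <= a n <= b n) ->
  b n @[n --> \oo] --> (0 : R) -> a n @[n --> \oo] --> (0 : R).
Proof.
move=> ab b0; apply: (@squeeze_cvgr _ _ _ _ (cst 0) b) => //; last exact: cvg_cst.
by near=> n; exact: ab.
Unshelve. all: by end_near. Qed.

Lemma sqr_cvg0 a b : (forall n, a n ^+ 2 <= b n) ->
  b n @[n --> \oo] --> (0 : R) -> a n @[n --> \oo] --> (0 : R).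
Proof.
move=> ab /cvgrPdist_lt b0; apply/cvgrPdist_lt => e e0.
have := b0 (e ^+ 2); rewrite exprn_gt0// => /(_ isT); apply: filterS => n.
have bn0 : 0 <= b n by apply: le_trans (ab n); exact: sqr_ge0.
rewrite !sub0r !normrN (ger0_norm bn0) => bne.
rewrite -(@ltr_pXn2r _ 2)// ?nnegrE// ?(ltW e0)//.
by rewrite real_normK ?num_real// (le_lt_trans (ab n)).
Qed.

Lemma cvg_eps0 a : (forall n, 0 <= a n) ->
  (forall e, 0 < e -> exists N, forall n, (N <= n)%N -> a n <= e) ->
  a n @[n --> \oo] --> (0 : R).
Proof.
move=> a0 h; apply/cvgrPdist_le => e e0; have [N hN] := h e e0.
by exists N => // n /hN; rewrite sub0r normrN ger0_norm.
Qed.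

Lemma eps_cvg0 a e : a n @[n --> \oo] --> (0 : R) -> 0 < e ->
  exists N, forall n, (N <= n)%N -> a n <= e.
Proof.
move=> /cvgrPdist_le h /h[N _ hN]; exists N => n /hN /=.
by rewrite sub0r normrN => /ler_normlP[].
Qed.

Lemma cauchy_real a e : cvgn a -> 0 < e ->
  exists N, forall m n, (N <= m)%N -> (N <= n)%N -> `|a m - a n| <= e.
Proof.
move=> /cvg_ex[l /cvgrPdist_le] /(_ (e / 2)) h e0.
have [|N _ hN] := h; first by rewrite divr_gt0.
exists N => m n /hN/= hm /hN/= hn.
rewrite (_ : a m - a n = (l - a n) - (l - a m)); last by ring.
by rewrite (le_trans (ler_normB _ _))// [e]splitr lerD.
Qed.

Lemma le_lim_seq a b x y : a n @[n --> \oo] --> x -> b n @[n --> \oo] --> y ->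
  (forall n, a n <= b n) -> x <= y.
Proof.
by move=> ax by_ ab; apply: (ler_cvg_to ax by_); exact: nearW.
Qed.

Lemma cvg_R_uniq a x y : a n @[n --> \oo] --> x -> a n @[n --> \oo] --> y ->
  x = y.
Proof. by move=> ax ay; exact: (@norm_cvg_unique _ _ (a @ \oo)). Qed.

Lemma cvg_sum_seq n (u : nat -> nat -> R) (l : nat -> R) :
  (forall k, u k m @[m --> \oo] --> l k) ->
  \sum_(0 <= k < n) u k m @[m --> \oo] --> \sum_(0 <= k < n) l k.
Proof.
move=> ul; elim: n => [|n ih].
  by under eq_fun do rewrite big_geq//; rewrite big_geq//; exact: cvg_cst.
under eq_fun do rewrite big_nat_recr//=.
by rewrite big_nat_recr//=; exact: cvgD.
Qed.

End real_sequences.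

Section hilbert_limits.
Context {R : realType} {H : hilbertType R}.
Implicit Types (x y z : H) (u v : nat -> H).

Lemma csqnP u x :
  (u n @[n --> \oo] --> x) <-> (sqn (u n - x) @[n --> \oo] --> (0 : R)).
Proof. exact: cvg_sqnP. Qed.

Lemma cvg_H_uniq u x y : u n @[n --> \oo] --> x ->
  u n @[n --> \oo] --> y -> x = y.
Proof. by move=> ux uy; exact: (@norm_cvg_unique _ _ (u @ \oo)). Qed.

Lemma cvg_rdotl u x y : u n @[n --> \oo] --> x ->
  rdot (u n) y @[n --> \oo] --> rdot x y.
Proof.
move=> /csqnP ux; apply/subr_cvg0.
apply: (@sqr_cvg0 _ _ (fun n => sqn (u n - x) * sqn y)).
  by move=> n; rewrite -rdotBl CS_rdot.
by rewrite -(mul0r (sqn y)); apply: cvgM => //; exact: cvg_cst.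
Qed.

Lemma cvg_rdotr u x y : u n @[n --> \oo] --> x ->
  rdot y (u n) @[n --> \oo] --> rdot y x.
Proof.
move=> /cvg_rdotl h; rewrite rdotC.
by under eq_fun do rewrite rdotC; exact: h.
Qed.

Lemma cvg_sqn u x : u n @[n --> \oo] --> x ->
  sqn (u n) @[n --> \oo] --> sqn x.
Proof.
move=> ux; rewrite (_ : sqn x = 0 + 2 * rdot x x - sqn x); last first.
  by rewrite sqnE; ring.
rewrite (_ : (fun n => sqn (u n)) =
  (fun n => sqn (u n - x) + 2 * rdot (u n) x - sqn x)); last first.
  by apply/funext => n; rewrite sqnB; ring.
apply: cvgB; last exact: cvg_cst.
apply: cvgD; first exact/csqnP.
by apply: cvgM; [exact: cvg_cst|exact: cvg_rdotl].
Qed.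

(** Bounded monotone sequences serve as [a]: partial sums of squared coefficients, norms of
    iterates, moments of an operator. The bound is on the squared distance, as orthogonality
    provides it. *)
Lemma sqn_cauchy_cvg u (a : nat -> R) : cvgn a ->
  (forall m n, (m <= n)%N -> sqn (u n - u m) <= `|a n - a m|) ->
  exists x, u n @[n --> \oo] --> x.
Proof.
move=> ca ua; apply/cvg_ex; apply: cauchy_cvg; apply/cauchyP => -[e1 e2].
rewrite ltcE/= => /andP[/eqP -> e0].
have e20 : 0 < e1 ^+ 2 / 2 by rewrite divr_gt0// exprn_gt0.
have [N hN] := cauchy_real ca e20.
exists (u N); exists N => // n /= Nn; rewrite -ball_normE /=.
rewrite normE ltcR -(@ltr_pXn2r _ 2)// ?nnegrE ?sqrtr_ge0 ?(ltW e0)//.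
rewrite sqr_sqrtr ?sqn_ge0// sqnBC (le_lt_trans (ua _ _ Nn))//.
by rewrite (le_lt_trans (hN _ _ Nn (leqnn _)))// ltr_pdivrMr// ltr_pMr ?exprn_gt0// ltr1n.
Qed.

End hilbert_limits.

(** * Bounded linear operators *)

Section bounded_linear.
Context {R : realType}.

(** Here [M] bounds the square of the operator norm. *)
Definition sqn_bounded {H G : hilbertType R} (T : H -> G) (M : R) :=
  forall x, sqn (T x) <= M * sqn x.

Section linear_maps.
Context {H G : hilbertType R} (T : H -> G) (linT : linear T).

Lemma linD x y : T (x + y) = T x + T y.
Proof. by have := linT 1 x y; rewrite !scale1r. Qed.
Lemma lin0 : T 0 = 0.
Proof. by have := linT (-1) 0 0; rewrite !scaleN1r !addNr. Qed.
Lemma linZ c x : T (c *: x) = c *: T x.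
Proof. by have := linT c x 0; rewrite !addr0 lin0 addr0. Qed.
Lemma linN x : T (- x) = - T x.
Proof. by rewrite -scaleN1r linZ scaleN1r. Qed.
Lemma linB x y : T (x - y) = T x - T y.
Proof. by rewrite linD linN. Qed.
Lemma lin_sum I s (P : pred I) (F : I -> H) :
  T (\sum_(i <- s | P i) F i) = \sum_(i <- s | P i) T (F i).
Proof.
elim/big_rec2: _ => [|i y z _ <-]; first exact: lin0.
by rewrite linD.
Qed.

Lemma sqn_bounded_cvg M u x : sqn_bounded T M -> u n @[n --> \oo] --> x ->
  T (u n) @[n --> \oo] --> T x.
Proof.
move=> TM /csqnP ux; apply/csqnP.
apply: (@cvg_squeeze0 _ _ (fun n => M * sqn (u n - x))).
  by move=> n; rewrite sqn_ge0 -linB TM.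
by rewrite -(mulr0 M); apply: cvgM => //; exact: cvg_cst.
Qed.

Lemma bounded_opP : bounded_op T <-> exists2 M, 0 <= M & sqn_bounded T M.
Proof.
split=> [[_ cT]|[M M0 TM]].
  have /cvgrPdist_lt/(_ 1 ltr01)/nbhs_ballP[[e1 e2] /=] := cT 0.
  rewrite ltcE/= => /andP[/eqP -> e0] he.
  pose M := 4 / e1 ^+ 2; exists M; first by rewrite divr_ge0// sqr_ge0.
  move=> x; have [->|x0] := eqVneq x 0.
    by rewrite lin0 !sqn0 mulr0.
  have nx0 : 0 < Num.sqrt (sqn x) by rewrite sqrtr_gt0 sqn_gt0.
  (* Scaling by [r] gives [x] the norm [e1 / 2], inside the ball that [T] sends into the unit ball;
     this explains [M = 4 / e1 ^+ 2]. *)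
  pose r := e1 / (2 * Num.sqrt (sqn x)).
  have r0 : 0 < r by rewrite divr_gt0// mulr_gt0.
  have r2 : r ^+ 2 * sqn x = e1 ^+ 2 / 4.
    rewrite /r exprMn exprVn exprMn sqr_sqrtr ?sqn_ge0//; field.
    by rewrite sqn_eq0.
  have := he (r%:C *: x); rewrite -ball_normE /= sub0r normrN normE ltcR.
  rewrite sqnZr r2 lin0 sub0r normrN linZ normE ltcR.
  rewrite -[X in X < e1 -> _]ger0_norm ?sqrtr_ge0// .
  have -> : `|Num.sqrt (e1 ^+ 2 / 4)| < e1.
    rewrite ger0_norm ?sqrtr_ge0// -(@ltr_pXn2r _ 2)// ?nnegrE ?sqrtr_ge0 ?(ltW e0)//.
    by rewrite sqr_sqrtr ?divr_ge0 ?sqr_ge0// ltr_pdivrMr// ltr_pMr ?exprn_gt0// ltr1n.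
  move=> /(_ isT) h1.
  have h2 : r ^+ 2 * sqn (T x) < 1.
    rewrite -sqnZr -(sqr_sqrtr (sqn_ge0 _)) -[ltRHS](expr1n R 2).
    by rewrite ltr_pXn2r ?nnegrE ?sqrtr_ge0//.
  have -> : M * sqn x = 1 / r ^+ 2.
    rewrite (_ : sqn x = e1 ^+ 2 / 4 / r ^+ 2).
      by rewrite /M; field; rewrite !gt_eqF.
    by rewrite -r2; field; rewrite gt_eqF.
  by rewrite ler_pdivlMr ?exprn_gt0// mulrC ltW.
split=> // x; apply/cvg_sqnP.
have : sqn (t - x) @[t --> x] --> (0 : R) by apply/cvg_sqnP; exact: cvg_id.
move=> /cvgrPdist_lt h; apply/cvgrPdist_lt => e e0.
have e1 : 0 < e / (M + 1) by rewrite divr_gt0// ltr_wpDl.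
have := h _ e1; apply: filterS => t.
rewrite !sub0r !normrN !(ger0_norm (sqn_ge0 _)) -linB => ht.
rewrite (le_lt_trans (TM _))// (@le_lt_trans _ _ ((M + 1) * sqn (t - x)))//.
  by rewrite ler_wpM2r ?sqn_ge0// lerDl.
by rewrite mulrC -ltr_pdivlMr// ltr_wpDl.
Qed.

End linear_maps.

Lemma bounded_op_ex {H G : hilbertType R} (T : H -> G) :
  bounded_op T -> exists2 M, 0 <= M & sqn_bounded T M.
Proof. by move=> [lT cT]; exact/bounded_opP. Qed.

Lemma bounded_op_cvg {H G : hilbertType R} (T : H -> G) u x :
  bounded_op T -> u n @[n --> \oo] --> x -> T (u n) @[n --> \oo] --> T x.
Proof.
move=> bT; have [M _ TM] := bounded_op_ex bT.
by apply: sqn_bounded_cvg TM; case: bT.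
Qed.

End bounded_linear.

(** * Orthonormal sequences *)

Section finite_orthonormal.
Context {R : realType} {H : hilbertType R}.
Variables (I : eqType) (s : seq I) (e : I -> H).
Hypothesis (us : uniq s) (es : forall i j, i \in s -> j \in s ->
  hdot (e i) (e j) = ((i == j) && (e j != 0))%:R).
Implicit Types (x y z : H) (c : I -> R[i]).

Lemma rdot_comb x c :
  rdot x (\sum_(i <- s) c i *: e i) = \sum_(i <- s) complex.Re (hdot x (e i) * (c i)^*).
Proof.
by rewrite rdot_sumr; apply: eq_bigr => i _; rewrite /rdot hdotZr mulrC.
Qed.

Lemma hdot_comb c j : j \in s ->
  hdot (\sum_(i <- s) c i *: e i) (e j) = c j * (e j != 0)%:R.
Proof.
move=> js; rewrite hdot_suml (bigD1_seq j)//= hdotZl es// eqxx/=.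
rewrite big_seq_cond big1 ?addr0// => i /andP[si ij].
by rewrite hdotZl es// (negbTE ij) mulr0.
Qed.

Lemma sqn_comb c :
  sqn (\sum_(i <- s) c i *: e i) = \sum_(i <- s) csq (c i) * (e i != 0)%:R.
Proof.
rewrite -sqnE rdot_comb big_seq [RHS]big_seq; apply: eq_bigr => i si.
rewrite hdot_comb// mulrAC csqE; case: (e i != 0); rewrite ?mulr1//.
by rewrite !mulr0.
Qed.

Lemma sqn_comb_le c :
  sqn (\sum_(i <- s) c i *: e i) <= \sum_(i <- s) csq (c i).
Proof.
rewrite sqn_comb; apply: ler_sum => i _.
by case: (e i != 0); rewrite ?mulr1// mulr0 csq_ge0.
Qed.

Lemma csq_hdot_ne0 x i : csq (hdot x (e i)) * (e i != 0)%:R = csq (hdot x (e i)).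
Proof.
by have [->|] := eqVneq (e i) 0; rewrite ?mulr1// hdot0r mulr0 csqR expr0n.
Qed.

Lemma sqn_sub_comb x : let p := \sum_(i <- s) hdot x (e i) *: e i in
  sqn (x - p) = sqn x - \sum_(i <- s) csq (hdot x (e i)).
Proof.
move=> p; rewrite sqnB /p sqn_comb rdot_comb.
under [X in _ + X]eq_bigr do rewrite csq_hdot_ne0.
under [X in _ - _ * X]eq_bigr do rewrite csqE/=.
ring.
Qed.

Lemma bessel x : \sum_(i <- s) csq (hdot x (e i)) <= sqn x.
Proof. by rewrite -subr_ge0 -sqn_sub_comb sqn_ge0. Qed.

(** Term by term, where [e i] is nonzero, the right side exceeds the left one by the squared modulus
    of [hdot x (e i) - c i]. *)
Lemma best_approx x c :
  sqn x - \sum_(i <- s) csq (hdot x (e i)) <= sqn (x - \sum_(i <- s) c i *: e i).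
Proof.
rewrite sqnB sqn_comb rdot_comb -addrA lerD2l mulr_sumr -sumrN -sumrN -big_split/=.
apply: ler_sum => i _; have [->|e0] := eqVneq (e i) 0.
  by rewrite hdot0r mul0r/= !mulr0 csqR expr0n oppr0 addr0.
rewrite mulr1; case: (hdot x (e i)) (c i) => [a b] [u v].
rewrite /csq/= -subr_ge0.
rewrite (_ : _ - _ = (a - u) ^+ 2 + (b - v) ^+ 2); last by ring.
by rewrite addr_ge0 ?sqr_ge0.
Qed.

End finite_orthonormal.

(* Orthonormal sequences may be padded with zero vectors, so that finite and
   infinite families are treated alike. *)
Definition ons {R : realType} {H : hilbertType R} (e : nat -> H) :=
  forall m n, hdot (e m) (e n) = ((m == n) && (e n != 0))%:R.

Definition onb {R : realType} {H : hilbertType R} (e : nat -> H) :=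
  ons e /\ forall x, (forall n, hdot x (e n) = 0) -> x = 0.

Section orthonormal_sequences.
Context {R : realType} {H : hilbertType R}.
Implicit Types (e : nat -> H) (x y : H) (c : nat -> R[i]).

Lemma ons_sqn e n : ons e -> sqn (e n) = (e n != 0)%:R.
Proof.
by move=> oe; have := oe n n; rewrite hdotxx eqxx/= => /(@congr1 _ _ (@complex.Re R)) /= ->;
  case: (e n != 0).
Qed.

Lemma ons_sqn_le1 e n : ons e -> sqn (e n) <= 1.
Proof. by move=> oe; rewrite ons_sqn//; case: (e n != 0). Qed.

Lemma ons_bessel e x n : ons e -> \sum_(0 <= k < n) csq (hdot x (e k)) <= sqn x.
Proof. by move=> oe; apply: bessel => [|i j _ _]; rewrite ?iota_uniq. Qed.

Lemma ons_sqn_comb_le e c m n : ons e ->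
  sqn (\sum_(m <= k < n) c k *: e k) <= \sum_(m <= k < n) csq (c k).
Proof. by move=> oe; apply: sqn_comb_le => [|i j _ _]; rewrite ?iota_uniq. Qed.

Lemma bounded_series_cvg (a : nat -> R) M : (forall k, 0 <= a k) ->
  (forall n, \sum_(0 <= k < n) a k <= M) -> cvgn (fun n => \sum_(0 <= k < n) a k).
Proof.
move=> a0 aM; apply: nondecreasing_is_cvgn; last by exists M => _ [n _ <-].
exact: nondecreasing_series.
Qed.

Lemma ons_series_cvg e c M : ons e ->
  (forall n, \sum_(0 <= k < n) csq (c k) <= M) ->
  exists y, \sum_(0 <= k < n) c k *: e k @[n --> \oo] --> y.
Proof.
move=> oe cM; apply: (@sqn_cauchy_cvg _ _ _ (fun n => \sum_(0 <= k < n) csq (c k))).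
  by apply: bounded_series_cvg cM => k; exact: csq_ge0.
move=> m n mn; rewrite (big_cat_nat (n := m))//= [X in sqn (X - _)]addrC addrK.
rewrite [X in `|X - _|](big_cat_nat (n := m))//= [X in `|X - _|]addrC addrK.
by rewrite (le_trans (ons_sqn_comb_le _ _ _ oe))// ler_norm.
Qed.

Lemma cvg_hdot0 (u : nat -> H) x y : u n @[n --> \oo] --> x ->
  (exists N, forall n, (N <= n)%N -> hdot (u n) y = 0) -> hdot x y = 0.
Proof.
move=> ux [N uN].
suff h (z : H) : (forall n, (N <= n)%N -> rdot (u n) z = 0) -> rdot x z = 0.
  rewrite hdotE !h// => n /uN h0; last by rewrite /rdot h0.
  by rewrite /rdot hdotZr h0 mulr0.
move=> h0; apply: cvg_R_uniq (cvg_rdotl (y := z) ux) _.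
apply: cvg_near_cst; exists N => // n /= /h0 ->; exact: eqxx.
Qed.

Lemma ons_series_coef e c y j : ons e ->
  \sum_(0 <= k < n) c k *: e k @[n --> \oo] --> y ->
  hdot y (e j) = c j * (e j != 0)%:R.
Proof.
move=> oe cy; apply/eqP; rewrite -subr_eq0; apply/eqP.
have [->|ej] := eqVneq (e j) 0; first by rewrite hdot0r mulr0 subrr.
have -> : c j * true%:R = hdot (c j *: e j) (e j).
  by rewrite hdotZl oe eqxx ej.
rewrite -hdotBl; apply: (@cvg_hdot0 (fun n => \sum_(0 <= k < n) c k *: e k - c j *: e j)).
  by apply: cvgB => //; exact: cvg_cst.
exists j.+1 => n jn; rewrite hdotBl hdot_comb ?iota_uniq ?mem_index_iota//=.
  by rewrite hdotZl oe eqxx ej subrr.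
Qed.

Lemma onb_expansion e x : onb e ->
  \sum_(0 <= k < n) hdot x (e k) *: e k @[n --> \oo] --> x.
Proof.
move=> [oe ce].
have [y cy] := ons_series_cvg oe (fun n => ons_bessel x n oe).
suff yx : y = x by rewrite -{2}yx.
apply/eqP; rewrite -subr_eq0; apply/eqP/ce => j.
rewrite hdotBl (ons_series_coef j oe cy).
have [->|_] := eqVneq (e j) 0; first by rewrite hdot0r mulr0 subrr.
by rewrite mulr1 subrr.
Qed.

Lemma sqn_sub_part e x n : ons e ->
  sqn (x - \sum_(0 <= k < n) hdot x (e k) *: e k) =
  sqn x - \sum_(0 <= k < n) csq (hdot x (e k)).
Proof. by move=> oe; apply: sqn_sub_comb => [|i j _ _]; rewrite ?iota_uniq. Qed.

Lemma onb_parseval e x : onb e ->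
  \sum_(0 <= k < n) csq (hdot x (e k)) @[n --> \oo] --> sqn x.
Proof.
move=> oe; have /csqnP := @onb_expansion e x oe.
have oe1 := oe.1; under eq_fun do rewrite sqnBC sqn_sub_part//.
move=> h; rewrite -[sqn x]subr0.
apply: eq_cvg_seq (fun n => subKr (sqn x) _) _.
by apply: cvgB h; exact: cvg_cst.
Qed.

Lemma onb_eparseval e x : onb e ->
  (\sum_(0 <= k <oo) (csq (hdot x (e k)))%:E = (sqn x)%:E)%E.
Proof.
move=> oe; apply: cvg_lim => //.
under eq_fun do rewrite sumEFin.
by apply/fine_cvgP; split; [exact: nearW|exact: onb_parseval].
Qed.

Lemma dense_sqn (B : set H) x (r : R) : dense B -> 0 < r ->
  exists2 z, B z & sqn (x - z) < r.
Proof.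
move=> dB r0; have r1 : 0 < (Num.sqrt r)%:C by rewrite ltcR sqrtr_gt0.
have [||z [xz Bz]] := dB (ball x (Num.sqrt r)%:C).
- by exists x; exact: ballxx.
- exact: ball_open.
- exists z => //; move: xz; rewrite -ball_normE/= normE ltcR.
  by rewrite ltr_sqrt.
Qed.

(** One inequality is Bessel's. For the other, a combination of finitely many basis vectors close to
    [x] is no closer than the projection onto these vectors, whose coefficients therefore account
    for [sqn x] up to [e]. *)
Lemma basis_parseval (B : set H) x : hilbert_basis B ->
  (\esum_(b in B) (csq (hdot x b))%:E = (sqn x)%:E)%E.
Proof.
move=> [[B1 B0] dB].
have oB (A : set H) : finite_set A -> A `<=` B -> forall i j : H,
    i \in fset_set A -> j \in fset_set A ->
    hdot i j = ((i == j) && (j != 0))%:R.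
  move=> fA AB i j; rewrite !in_fset_set// => /set_mem/AB Bi /set_mem/AB Bj.
  have j0 : j != 0.
    apply/eqP => j0; have := B1 _ Bj; rewrite j0 hdot0l => /eqP.
    by rewrite eq_sym oner_eq0.
  by have [->|/eqP ij] := eqVneq i j; rewrite ?B1 ?j0// B0.
apply/eqP; rewrite eq_le; apply/andP; split.
  apply: ge_ereal_sup => _ [A [fA AB] <-].
  rewrite fsbig_finite//= sumEFin lee_fin.
  by apply: (@bessel _ _ _ _ id); [exact: fset_uniq|exact: oB].
apply/lee_addgt0Pr => e e0.
have [z [A [c [fA AB ->]]] xz] := @dense_sqn (lin_span B) x e dB e0.
have := @best_approx _ _ _ (fset_set A) id (fset_uniq _) (oB A fA AB) x c.
rewrite -[X in sqn (_ - X)]fsbig_finite//= => le1.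
apply: (@le_trans _ _ (\sum_(b <- fset_set A) csq (hdot x b) + e)%:E).
  by rewrite lee_fin -lerBlDl (le_trans le1)// ltW.
rewrite EFinD leeD2r// -sumEFin -fsbig_finite//=.
by apply: ereal_sup_ubound; exists A.
Qed.

End orthonormal_sequences.

(** * Adjoints, positive operators and square roots *)

Section adjoints.
Context {R : realType}.

Definition is_adjoint {H G : hilbertType R} (T : H -> G) (S : G -> H) :=
  forall x y, hdot (T x) y = hdot x (S y).

Lemma hdot_injr {H : hilbertType R} (x y : H) :
  (forall z, hdot z x = hdot z y) -> x = y.
Proof.
move=> h; apply/eqP; rewrite -subr_eq0 -sqn_eq0; apply/eqP.
by rewrite -sqnE /rdot hdotBr h subrr.
Qed.

Lemma hdot_injl {H : hilbertType R} (x y : H) :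
  (forall z, hdot x z = hdot y z) -> x = y.
Proof. by move=> h; apply: hdot_injr => z; rewrite hdotC h -hdotC. Qed.

Lemma rdot_injl {H : hilbertType R} (x y : H) :
  (forall z, rdot x z = rdot y z) -> x = y.
Proof. by move=> h; apply: hdot_injl => z; exact: hdot_eq. Qed.

Lemma is_adjoint_linear {H G : hilbertType R} (T : H -> G) S :
  is_adjoint T S -> linear T.
Proof.
by move=> TS c x y; apply: hdot_injl => z; rewrite hdotDl hdotZl !TS hdotDl hdotZl.
Qed.

Lemma is_adjointC {H G : hilbertType R} (T : H -> G) S :
  is_adjoint T S -> is_adjoint S T.
Proof. by move=> TS x y; rewrite hdotC -TS -hdotC. Qed.

Lemma is_adjoint_rdot {H G : hilbertType R} (T : H -> G) S :
  is_adjoint T S -> forall x y, rdot (T x) y = rdot x (S y).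
Proof. by move=> TS x y; rewrite /rdot TS. Qed.

Lemma rdot_is_adjoint {H G : hilbertType R} (T : H -> G) S : linear T ->
  (forall x y, rdot (T x) y = rdot x (S y)) -> is_adjoint T S.
Proof.
move=> lT TS x y; rewrite [LHS]hdotE [RHS]hdotE TS; congr (_ +i* _).
have := TS ('i *: x) y; rewrite linZ// !rdotiZl; exact: (@oppr_inj R).
Qed.

Lemma is_adjoint_uniq {H G : hilbertType R} (T : H -> G) S S' :
  is_adjoint T S -> is_adjoint T S' -> S = S'.
Proof.
by move=> h h'; apply/funext => y; apply: hdot_injr => z; rewrite -h -h'.
Qed.

(** Uniqueness identifies the adjoint chosen by [get] with any one exhibited. *)
Lemma adjointE {H G : hilbertType R} (T : H -> G) S :
  is_adjoint T S -> adjoint T = S.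
Proof.
move=> TS; apply: (@is_adjoint_uniq _ _ T) => //.
exact: (@getPex _ [set S | forall x y, hdot (T x) y = hdot x (S y)] (ex_intro _ S TS)).
Qed.

Lemma is_adjoint_comp {H G K : hilbertType R} (T : H -> G) S (T' : G -> K) S' :
  is_adjoint T S -> is_adjoint T' S' -> is_adjoint (T' \o T) (S \o S').
Proof. by move=> TS TS' x y /=; rewrite TS' TS. Qed.

Lemma is_adjoint_bounded {H G : hilbertType R} (T : H -> G) S M :
  0 <= M -> is_adjoint T S -> sqn_bounded T M -> sqn_bounded S M.
Proof.
move=> M0 TS TM y; have [->|Sy] := eqVneq (sqn (S y)) 0.
  by rewrite mulr_ge0// sqn_ge0.
have {}Sy : 0 < sqn (S y) by rewrite lt_neqAle eq_sym Sy sqn_ge0.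
have := CS_rdot (T (S y)) y; rewrite (is_adjoint_rdot TS) sqnE => h.
rewrite -(ler_pM2l Sy) -expr2 (le_trans h)// mulrA [sqn _ * M]mulrC.
by rewrite ler_wpM2r ?sqn_ge0.
Qed.

(** Riesz representation in coordinates: the adjoint at [y] has the coefficients [hdot y (T (e k))].
    A partial sum [s] of their squares equals [rdot y (T v)], with [v] the corresponding combination
    and [sqn v <= s]; Cauchy-Schwarz then gives [s ^+ 2 <= sqn y * (M * s)]. *)
Lemma adjoint_exists {H G : hilbertType R} (e : nat -> H) (T : H -> G) :
  onb e -> bounded_op T -> exists S, is_adjoint T S.
Proof.
move=> oe bT; have [M M0 TM] := bounded_op_ex bT; have lT := bT.1.
have Sy y : exists z, forall x, rdot (T x) y = rdot x z.
  pose c k := hdot y (T (e k)).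
  have [n|z cz] := @ons_series_cvg _ _ e c (M * sqn y) oe.1.
    set s := \sum_(_ <= _ < _) _; pose v := \sum_(0 <= k < n) c k *: e k.
    have s0 : 0 <= s by apply: sumr_ge0 => k _; exact: csq_ge0.
    have vs : sqn v <= s by exact: ons_sqn_comb_le oe.1.
    have yv : rdot y (T v) = s.
      rewrite lin_sum// rdot_sumr; apply: eq_bigr => k _.
      by rewrite linZ// /rdot hdotZr mulrC csqE.
    have [s00|s00] := eqVneq s 0; first by rewrite s00 mulr_ge0 ?sqn_ge0.
    have {}s0 : 0 < s by rewrite lt_neqAle eq_sym s00.
    rewrite -(ler_pM2r s0) -expr2 -{1}yv (le_trans (CS_rdot _ _))//.
    rewrite (mulrC M) -mulrA ler_wpM2l ?sqn_ge0// (le_trans (TM _))//.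
    by rewrite ler_wpM2l.
  have zk k : hdot z (e k) = hdot y (T (e k)).
    rewrite (ons_series_coef _ oe.1 cz) /c.
    have [->|_] := eqVneq (e k) 0; first by rewrite lin0// hdot0r mulr0.
    by rewrite mulr1.
  exists z => x; have ex := @onb_expansion _ _ e x oe.
  apply: cvg_R_uniq (cvg_rdotl (y := y) (bounded_op_cvg bT ex)) _.
  apply: eq_cvg_seq (cvg_rdotl (y := z) ex) => n.
  rewrite lin_sum// !rdot_suml; apply: eq_bigr => k _.
  by rewrite linZ// /rdot !hdotZl (hdotC (e k) z) zk -hdotC.
have [S hS] := choice Sy; exists S; exact: rdot_is_adjoint.
Qed.

End adjoints.

Section positive_operators.
Context {R : realType} {H : hilbertType R}.
Implicit Types (x y z : H) (T S : H -> H).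

(** Polarization over the complex numbers: the form has no imaginary part at [x + 'i *: y], and this
    is the symmetry of its real part. *)
Lemma positive_sym T : positive_op T -> is_adjoint T T.
Proof.
move=> [[lT cT] T0]; apply: rdot_is_adjoint => // x y.
have Im0 z : complex.Im (hdot (T z) z) = 0.
  by have := T0 z; rewrite lecE => /andP[/eqP].
have h u v : complex.Im (hdot (T u) v) + complex.Im (hdot (T v) u) = 0.
  have := Im0 (u + v); rewrite (linD lT) !hdotDl !hdotDr !raddfD/= !Im0.
  by rewrite add0r addr0.
have := h x ('i *: y); rewrite (linZ lT) hdotZl hdotZr (rdotC x) /rdot.
by case: (hdot (T x) y) (hdot (T y) x) => [a b] [u v] /=; lra.
Qed.

Lemma positive_rdotC T x y : positive_op T -> rdot (T x) y = rdot x (T y).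
Proof. by move=> /positive_sym/is_adjoint_rdot; exact. Qed.

Lemma positive_ge0 T x : positive_op T -> 0 <= rdot (T x) x.
Proof. by move=> [_ /(_ x)]; rewrite lecE => /andP[]. Qed.

Lemma positive_linear T : positive_op T -> linear T.
Proof. by case=> -[]. Qed.

Lemma positive_opP T M : linear T -> (forall x y, rdot (T x) y = rdot x (T y)) ->
  (forall x, 0 <= rdot (T x) x) -> 0 <= M -> sqn_bounded T M -> positive_op T.
Proof.
move=> lT sT T0 M0 TM; split.
  by apply/bounded_opP => //; exists M.
move=> x; rewrite hdotE lecE/= T0 andbT.
have := sT x ('i *: x); rewrite (linZ lT) -[RHS]opprK -rdotiZl (rdotC _ (T x)) => h.
by apply/eqP; lra.
Qed.

Lemma CS_positive T x y : positive_op T ->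
  rdot (T x) y ^+ 2 <= rdot (T x) x * rdot (T y) y.
Proof.
move=> pT; apply: discr_le; rewrite ?positive_ge0// => t.
have := positive_ge0 (x + t%:C *: y) pT.
rewrite (_ : rdot _ _ =
  rdot (T x) x + 2 * t * rdot (T x) y + t ^+ 2 * rdot (T y) y)//.
rewrite (linD (positive_linear pT)) (linZ (positive_linear pT)).
rewrite !rdotDl !rdotDr !rdotZl !rdotZr (positive_rdotC y x)// (rdotC y).
by ring.
Qed.

Definition rdot_bounded T M := forall x, rdot (T x) x <= M * sqn x.

(** Cauchy-Schwarz for the form of [T] at [x] and [T x], divided by [sqn (T x)]. *)
Lemma rdot_bounded_sqn T M x : positive_op T -> rdot_bounded T M ->
  sqn (T x) <= M * rdot (T x) x.
Proof.
move=> pT TM; have [->|Tx] := eqVneq (sqn (T x)) 0.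
  have [M0|M0] := leP 0 M; first by rewrite mulr_ge0// positive_ge0.
  have x0 : sqn x = 0.
    apply/eqP; rewrite eq_le sqn_ge0 andbT -(ler_nM2l M0) mulr0.
    by rewrite (le_trans _ (TM x))// positive_ge0.
  have /eqP := x0; rewrite sqn_eq0 => /eqP ->.
  by rewrite rdot0r mulr0.
have {}Tx : 0 < sqn (T x) by rewrite lt_neqAle eq_sym Tx sqn_ge0.
rewrite -(ler_pM2l Tx) -expr2 -[X in X ^+ 2]sqnE.
rewrite (le_trans (CS_positive _ _ pT))// mulrC mulrA (mulrC _ M).
by rewrite ler_wpM2r ?positive_ge0.
Qed.

Lemma rdot_bounded_bounded T M : positive_op T -> 0 <= M -> rdot_bounded T M ->
  sqn_bounded T (M ^+ 2).
Proof.
move=> pT M0 TM x; rewrite (le_trans (rdot_bounded_sqn x pT TM))//.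
by rewrite expr2 -mulrA ler_wpM2l.
Qed.

Lemma positive_rdot_bounded T : positive_op T ->
  exists2 M, 0 < M & rdot_bounded T M.
Proof.
move=> [bT _]; have [M M0 TM] := bounded_op_ex bT.
exists (M + 1); first by rewrite ltr_wpDl.
move=> x; rewrite (le_trans (rdot_le _ _))// ler_pdivrMr//.
rewrite (@le_trans _ _ ((M + 1) * sqn x))//; last first.
  by rewrite ler_peMr ?ler1n// mulr_ge0 ?sqn_ge0// addr_ge0.
by rewrite mulrDl mul1r lerD2r TM.
Qed.

Lemma positive_rdot0 T x : positive_op T -> rdot (T x) x = 0 -> T x = 0.
Proof.
move=> pT Tx; have [M M0 TM] := positive_rdot_bounded pT.
apply/eqP; rewrite -sqn_eq0 eq_le sqn_ge0 andbT.
by rewrite (le_trans (rdot_bounded_sqn x pT TM))// Tx mulr0.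
Qed.

End positive_operators.

(** The triangle inequality for norms bounded by [a] and [b] times the root of [s], written with
    squares. *)
Lemma sqn_triangle {R : realType} {H : hilbertType R} (x y : H) (a b s : R) :
  0 <= a -> 0 <= b -> 0 <= s -> sqn x <= a ^+ 2 * s -> sqn y <= b ^+ 2 * s ->
  sqn (x + y) <= (a + b) ^+ 2 * s.
Proof.
move=> a0 b0 s0 xa yb.
have xy : rdot x y <= a * b * s.
  have [xy0|xy0] := leP (rdot x y) 0; first by rewrite (le_trans xy0)// !mulr_ge0.
  rewrite -(@ler_pXn2r _ 2)// ?nnegrE ?(ltW xy0) ?mulr_ge0//.
  rewrite (le_trans (CS_rdot _ _))// (_ : _ ^+ 2 = a ^+ 2 * s * (b ^+ 2 * s)).
    by rewrite ler_pM ?sqn_ge0.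
  by ring.
rewrite sqnD (_ : _ * s = a ^+ 2 * s + 2 * (a * b * s) + b ^+ 2 * s); last by ring.
by rewrite !lerD// ler_pM2l.
Qed.

(** * Square roots of positive operators *)

Section square_root.
Context {R : realType} {H : hilbertType R}.

Section contraction.
Variables (A : H -> H) (pA : positive_op A) (A1 : rdot_bounded A 1).

Let B x := x - A x.
Let lA := positive_linear pA.

Let lB : linear B.
Proof. by move=> c x y; rewrite /B lA scalerBr opprD addrACA. Qed.

Let symB x y : rdot (B x) y = rdot x (B y).
Proof. by rewrite /B rdotBl rdotBr (positive_rdotC x y). Qed.

Let sqnB1 x : sqn (B x) <= sqn x.
Proof.
rewrite /B sqnB rdotC; have := rdot_bounded_sqn x pA A1.
by have := positive_ge0 x pA; lra.
Qed.

(* The iteration [Y := (B + Y^2) / 2], whose fixed point satisfies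
   [(1 - Y)^2 = 1 - B = A]; [Yr] is the same iteration for [B = 1] in the reals,
   and dominates it in norm. *)
Let Y := fix Y n x := if n is n'.+1 then (2^-1)%:C *: (B x + Y n' (Y n' x)) else 0.
Let Yr := fix y n : R := if n is n'.+1 then 2^-1 * (1 + y n' * y n') else 0.

Let YrE n : Yr n.+1 = 2^-1 * (1 + Yr n * Yr n). Proof. by []. Qed.
Let YE n x : Y n.+1 x = (2^-1)%:C *: (B x + Y n (Y n x)). Proof. by []. Qed.

Let Yr01 n : 0 <= Yr n <= 1.
Proof.
elim: n => [|n /andP[y0 y1]]; first by rewrite lexx ler01.
rewrite YrE.
have : Yr n * Yr n <= 1 by rewrite mulr_ile1.
by have := mulr_ge0 y0 y0; lra.
Qed.
Let Yr0 n : 0 <= Yr n. Proof. by case/andP: (Yr01 n). Qed.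
Let Yr1 n : Yr n <= 1. Proof. by case/andP: (Yr01 n). Qed.

Let YrS n : Yr n <= Yr n.+1.
Proof.
elim: n => [|n ih]; first by rewrite [Yr 0]/= Yr0.
by rewrite !YrE ler_pM2l ?invr_gt0// lerD2l ler_pM.
Qed.

Let Yr_le m n : (m <= n)%N -> Yr m <= Yr n.
Proof. exact: (@homo_leq _ Yr (fun a b => a <= b) (@lexx _ _) (@le_trans _ _) YrS). Qed.

Let lY n : linear (Y n).
Proof.
elim: n => [|n ih] c x y; first by rewrite /= scaler0 addr0.
by rewrite !YE lB !ih !scalerDr !scalerA (mulrC c) addrACA.
Qed.

(** Each iterate is a polynomial in [B]; in particular the iterates commute with one another. *)
Let YC n (C : H -> H) : linear C -> (forall x, C (B x) = B (C x)) ->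
  forall x, C (Y n x) = Y n (C x).
Proof.
move=> lC CB; elim: n => [|n ih] x; first exact: lin0.
by rewrite !YE (linZ lC) (linD lC) CB !ih.
Qed.

Let YYC m n x : Y m (Y n x) = Y n (Y m x).
Proof. by apply: YC => // {}x; rewrite (@YC m B). Qed.

Let symY n x y : rdot (Y n x) y = rdot x (Y n y).
Proof.
elim: n x y => [|n ih] x y; first by rewrite rdot0l rdot0r.
by rewrite !YE rdotZl rdotZr rdotDl rdotDr symB !ih.
Qed.

Let sqnY n x : sqn (Y n x) <= Yr n ^+ 2 * sqn x.
Proof.
elim: n x => [|n ih] x; first by rewrite sqn0 expr0n mul0r.
rewrite YE YrE sqnZr exprMn -[leRHS]mulrA ler_pM2l ?exprn_gt0//.
apply: sqn_triangle; rewrite ?sqn_ge0 ?mulr_ge0//.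
  by rewrite expr1n mul1r.
rewrite (le_trans (ih _))// exprMn -[leRHS]mulrA ler_wpM2l ?sqr_ge0//.
Qed.

(** By commutation, a step is half of [Y n.+1 + Y n] applied to the preceding step. The real
    iterates factor in the same way, which carries the bound along. *)
Let sqnYS n x : sqn (Y n.+1 x - Y n x) <= (Yr n.+1 - Yr n) ^+ 2 * sqn x.
Proof.
elim: n x => [|n ih] x.
  rewrite [Y 0 x]/= [Yr 0]/= !subr0; exact: sqnY.
have -> : Y n.+2 x - Y n.+1 x =
    (2^-1)%:C *: (Y n.+1 (Y n.+1 x - Y n x) + Y n (Y n.+1 x - Y n x)).
  rewrite (YE n.+1) [X in _ - X = _]YE -scalerBr; congr (_ *: _).
  by rewrite !(linB (lY _)) (YYC n n.+1) subrKA opprD addrACA subrr add0r.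
rewrite sqnZr.
have -> : (Yr n.+2 - Yr n.+1) ^+ 2 * sqn x =
  2^-1 ^+ 2 * ((Yr n.+1 + Yr n) ^+ 2 * ((Yr n.+1 - Yr n) ^+ 2 * sqn x)).
  by rewrite (YrE n.+1) [X in (_ - X) ^+ 2]YrE; ring.
rewrite ler_pM2l ?exprn_gt0//.
apply: (@le_trans _ _ ((Yr n.+1 + Yr n) ^+ 2 * sqn (Y n.+1 x - Y n x))).
  by apply: sqn_triangle => //; rewrite sqn_ge0.
by rewrite ler_wpM2l ?sqr_ge0.
Qed.

Let sqnYB m n x : (m <= n)%N -> sqn (Y n x - Y m x) <= (Yr n - Yr m) ^+ 2 * sqn x.
Proof.
elim: n => [|n ih]; first by rewrite leqn0 => /eqP ->; rewrite !subrr sqn0 expr0n mul0r.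
rewrite leq_eqVlt => /predU1P[->|]; first by rewrite !subrr sqn0 expr0n mul0r.
rewrite ltnS => mn.
rewrite -(subrKA (Y n x)) -(subrKA (Yr n)).
apply: sqn_triangle; rewrite ?subr_ge0 ?sqn_ge0 ?Yr_le ?ih//.
Qed.

Let cvY x : exists z : H, Y n x @[n --> \oo] --> z.
Proof.
apply: (@sqn_cauchy_cvg _ _ _ (fun n => Yr n * sqn x)).
  apply: is_cvgM; last exact: is_cvg_cst.
  apply: nondecreasing_is_cvgn; first by move=> m n; exact: Yr_le.
  by exists 1 => _ [n _ <-].
move=> m n mn; rewrite (le_trans (sqnYB x mn))// -mulrBl.
have h0 : 0 <= Yr n - Yr m by rewrite subr_ge0 Yr_le.
rewrite ger0_norm ?mulr_ge0 ?sqn_ge0// ler_wpM2r ?sqn_ge0//.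
rewrite expr2 ler_piMr//; have := Yr1 n; have := Yr0 m; lra.
Qed.

Lemma contraction_sqrt : exists2 S, positive_op S & S \o S = A.
Proof.
have [Z hZ] := choice cvY.
have sqnZ1 x : sqn (Z x) <= sqn x.
  apply: le_lim_seq (cvg_sqn (hZ x)) (cvg_cst (sqn x)) _ => n.
  by rewrite (le_trans (sqnY n x))// ler_piMl ?sqn_ge0// exprn_ile1.
have lZ : linear Z.
  move=> c x y; apply: cvg_H_uniq (hZ _) _.
  apply: (@eq_cvg_seq _ (fun n => c *: Y n x + Y n y)).
    by move=> n; rewrite lY.
  by apply: cvgD => //; apply: cvgZr; exact: hZ.
have symZ x y : rdot (Z x) y = rdot x (Z y).
  apply: cvg_R_uniq (cvg_rdotl (y := y) (hZ x)) _.
  by apply: eq_cvg_seq (cvg_rdotr (y := x) (hZ y)) => n; rewrite symY.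
have ZZ x : Z x = (2^-1)%:C *: (B x + Z (Z x)).
  have hS : Y n.+1 x @[n --> \oo] --> Z x.
    by rewrite (cvg_shiftS (fun n => Y n x)); exact: hZ.
  apply: cvg_H_uniq hS _.
  apply: cvgZr; apply: cvgD; first exact: cvg_cst.
  (* The first summand tends to 0 because no [Y n] increases norms. *)
  apply: (@eq_cvg_seq _ (fun n => Y n (Y n x - Z x) + Y n (Z x))).
    by move=> n; rewrite (linB (lY n)) subrK.
  rewrite -[Z (Z x)]add0r; apply: cvgD => //; apply/csqnP.
  apply: (@cvg_squeeze0 _ _ (fun n => sqn (Y n x - Z x))).
    move=> n; rewrite subr0 sqn_ge0 (le_trans (sqnY _ _))//.
    by rewrite ler_piMl ?sqn_ge0// exprn_ile1.
  by apply/csqnP.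
pose S x := x - Z x; exists S.
  apply: (@positive_opP _ _ S 4) => //.
  - by move=> c x y; rewrite /S lZ scalerBr opprD addrACA.
  - by move=> x y; rewrite /S rdotBl rdotBr symZ.
  - by move=> x; rewrite /S rdotBl sqnE subr_ge0 (le_trans (rdot_le _ _))//
      ler_pdivrMr//; have := sqnZ1 x; lra.
  - by move=> x; rewrite (le_trans (sqnB_le _ _))//; have := sqnZ1 x; lra.
apply/funext => x /=; rewrite /S (linB lZ).
have h : Z x + Z x = B x + Z (Z x).
  by rewrite {1 2}ZZ -scalerDl -rmorphD/= -[2^-1]mul1r -splitr scale1r.
have -> : x - Z x - (Z x - Z (Z x)) = x - (Z x + Z x) + Z (Z x).
  by rewrite opprB opprD !addrA addrAC.
by rewrite h opprD addrA subrK /B subKr.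
Qed.

End contraction.

Lemma positive_sqrt (T : H -> H) : positive_op T ->
  exists2 S, positive_op S & S \o S = T.
Proof.
move=> pT; have [M M0 TM] := positive_rdot_bounded pT.
have lT := positive_linear pT.
pose A x := (M^-1)%:C *: T x.
have [||S pS SA] := @contraction_sqrt A.
- have [K K0 TK] := bounded_op_ex pT.1.
  apply: (@positive_opP _ _ A (M^-1 ^+ 2 * K)).
  + by move=> c x y; rewrite /A lT scalerDr !scalerA mulrC.
  + by move=> x y; rewrite rdotZl rdotZr (positive_rdotC x y).
  + by move=> x; rewrite rdotZl mulr_ge0 ?positive_ge0// invr_ge0 ltW.
  + by rewrite mulr_ge0 ?sqr_ge0.
  + by move=> x; rewrite sqnZr -[leRHS]mulrA ler_wpM2l ?sqr_ge0.
- by move=> x; rewrite rdotZl mul1r mulrC ler_pdivrMr// mulrC.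
have lS := positive_linear pS.
pose r := Num.sqrt M; exists (fun x => r%:C *: S x).
  have [K K0 SK] := bounded_op_ex pS.1.
  apply: (@positive_opP _ _ _ (r ^+ 2 * K)).
  + by move=> c x y; rewrite lS scalerDr !scalerA mulrC.
  + by move=> x y; rewrite rdotZl rdotZr (positive_rdotC x y).
  + by move=> x; rewrite rdotZl mulr_ge0 ?positive_ge0// sqrtr_ge0.
  + by rewrite mulr_ge0 ?sqr_ge0.
  + by move=> x; rewrite sqnZr -[leRHS]mulrA ler_wpM2l ?sqr_ge0.
apply/funext => x /=; rewrite (linZ lS) scalerA -rmorphM -expr2 sqr_sqrtr ?ltW//.
have /= -> := congr1 (fun f => f x) SA.
by rewrite scalerA -rmorphM mulfV ?gt_eqF// scale1r.
Qed.

End square_root.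

(** * Spectral decomposition by power iteration and deflation *)

(** For a positive operator, a bound on its trace in the basis [e], kept in the reals by bounding
    the partial sums. *)
Definition finite_trace {R : realType} {H : hilbertType R} (e : nat -> H)
    (T : H -> H) (M : R) :=
  forall n, \sum_(0 <= j < n) rdot (T (e j)) (e j) <= M.

Section power_limit.
Context {R : realType} {H : hilbertType R}.
Variables (T : H -> H) (pT : positive_op T) (T1 : rdot_bounded T 1).
Implicit Types x y : H.

Let lT := positive_linear pT.

Lemma rdot_iter m n x y :
  rdot (iter m T x) (iter n T y) = rdot (iter (m + n) T x) y.
Proof.
elim: n m => [|n ih] m; first by rewrite addn0.
by rewrite iterS -(positive_rdotC _ _ pT) -iterS ih addSnnS.
Qed.

Lemma iter_linear n : linear (iter n T).
Proof. by elim: n => [//|n ih] c x y; rewrite !iterS ih lT. Qed.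

Let d x n := rdot (iter n T x) x.

(** Even moments are squared norms of iterates, odd ones are values of the form of [T] at iterates.
    Going from even to odd uses [T <= 1], from odd to even [sqn (T y) <= rdot (T y) y]. *)
Let dS x n : 0 <= d x n.+1 <= d x n.
Proof.
have e1 (m : nat) : d x m.*2 = sqn (iter m T x).
  by rewrite /d -addnn -rdot_iter.
have e2 (m : nat) : d x m.*2.+1 = rdot (T (iter m T x)) (iter m T x).
  by rewrite /d -iterS rdot_iter addSn addnn.
rewrite -(odd_double_half n); case: (odd n) => /=.
  rewrite add1n -doubleS e1 e2 sqn_ge0/=.
  by rewrite (le_trans (rdot_bounded_sqn _ pT T1))// mul1r.
rewrite add0n e1 e2 positive_ge0//=.
by rewrite (le_trans (T1 _))// mul1r.
Qed.

Let d_ge0 x n : 0 <= d x n.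
Proof. by have /andP[h1 h2] := dS x n; exact: le_trans h2. Qed.

Let d_le x m n : (m <= n)%N -> d x n <= d x m.
Proof.
by apply: (@homo_leq _ (d x) (fun a b => b <= a)) => // [a b c ab bc|k];
  [exact: le_trans bc ab|case/andP: (dS x k)].
Qed.

(** The squared distance of two iterates is [d x n.*2 - 2 * d x (n + m) + d x m.*2], which
    monotonicity of the moments bounds by [d x m.*2 - d x n.*2]. *)
Lemma iter_cvg x : exists z : H, iter n T x @[n --> \oo] --> z.
Proof.
apply: (@sqn_cauchy_cvg _ _ _ (fun n => d x n.*2)).
  apply: nonincreasing_is_cvgn.
    by move=> m n mn; apply: d_le; rewrite leq_double.
  by exists 0 => _ [n _ <-].
move=> m n mn; rewrite sqnB -!sqnE !rdot_iter !addnn -/(d x n.*2) -/(d x m.*2) -/(d x (n + m)).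
have h1 : d x n.*2 <= d x (n + m) by apply: d_le; rewrite -addnn leq_add2l.
have h2 : d x n.*2 <= d x m.*2 by apply: d_le; rewrite leq_double.
by rewrite ler0_norm ?subr_le0//; lra.
Qed.

Definition power_lim x : H := lim (iter n T x @[n --> \oo]).

Lemma power_lim_cvg x : iter n T x @[n --> \oo] --> power_lim x.
Proof. by have /cvg_ex := iter_cvg x. Qed.

Lemma power_lim_fix x : T (power_lim x) = power_lim x.
Proof.
have h := bounded_op_cvg pT.1 (@power_lim_cvg x).
apply: cvg_H_uniq h _; rewrite (cvg_shiftS (fun n => iter n T x)).
exact: power_lim_cvg.
Qed.

(** Cauchy-Schwarz bounds the square of the form of a power by [sqn x] times the form of the doubled
    power: halving the exponent costs a square root of [q], which stays below 1. *)
Lemma pow2_contract i q : 0 <= q < 1 -> rdot_bounded (iter (2 ^ i) T) q ->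
  exists2 q', 0 <= q' < 1 & rdot_bounded T q'.
Proof.
elim: i q => [|i ih] q /andP[q0 q1] Tq; first by exists q => //; rewrite q0.
apply: (ih (Num.sqrt q)).
  by rewrite sqrtr_ge0 -[ltRHS]sqrtr1 ltr_sqrt.
move=> x; have [h|h] := leP (rdot (iter (2 ^ i) T x) x) 0.
  by rewrite (le_trans h)// mulr_ge0 ?sqrtr_ge0 ?sqn_ge0.
rewrite -(@ler_pXn2r _ 2)// ?nnegrE ?(ltW h) ?mulr_ge0 ?sqrtr_ge0 ?sqn_ge0//.
rewrite (le_trans (CS_rdot _ _))// exprMn sqr_sqrtr// expr2 mulrA.
rewrite ler_wpM2r ?sqn_ge0//.
by rewrite -sqnE rdot_iter addnn -mul2n -expnS; exact: Tq.
Qed.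

(* If the limit vanishes on a basis, the Hilbert-Schmidt norms of the powers
   tend to 0, hence so do their norms. *)
Lemma power_lim0_contract e M : onb e -> finite_trace e T M ->
  (forall j, power_lim (e j) = 0) -> exists2 q, 0 <= q < 1 & rdot_bounded T q.
Proof.
move=> oe TM e0.
have cT : cvgn (fun n => \sum_(0 <= j < n) rdot (T (e j)) (e j)).
  by apply: bounded_series_cvg TM => k; exact: positive_ge0.
have c4 : 0 < 4^-1 :> R by rewrite invr_gt0.
(* Beyond [J] the squared norms of the iterates are dominated by the terms of the trace and add up
   to at most 1/4; the first [J] of them tend to 0 and will be below 1/4 as well. *)
have [J hJ] := cauchy_real cT c4.
have : \sum_(0 <= j < J) sqn (iter k T (e j)) @[k --> \oo] --> (0 : R).
  elim: J {hJ} => [|J ih].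
    by under eq_fun do rewrite big_geq//; exact: cvg_cst.
  under eq_fun do rewrite big_nat_recr//=.
  suff : \sum_(0 <= j < J) sqn (iter k T (e j)) + sqn (iter k T (e J))
    @[k --> \oo] --> 0 + (0 : R) by rewrite addr0.
  apply: cvgD => //.
  by have := cvg_sqn (@power_lim_cvg (e J)); rewrite e0 sqn0.
move=> /eps_cvg0-/(_ _ c4)[K hK].
pose k := (2 ^ K)%N.
have Kk : (K <= k)%N by rewrite ltnW// ltn_expl.
have k0 : (0 < k)%N by rewrite expn_gt0.
have hk n : \sum_(0 <= j < n) sqn (iter k T (e j)) <= 2^-1.
  have h1 : \sum_(0 <= j < J + n) sqn (iter k T (e j)) <= 2^-1.
    rewrite (big_cat_nat (n := J)) ?leq_addr//=.
    have -> : 2^-1 = 4^-1 + 4^-1 :> R by field.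
    apply: lerD; first exact: hK.
    have := hJ (J + n)%N J (leq_addr _ _) (leqnn _).
    rewrite (big_cat_nat (n := J)) ?leq_addr//= addrAC subrr add0r => h.
    apply: le_trans (le_trans (ler_norm _) h); apply: ler_sum => j _.
    rewrite -sqnE rdot_iter addnn; have := d_le (e j) (m := 1) (n := k.*2).
    by rewrite double_gt0 k0 => /(_ isT).
  apply: le_trans h1; rewrite [leRHS](big_cat_nat (n := n)) ?leq_addl//=.
  by rewrite lerDl sumr_ge0// => j _; exact: sqn_ge0.
(* The Hilbert-Schmidt bound gives [sqn (iter k T x) <= sqn x / 2], and the mean of 1/2 and 1 is
   3/4. *)
apply: (@pow2_contract K (3/4)); first by apply/andP; split; lra.
move=> x; rewrite (le_trans (rdot_le _ _))// ler_pdivrMr//.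
suff : sqn (iter k T x) <= 2^-1 * sqn x by rewrite -/k; lra.
have px := onb_parseval (x := iter k T x) oe.
apply: le_lim_seq px (cvg_cst (2^-1 * sqn x)) _ => n.
apply: (@le_trans _ _ (\sum_(0 <= j < n) sqn (iter k T (e j)) * sqn x)).
  apply: ler_sum => j _.
  have -> : hdot (iter k T x) (e j) = hdot x (iter k T (e j)).
    apply: rdot_is_adjoint; first exact: iter_linear.
    by move=> u v; rewrite (rdot_iter 0 k u v) add0n.
  by rewrite mulrC; exact: CS_hdot.
by rewrite -mulr_suml ler_wpM2r ?sqn_ge0.
Qed.

End power_limit.

Section top_eigenvalue.
Context {R : realType} {H : hilbertType R}.
Implicit Types (A : H -> H) (x : H).

(** The quotient at [x = 0] is 0, so the supremum is over a nonempty set and nonnegative for a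
    positive operator, even on the null space. *)
Definition top A : R := sup [set rdot (A x) x / sqn x | x in [set: H]].

Lemma top_has_sup A : positive_op A ->
  has_sup [set rdot (A x) x / sqn x | x in [set: H]].
Proof.
move=> pA; split; first by exists (rdot (A 0) 0 / sqn (0 : H)); exists 0.
have [M M0 AM] := positive_rdot_bounded pA.
exists M => _ [x _ <-]; have [->|x0] := eqVneq x 0.
  by rewrite rdot0r mul0r ltW.
by rewrite ler_pdivrMr// sqn_gt0.
Qed.

Lemma top_ge0 A : positive_op A -> 0 <= top A.
Proof.
move=> pA; apply: sup_upper_bound; first exact: top_has_sup.
by exists 0 => //; rewrite rdot0r mul0r.
Qed.

Lemma top_bounded A : positive_op A -> rdot_bounded A (top A).
Proof.
move=> pA x; have [->|x0] := eqVneq x 0; first by rewrite rdot0r sqn0 mulr0.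
rewrite -ler_pdivrMr ?sqn_gt0//.
by apply: sup_upper_bound; [exact: top_has_sup|exists x].
Qed.

Lemma top_le A M : 0 <= M -> rdot_bounded A M -> top A <= M.
Proof.
move=> M0 AM; apply: sup_le_ub.
  by exists (rdot (A 0) 0 / sqn (0 : H)); exists 0.
move=> _ [x _ <-]; have [->|x0] := eqVneq x 0; first by rewrite rdot0r mul0r.
by rewrite ler_pdivrMr// sqn_gt0.
Qed.

Lemma top0 A x : positive_op A -> top A = 0 -> A x = 0.
Proof.
move=> pA A0; apply: positive_rdot0 => //; apply/eqP.
by rewrite eq_le positive_ge0// andbT (le_trans (top_bounded pA x))// A0 mul0r.
Qed.

End top_eigenvalue.

Section first_nonzero.
Context {R : realType} {H : hilbertType R}.
Implicit Types (u : nat -> H).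

(** This sequence is constant once it is nonzero. Obtaining the first nonzero vector as its limit,
    and not by a choice, lets measurability in a parameter pass to it. *)
Fixpoint first_nz u n : H :=
  if n is m.+1 then if first_nz u m == 0 then u m else first_nz u m else 0.

Lemma first_nz_stable u m n : first_nz u m != 0 -> (m <= n)%N ->
  first_nz u n = first_nz u m.
Proof.
move=> um; elim: n => [|n ih]; first by rewrite leqn0 => /eqP ->.
rewrite leq_eqVlt => /predU1P[->//|]; rewrite ltnS => mn /=.
by rewrite ih// (negbTE um).
Qed.

Lemma first_nz_range u n : first_nz u n = 0 \/ exists j, first_nz u n = u j.
Proof.
elim: n => [|n [h|[j h]]] /=; first by left.
  by rewrite h eqxx; right; exists n.
by right; case: ifP => _; [exists n|exists j].
Qed.

Lemma first_nz_eq0 u n j : first_nz u n = 0 -> (j < n)%N -> u j = 0.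
Proof.
elim: n => [//|n ih] /=; case: ifP => [/eqP n0 un|/eqP //].
by rewrite ltnS leq_eqVlt => /predU1P[->//|]; exact: ih.
Qed.

Definition first_lim u : H := lim (first_nz u n @[n --> \oo]).

Lemma first_lim_cvg u : first_nz u n @[n --> \oo] --> first_lim u.
Proof.
suff : exists z : H, first_nz u n @[n --> \oo] --> z by move=> /cvg_ex.
have [[m um]|h] := pselect (exists m, first_nz u m != 0).
  exists (first_nz u m); apply: cvg_near_cst; exists m => // n /= mn.
  by rewrite (first_nz_stable um mn).
exists 0; apply: cvg_near_cst; apply: nearW => n.
by apply: contrapT => un; apply: h; exists n; exact/eqP.
Qed.

Lemma first_limP u :
  (exists2 j, first_lim u = u j & u j != 0) \/
  (first_lim u = 0 /\ forall j, u j = 0).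
Proof.
have [[m um]|h] := pselect (exists m, first_nz u m != 0).
  left; have [m0|[j uj]] := first_nz_range u m; first by rewrite m0 eqxx in um.
  exists j; rewrite -uj//.
  apply: cvg_H_uniq (@first_lim_cvg u) _.
  apply: cvg_near_cst; exists m => // n /= mn.
  by rewrite (first_nz_stable um mn).
have u0 n : first_nz u n = 0.
  by apply: contrapT => un; apply: h; exists n; exact/eqP.
right; split.
  apply: cvg_H_uniq (@first_lim_cvg u) _.
  by under eq_fun do rewrite u0; exact: cvg_cst.
by move=> j; exact: (first_nz_eq0 (u0 j.+1) (leqnn _)).
Qed.

(** Since the inverse of 0 is 0, the zero vector is kept, in agreement with the padding of
    orthonormal sequences. *)
Definition normalize (x : H) : H := (Num.sqrt (sqn x))^-1%:C *: x.

Lemma sqn_normalize x : sqn (normalize x) = (x != 0)%:R.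
Proof.
rewrite /normalize sqnZr; have [->|x0] := eqVneq x 0; first by rewrite sqn0 mulr0.
by rewrite exprVn sqr_sqrtr ?sqn_ge0// mulVf// sqn_eq0.
Qed.

Lemma normalize_eq0 x : (normalize x == 0) = (x == 0).
Proof.
by rewrite -sqn_eq0 sqn_normalize pnatr_eq0; case: (x == 0).
Qed.

End first_nonzero.

Section tensor_lemmas.
Context {R : realType} {H G : hilbertType R}.
Implicit Types (x : G) (y : H).

Lemma tensor_adjoint x y : is_adjoint (tensor x y) (tensor y x).
Proof. by move=> u v; rewrite /tensor hdotZl hdotZr mulrC (hdotC x v). Qed.

Lemma tensor_sqn_bounded x y : sqn_bounded (tensor x y) (sqn x * sqn y).
Proof.
move=> u; rewrite sqnZ mulrC -mulrA ler_wpM2l ?sqn_ge0// mulrC CS_hdot//.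
Qed.

Lemma tensor_linear x y : linear (tensor x y).
Proof. exact: is_adjoint_linear (tensor_adjoint x y). Qed.

Lemma tensor_bounded x y : bounded_op (tensor x y).
Proof.
apply/bounded_opP; first exact: tensor_linear.
by exists (sqn x * sqn y); [rewrite mulr_ge0 ?sqn_ge0|exact: tensor_sqn_bounded].
Qed.

End tensor_lemmas.

Lemma tensor_rdot {R : realType} {H : hilbertType R} (x u : H) :
  rdot (tensor x x u) u = csq (hdot u x).
Proof. by rewrite /tensor /rdot hdotZl (hdotC x) csqE. Qed.

Section deflation_step.
Context {R : realType} {H : hilbertType R}.
Variables (e : nat -> H).
Implicit Types (A Q : H -> H).

Definition normal_op A Q : H -> H :=
  if 0 < top A then fun x => (top A)^-1%:C *: A x else Q.

Definition eigvec A Q : H :=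
  normalize (first_lim (fun j => power_lim (normal_op A Q) (e j))).

Definition projector Q := positive_op Q /\ forall x, Q (Q x) = Q x.

(** The invariant of the deflation: [A] only sees the range of the projector [Q], which is the space
    still to be decomposed, and the bound [M] on the trace survives every step. *)
Definition deflated A Q M := [/\ positive_op A, projector Q,
  (forall x, A (Q x) = A x) & finite_trace e A M].

(** Applied to the operator with [c] its top eigenvalue, and to the projector with [c = 1]. *)
Definition peel (c : R) (v : H) A : H -> H := fun x => A x - c%:C *: tensor v v x.

Variables (A Q : H -> H) (M : R).
Hypotheses (oe : onb e) (AQM : deflated A Q M).

Let pA : positive_op A. Proof. by case: AQM. Qed.
Let pQ : positive_op Q. Proof. by case: AQM => _ []. Qed.
Let QQ x : Q (Q x) = Q x. Proof. by case: AQM => _ []. Qed.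
Let AQ x : A (Q x) = A x. Proof. by case: AQM. Qed.
Let trA : finite_trace e A M. Proof. by case: AQM. Qed.
Let s := top A.
Let T := normal_op A Q.
Let v := eigvec A Q.

Lemma deflated_QA x : Q (A x) = A x.
Proof. by apply: rdot_injl => z; rewrite !(positive_rdotC _ _ pQ, positive_rdotC _ _ pA) AQ. Qed.

Lemma Q_bounded : rdot_bounded Q 1.
Proof.
move=> x; rewrite -QQ (positive_rdotC _ _ pQ) sqnE mul1r.
have := sqn_ge0 (x - Q x); rewrite sqnB -(positive_rdotC _ _ pQ).
by rewrite -[X in rdot X _]QQ (positive_rdotC _ _ pQ) sqnE; lra.
Qed.

Lemma normal_op_positive : positive_op T.
Proof.
rewrite /T /normal_op; case: ifP => // s0.
have lA := positive_linear pA; have [K K0 AK] := bounded_op_ex pA.1.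
apply: (@positive_opP _ _ _ ((top A)^-1 ^+ 2 * K)).
- by move=> c x y; rewrite lA scalerDr !scalerA mulrC.
- by move=> x y; rewrite rdotZl rdotZr (positive_rdotC x y).
- by move=> x; rewrite rdotZl mulr_ge0 ?positive_ge0// invr_ge0 ltW.
- by rewrite mulr_ge0 ?sqr_ge0.
- by move=> x; rewrite sqnZr -[leRHS]mulrA ler_wpM2l ?sqr_ge0.
Qed.

Lemma normal_op_bounded : rdot_bounded T 1.
Proof.
rewrite /T /normal_op; case: ifP => s0; last exact: Q_bounded.
by move=> x; rewrite rdotZl mul1r mulrC ler_pdivrMr// mulrC top_bounded.
Qed.

Lemma normal_op_Q x : Q (T x) = T x.
Proof.
rewrite /T /normal_op; case: ifP => // _.
by rewrite (linZ (positive_linear pQ)) deflated_QA.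
Qed.

Lemma eigvec_fix : T v = v.
Proof.
have lT := positive_linear normal_op_positive.
rewrite /v /eigvec /normalize (linZ lT); congr (_ *: _).
have [[j -> _]|[-> _]] := first_limP (fun j => power_lim (normal_op A Q) (e j)).
  exact: power_lim_fix normal_op_positive normal_op_bounded _.
exact: lin0.
Qed.

Lemma eigvec_Q : Q v = v.
Proof. by rewrite -eigvec_fix normal_op_Q. Qed.

Lemma eigvec_A : A v = s%:C *: v.
Proof.
have := eigvec_fix; rewrite /T /normal_op -/s; case: ifP => s0.
  move=> {2}<-; rewrite scalerA -rmorphM mulfV ?gt_eqF// scale1r//.
move=> _; have -> : s = 0.
  by apply/eqP; rewrite eq_le top_ge0// andbT leNgt s0.
rewrite scale0r; apply: top0 => //.
by apply/eqP; rewrite eq_le top_ge0// andbT leNgt s0.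
Qed.

Lemma eigvec_sqn : sqn v = (v != 0)%:R.
Proof. by rewrite /v /eigvec sqn_normalize normalize_eq0. Qed.

(** If [top A] is positive, the vanishing of all limits makes [T] a strict contraction, so
    [s <= q * s] with [q < 1]. Otherwise the powers of [T = Q] are constant, and [Q] itself vanishes
    on the basis. *)
Lemma eigvec0 : v = 0 -> forall x, Q x = 0.
Proof.
move=> v0.
have P0 j : power_lim T (e j) = 0.
  have [[i h /eqP ui]|[_ ->//]] := first_limP (fun j => power_lim T (e j)).
  by move/eqP : v0; rewrite /v /eigvec normalize_eq0 h => /eqP /ui.
have pT := normal_op_positive; have bT := normal_op_bounded.
have [s0|s0] := ltP 0 s; last first.
  have TQ : T = Q by rewrite /T /normal_op -/s ltNge s0.
  have PQ x : power_lim T x = Q x.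
    apply: cvg_H_uniq (@power_lim_cvg _ _ _ pT bT x) _.
    apply: cvg_near_cst; exists 1%N => // -[//|n] _ /=.
    rewrite TQ; apply/eqP; elim: n => [//|n ih] /=.
    by rewrite (eqP ih) QQ.
  move=> x; apply: oe.2 => j.
  by rewrite (positive_sym pQ) -PQ P0 hdot0r.
have TA : T = fun x => s^-1%:C *: A x by rewrite /T /normal_op -/s s0.
have [|q /andP[q0 q1] Tq] := power_lim0_contract pT bT oe (M := s^-1 * M) _ P0.
  move=> n; rewrite TA; under eq_bigr do rewrite rdotZl.
  by rewrite -mulr_sumr ler_wpM2l// invr_ge0 ltW.
suff : s <= q * s by rewrite leNgt gtr_pMl// q1.
apply: top_le; first by rewrite mulr_ge0// ltW.
move=> x; have := Tq x; rewrite TA rdotZl => h.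
by rewrite mulrAC -ler_pdivrMr// [_ / s]mulrC.
Qed.

Lemma eigvec0_A : v = 0 -> forall x, A x = 0.
Proof. by move=> v0 x; rewrite -deflated_QA eigvec0. Qed.

Lemma peel_rdot x :
  rdot (peel s v A x) x = rdot (A x) x - s * csq (hdot x v).
Proof. by rewrite /peel rdotBl rdotZl tensor_rdot. Qed.

Lemma peel_linear c : linear (peel c v A).
Proof.
move=> a x y; rewrite /peel (positive_linear pA) tensor_linear.
by rewrite scalerDr !scalerBr !scalerA (mulrC a) opprD addrACA.
Qed.

Lemma peel_proj x (w := x - hdot x v *: v) : peel s v A x = A w.
Proof.
rewrite /w (linB (positive_linear pA)) (linZ (positive_linear pA)) eigvec_A.
by rewrite /peel /tensor scalerA mulrC -scalerA.
Qed.

Lemma vv_tensor x : tensor v v (tensor v v x) = tensor v v x.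
Proof.
rewrite /tensor hdotZl hdotxx eigvec_sqn; have [->|_] := eqVneq v 0.
  by rewrite !scaler0.
by rewrite mulr1.
Qed.

(** The peeled operator kills [v], so its form at [x] is the form of [A] at the component [w] of [x]
    orthogonal to [v]. *)
Lemma peel_positive : positive_op (peel s v A).
Proof.
have [K K0 AK] := bounded_op_ex pA.1.
have symP x y : rdot (peel s v A x) y = rdot x (peel s v A y).
  rewrite /peel rdotBl rdotBr rdotZl rdotZr (positive_rdotC x y)//.
  by rewrite (is_adjoint_rdot (tensor_adjoint v v)).
have Pv : peel s v A v = 0.
  rewrite /peel /tensor hdotxx eigvec_sqn eigvec_A.
  by case: eqP => [->|_]; rewrite ?scale1r ?subrr// !scaler0 subrr.
apply: (@positive_opP _ _ _ (2 * (K + s ^+ 2))).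
- exact: peel_linear.
- exact: symP.
- move=> x; pose w := x - hdot x v *: v.
  have -> : rdot (peel s v A x) x = rdot (peel s v A x) w.
    rewrite /w rdotBr [X in _ - X](_ : _ = 0) ?subr0//.
    rewrite symP (linZ (peel_linear s)) Pv scaler0 rdot0r//.
  by rewrite peel_proj; exact: positive_ge0.
- by rewrite mulr_ge0// addr_ge0// sqr_ge0.
- move=> x; rewrite (le_trans (sqnB_le _ _))// -mulrA ler_pM2l// mulrDl lerD//.
  rewrite sqnZr ler_wpM2l ?sqr_ge0//.
  rewrite (le_trans (tensor_sqn_bounded _ _ _))// -[leRHS]mul1r.
  by rewrite ler_wpM2r ?sqn_ge0// eigvec_sqn; case: (v != 0); rewrite ?mulr1// mulr0.
Qed.

Lemma tensor_Q x : tensor v v (Q x) = tensor v v x.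
Proof. by rewrite /tensor (positive_sym pQ) eigvec_Q. Qed.

Lemma peel_QQ x : peel 1 v Q (peel 1 v Q x) = peel 1 v Q x.
Proof.
rewrite /peel !scale1r (linB (positive_linear pQ)) QQ.
rewrite [Q (tensor _ _ _)](linZ (positive_linear pQ)) eigvec_Q.
by rewrite (linB (tensor_linear v v)) tensor_Q vv_tensor subrr subr0.
Qed.

Lemma peel_A_Q x : peel s v A (peel 1 v Q x) = peel s v A x.
Proof.
rewrite /peel !scale1r (linB (positive_linear pA)) AQ.
rewrite [A (tensor _ _ _)](linZ (positive_linear pA)) eigvec_A.
rewrite (linB (tensor_linear v v)) tensor_Q vv_tensor subrr scaler0 subr0.
by rewrite [in RHS]/tensor !scalerA (mulrC s%:C).
Qed.

Lemma peel_Q_positive : positive_op (peel 1 v Q).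
Proof.
have [K K0 QK] := bounded_op_ex pQ.1.
have sym1 x y : rdot (peel 1 v Q x) y = rdot x (peel 1 v Q y).
  rewrite /peel rdotBl rdotBr rdotZl rdotZr (positive_rdotC x y)//.
  by rewrite (is_adjoint_rdot (tensor_adjoint v v)).
apply: (@positive_opP _ _ _ (2 * (K + 1))) => //.
- move=> a x y; rewrite /peel (positive_linear pQ) tensor_linear.
  by rewrite !scale1r scalerBr opprD addrACA.
- by move=> x; rewrite -peel_QQ sym1 sqn_ge0.
- by rewrite mulr_ge0// addr_ge0.
- move=> x; rewrite (le_trans (sqnB_le _ _))// -mulrA ler_pM2l// mulrDl lerD//.
  rewrite scale1r (le_trans (tensor_sqn_bounded _ _ _))//.
  by rewrite ler_wpM2r ?sqn_ge0// eigvec_sqn; case: (v != 0); rewrite ?mulr1// mulr0.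
Qed.

Lemma peel_deflated : deflated (peel s v A) (peel 1 v Q) M.
Proof.
split; [exact: peel_positive| |exact: peel_A_Q|].
  by split; [exact: peel_Q_positive|exact: peel_QQ].
move=> n; apply: le_trans (trA n); apply: ler_sum => j _.
by rewrite peel_rdot lerBlDr lerDl mulr_ge0 ?csq_ge0 ?top_ge0.
Qed.

Lemma top_peel_le : top (peel s v A) <= s.
Proof.
apply: top_le; first exact: top_ge0.
move=> x; rewrite peel_rdot (le_trans _ (top_bounded pA x))//.
by rewrite lerBlDr lerDl mulr_ge0 ?csq_ge0 ?top_ge0.
Qed.

End deflation_step.

Section spectral_sequence.
Context {R : realType} {H : hilbertType R}.
Variables (e : nat -> H).

(* Successive deflations of an operator, each paired with the projector onto
   the orthogonal complement of the eigenvectors found so far. *)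
Fixpoint deflation (T : H -> H) n : (H -> H) * (H -> H) :=
  if n is m.+1 then
    let: (A, Q) := deflation T m in
    (peel (top A) (eigvec e A Q) A, peel 1 (eigvec e A Q) Q)
  else (T, idfun).

Definition eigval T n : R := top (deflation T n).1.
Definition eigenvec T n : H := eigvec e (deflation T n).1 (deflation T n).2.

Lemma deflationS T n : deflation T n.+1 =
  (peel (eigval T n) (eigenvec T n) (deflation T n).1,
   peel 1 (eigenvec T n) (deflation T n).2).
Proof. by rewrite /= /eigval /eigenvec; case: (deflation T n). Qed.

Variables (T : H -> H) (M : R).
Hypotheses (oe : onb e) (pT : positive_op T) (TM : finite_trace e T M).
Notation sg := (eigval T).
Notation ph := (eigenvec T).
Let A n := (deflation T n).1.
Let Q n := (deflation T n).2.

Lemma deflation_deflated n : deflated e (A n) (Q n) M.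
Proof.
elim: n => [|n ih].
  split=> //; split=> //; apply: (@positive_opP _ _ _ 1) => //.
  - by move=> x; exact: sqn_ge0.
  - by move=> x; rewrite mul1r.
by rewrite /A /Q deflationS; exact: peel_deflated.
Qed.

Let AS n : A n.+1 = peel (sg n) (ph n) (A n). Proof. by rewrite /A deflationS. Qed.
Let QS n : Q n.+1 = peel 1 (ph n) (Q n). Proof. by rewrite /Q deflationS. Qed.
Let pA n : positive_op (A n). Proof. by case: (deflation_deflated n). Qed.
Let pQ n : positive_op (Q n). Proof. by case: (deflation_deflated n) => _ []. Qed.

Let Qph n : Q n (ph n) = ph n.
Proof. exact: eigvec_Q (deflation_deflated n). Qed.

Lemma deflationE n x :
  A n x = T x - \sum_(0 <= k < n) (sg k)%:C *: tensor (ph k) (ph k) x.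
Proof.
elim: n => [|n ih]; first by rewrite big_geq// subr0.
by rewrite AS /peel ih big_nat_recr//= opprD addrA.
Qed.

Lemma deflationQE n x :
  Q n x = x - \sum_(0 <= k < n) hdot x (ph k) *: ph k.
Proof.
elim: n => [|n ih]; first by rewrite big_geq// subr0.
by rewrite QS /peel ih big_nat_recr//= opprD addrA scale1r.
Qed.

Lemma eigenvec_sqn n : sqn (ph n) = (ph n != 0)%:R.
Proof. exact: eigvec_sqn. Qed.

Lemma deflationQ_eigenvec m n : (m < n)%N -> Q n (ph m) = 0.
Proof.
elim: n => [//|n ih]; rewrite ltnS leq_eqVlt => /predU1P[<-|/ih h].
  rewrite QS /peel /tensor hdotxx eigenvec_sqn.
  rewrite Qph scale1r.
  by case: eqP => [->|_]; rewrite ?scaler0 ?subrr// scale1r subrr.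
rewrite QS /peel /tensor h -[X in hdot _ X]Qph.
by rewrite -(positive_sym (pQ n)) h hdot0l scale0r scaler0 subr0.
Qed.

(** [Q n] is symmetric, fixes [ph n] and kills the earlier vectors. *)
Lemma eigenvec_ons : ons ph.
Proof.
suff h m n : (m < n)%N -> hdot (ph m) (ph n) = 0.
  move=> m n; case: ltngtP => [mn|nm|->] /=; first exact: h.
    by rewrite hdotC h// rmorph0.
  by rewrite hdotxx eigenvec_sqn; case: (ph n != 0).
move=> mn; rewrite -[ph n]Qph.
by rewrite -(positive_sym (pQ n)) deflationQ_eigenvec// hdot0l.
Qed.

Lemma eigval_ge0 n : 0 <= sg n.
Proof. exact/top_ge0/pA. Qed.

Lemma eigval_nonincreasing m n : (m <= n)%N -> sg n <= sg m.
Proof.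
apply: (@homo_leq _ sg (fun a b => b <= a)) => // [a b c ab bc|k].
  exact: le_trans bc ab.
by rewrite /eigval deflationS; exact: top_peel_le (deflation_deflated k).
Qed.

Lemma eigenvecE n : T (ph n) = (sg n)%:C *: ph n.
Proof.
have <- : A n (ph n) = (sg n)%:C *: ph n by exact: eigvec_A (deflation_deflated n).
rewrite deflationE.
rewrite big_nat_cond big1 ?subr0// => k /andP[/andP[_ kn] _].
by rewrite /tensor eigenvec_ons (gtn_eqF kn) scale0r scaler0.
Qed.

Lemma eigenvec0 n : ph n = 0 -> forall x, Q n x = 0.
Proof. exact: eigvec0 oe (deflation_deflated n). Qed.

Lemma eigenvec0_expansion n x : ph n = 0 ->
  x = \sum_(0 <= k < n) hdot x (ph k) *: ph k.
Proof.
by move=> h; apply/eqP; rewrite -subr_eq0 -deflationQE; apply/eqP/eigenvec0.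
Qed.

Lemma eigenvec0_eigval n : ph n = 0 -> sg n = 0.
Proof.
move=> h; apply/eqP; rewrite eq_le eigval_ge0 andbT.
apply: top_le => // x.
have -> : (deflation T n).1 x = 0.
  exact: eigvec0_A oe (deflation_deflated n) h x.
by rewrite rdot0l mul0r.
Qed.

Lemma eigval_sqn n : sg n * sqn (ph n) = sg n.
Proof.
rewrite eigenvec_sqn; have [/eigenvec0_eigval ->|_] := eqVneq (ph n) 0.
  by rewrite mul0r.
by rewrite mulr1.
Qed.

Lemma eigval_rdot_le n x :
  \sum_(0 <= k < n) sg k * csq (hdot x (ph k)) <= rdot (T x) x.
Proof.
have := positive_ge0 x (pA n); rewrite deflationE rdotBl rdot_suml subr_ge0.
by under eq_bigr do rewrite rdotZl tensor_rdot.
Qed.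

(** By Parseval each eigenvalue is the sum over [j] of [sg k * csq (hdot (ph k) (e j))]. For fixed
    [j] the sum over [k] is at most the form of [T] at [e j], because the remaining deflation is
    positive. *)
Lemma eigval_sum_le n : \sum_(0 <= k < n) sg k <= M.
Proof.
have h J : \sum_(0 <= j < J) \sum_(0 <= k < n) sg k * csq (hdot (ph k) (e j)) <= M.
  apply: le_trans (TM J); apply: ler_sum => j _.
  apply: le_trans (eigval_rdot_le n (e j)); apply: ler_sum => k _.
  by rewrite hdotC csqJ.
apply: le_lim_seq (cvg_cst M) h.
under eq_fun do rewrite exchange_big/=; under eq_bigr do rewrite -eigval_sqn.
apply: cvg_sum_seq => k; under eq_fun do rewrite -mulr_sumr.
by apply: cvgM; [exact: cvg_cst|exact: onb_parseval].
Qed.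

Lemma eigval_cvg0 : sg n @[n --> \oo] --> (0 : R).
Proof.
have : cvgn (series sg).
  exact: bounded_series_cvg eigval_ge0 eigval_sum_le.
exact: cvg_series_cvg_0.
Qed.

(** At such an [x] every deflation agrees with [T], while its top, the n-th eigenvalue, tends to
    0. *)
Lemma eigenvec_complete x : (forall n, hdot x (ph n) = 0) -> T x = 0.
Proof.
move=> x0; apply: positive_rdot0 => //; apply/eqP.
rewrite eq_le positive_ge0// andbT.
rewrite -(mul0r (sqn x)).
apply: (le_lim_seq (cvg_cst (rdot (T x) x)) (cvgM eigval_cvg0 (cvg_cst (sqn x)))).
move=> n; suff -> : T x = A n x by exact: top_bounded.
rewrite deflationE big1 ?subr0// => k _.
by rewrite /tensor x0 scale0r scaler0.
Qed.

End spectral_sequence.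

Lemma esum_exchange {R : realType} {I J : choiceType} (P : set I) (Q : set J)
    (a : I -> J -> \bar R) : (forall i j, (0 <= a i j)%E) ->
  (\esum_(i in P) \esum_(j in Q) a i j = \esum_(j in Q) \esum_(i in P) a i j)%E.
Proof.
move=> a0; rewrite !esum_esum//.
rewrite (reindex_esum (Q `*`` (fun=> P)) _ (fun x => (x.2, x.1)))//.
split=> //=; first by move=> [i j] [? ?].
  by move=> [i j] [k l] _ _ /= [-> ->].
by move=> [i j] [? ?]; exists (j, i).
Qed.

Lemma nneseries_le {R : realType} (a : nat -> R) M : (forall k, 0 <= a k) ->
  ((\sum_(0 <= k <oo) (a k)%:E <= M%:E)%E <->
   forall n, \sum_(0 <= k < n) a k <= M).
Proof.
move=> a0; split=> [h n|h].
  rewrite -lee_fin -sumEFin (le_trans _ h)//.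
  by apply: nneseries_lim_ge => k _; rewrite lee_fin.
apply: lime_le; first by apply: is_cvg_nneseries => k _ _; rewrite lee_fin.
by apply: nearW => n; rewrite sumEFin lee_fin.
Qed.

(** * Traces and trace norms *)

Section traces.
Context {R : realType}.

Lemma esum_sqn_adjoint {H G : hilbertType R} (B : set H) (g : nat -> G)
    (Q : H -> G) S : hilbert_basis B -> onb g -> is_adjoint Q S ->
  (\esum_(b in B) (sqn (Q b))%:E = \sum_(0 <= k <oo) (sqn (S (g k)))%:E)%E.
Proof.
move=> hB og QS; rewrite nneseries_esumT; last by move=> k; rewrite lee_fin sqn_ge0.
transitivity (\esum_(b in B) \esum_(k in [set: nat]) (csq (hdot b (S (g k))))%:E)%E.
  apply: eq_esum => b _; rewrite -(onb_eparseval (Q b) og) nneseries_esumT.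
    by apply: eq_esum => k _; rewrite QS.
  by move=> k; rewrite lee_fin csq_ge0.
rewrite esum_exchange; last by move=> i j; rewrite lee_fin csq_ge0.
apply: eq_esum => k _; rewrite -(basis_parseval (S (g k)) hB).
by apply: eq_esum => b _; rewrite hdotC csqJ.
Qed.

Lemma series_sqn_adjoint {H G : hilbertType R} (e : nat -> H) (g : nat -> G)
    (Q : H -> G) S : onb e -> onb g -> is_adjoint Q S ->
  (\sum_(0 <= j <oo) (sqn (Q (e j)))%:E = \sum_(0 <= k <oo) (sqn (S (g k)))%:E)%E.
Proof.
move=> oe og QS; rewrite !nneseries_esumT; do ?by move=> k; rewrite lee_fin sqn_ge0.
transitivity (\esum_(j in [set: nat]) \esum_(k in [set: nat]) (csq (hdot (e j) (S (g k))))%:E)%E.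
  apply: eq_esum => b _; rewrite -(onb_eparseval (Q (e b)) og) nneseries_esumT.
    by apply: eq_esum => k _; rewrite QS.
  by move=> k; rewrite lee_fin csq_ge0.
rewrite esum_exchange; last by move=> i j; rewrite lee_fin csq_ge0.
apply: eq_esum => k _; rewrite -(onb_eparseval (S (g k)) oe) nneseries_esumT.
  by apply: eq_esum => b _; rewrite hdotC csqJ.
by move=> j; rewrite lee_fin csq_ge0.
Qed.

(** Two passages through the adjoint, each a double sum evaluated by Parseval, replace the arbitrary
    basis [hbasis H] first by [g] and then by [e]. *)
Lemma trace_pos_sqn {H G : hilbertType R} (e : nat -> H) (g : nat -> G)
    (Q : H -> G) : hilbert_basis (hbasis H) -> onb e -> onb g -> bounded_op Q ->
  (trace_pos (adjoint Q \o Q) = \sum_(0 <= j <oo) (sqn (Q (e j)))%:E)%E.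
Proof.
move=> hH oe og bQ; have [S QS] := adjoint_exists oe bQ.
rewrite (adjointE QS) (series_sqn_adjoint oe og QS) -(esum_sqn_adjoint hH og QS).
by apply: eq_esum => b _ /=; rewrite -/(rdot _ _) rdotC -(is_adjoint_rdot QS).
Qed.

Context {H : hilbertType R} (e : nat -> H).
Hypotheses (hH : hilbert_basis (hbasis H)) (oe : onb e).

Lemma positive_adjointE (T : H -> H) : positive_op T -> adjoint T = T.
Proof. by move=> /positive_sym/adjointE. Qed.

Lemma trace_posE (T : H -> H) : positive_op T ->
  (trace_pos T = \sum_(0 <= j <oo) (rdot (T (e j)) (e j))%:E)%E.
Proof.
move=> pT; have [Q pQ QT] := positive_sqrt pT.
rewrite -{1}QT -{1}(positive_adjointE pQ) (trace_pos_sqn hH oe oe pQ.1).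
by apply: eq_eseriesr => j _; rewrite -QT /= (positive_rdotC _ _ pQ).
Qed.

Lemma sqrt_opP (T : H -> H) : positive_op T ->
  positive_op (sqrt_op T) /\ sqrt_op T \o sqrt_op T = T.
Proof.
move=> pT; have [S pS ST] := positive_sqrt pT.
exact: (@getPex _ [set S | positive_op S /\ S \o S = T] (ex_intro _ S (conj pS ST))).
Qed.

Lemma adjointP (T : H -> H) : bounded_op T -> is_adjoint T (adjoint T).
Proof. by move=> bT; have [S TS] := adjoint_exists oe bT; rewrite (adjointE TS). Qed.

Lemma adjoint_comp_positive (T : H -> H) : bounded_op T ->
  positive_op (adjoint T \o T).
Proof.
move=> bT; have TS := adjointP bT; have [M M0 TM] := bounded_op_ex bT.
have SM := is_adjoint_bounded M0 TS TM.
have ra := is_adjoint_rdot TS.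
apply: (@positive_opP _ _ _ (M * M)) => /=.
- by move=> c x y /=; rewrite bT.1 (is_adjoint_linear (is_adjointC TS)).
- by move=> x y; rewrite rdotC -ra rdotC ra.
- by move=> x; rewrite rdotC -ra sqn_ge0.
- by rewrite mulr_ge0.
- by move=> x; rewrite (le_trans (SM _))// -mulrA ler_wpM2l.
Qed.

Lemma adjoint_comp_rdot (T : H -> H) x : bounded_op T ->
  rdot ((adjoint T \o T) x) x = sqn (T x).
Proof. by move=> /adjointP TS /=; rewrite rdotC -(is_adjoint_rdot TS). Qed.

Lemma abs_opP (T : H -> H) : bounded_op T ->
  positive_op (abs_op T) /\ abs_op T \o abs_op T = adjoint T \o T.
Proof. by move=> bT; exact: sqrt_opP (adjoint_comp_positive bT). Qed.

Lemma abs_op_sqn (T : H -> H) x : bounded_op T -> sqn (abs_op T x) = sqn (T x).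
Proof.
move=> bT; have [pS SS] := abs_opP bT.
by rewrite -sqnE (positive_rdotC _ _ pS) rdotC -adjoint_comp_rdot// -SS.
Qed.

(** The vector [y = S x - s x] satisfies [S y = - s y], which positivity of [S] allows only for
    [y = 0]. *)
Lemma sqrt_eigen (S : H -> H) x s : positive_op S -> 0 <= s ->
  S (S x) = (s ^+ 2)%:C *: x -> S x = s%:C *: x.
Proof.
move=> pS; rewrite le_eqVlt => /predU1P[<-|s0] SS.
  rewrite scale0r; apply/eqP; rewrite -sqn_eq0 -sqnE (positive_rdotC _ _ pS) SS.
  by rewrite expr0n scale0r rdot0r.
have lS := positive_linear pS.
pose y := S x - s%:C *: x.
have Sy : S y = - s%:C *: y.
  rewrite /y (linB lS) (linZ lS) SS scalerBr scaleNr scalerA -rmorphN/=.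
  by rewrite -rmorphM mulNr -expr2 rmorphN scaleNr opprK addrC.
apply/eqP; rewrite -subr_eq0 -sqn_eq0 eq_le sqn_ge0 andbT -/y.
rewrite -(ler_pM2l s0) mulr0.
have := positive_ge0 y pS; rewrite Sy -rmorphN rdotZl sqnE; lra.
Qed.

(** Parseval for the square root [Q] at [x]: its coefficients are [hdot x (Q (e k))], and the
    squared norms of the [Q (e k)] add up to the trace. *)
Lemma trace_rdot_bounded (S : H -> H) t : positive_op S -> finite_trace e S t ->
  rdot_bounded S t.
Proof.
move=> pS St x; have [Q pQ QS] := positive_sqrt pS.
have QE z : rdot (S z) z = sqn (Q z) by rewrite -QS /= (positive_rdotC _ _ pQ).
rewrite QE; apply: le_lim_seq (onb_parseval (x := Q x) oe) (cvg_cst (t * sqn x)) _.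
move=> n; apply: (@le_trans _ _ (\sum_(0 <= k < n) sqn (Q (e k)) * sqn x)).
  by apply: ler_sum => k _; rewrite (positive_sym pQ) mulrC CS_hdot.
rewrite -mulr_suml ler_wpM2r ?sqn_ge0//.
by under eq_bigr do rewrite -QE; exact: St.
Qed.

(** Uniqueness of the positive root when one root has finite trace; it identifies the [abs_op]
    chosen by [get]. The roots agree on the eigenvectors of [T] and both vanish on the orthogonal
    complement, so their symmetric difference [D] is 0. *)
Lemma square_inj (S T : H -> H) M : positive_op T -> finite_trace e T M ->
  positive_op S -> S \o S = T \o T -> S = T.
Proof.
move=> pT TM pS ST.
have lS := positive_linear pS; have lT := positive_linear pT.
pose ph := eigenvec e T; pose D x := S x - T x.
have SST x : S (S x) = T (T x) by exact: (congr1 (fun f => f x) ST).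
have Dph n : D (ph n) = 0.
  rewrite /D (eigenvecE pT TM) (@sqrt_eigen S _ (eigval e T n))// ?subrr//.
    exact: eigval_ge0 pT TM _.
  by rewrite SST !(eigenvecE pT TM, linZ lT) scalerA -rmorphM -expr2.
have D0 x : (forall n, hdot x (ph n) = 0) -> D x = 0.
  move=> x0; have Tx : T x = 0.
    exact (eigenvec_complete oe pT TM x0).
  rewrite /D Tx subr0; apply/eqP; rewrite -sqn_eq0 -sqnE (positive_rdotC _ _ pS).
  by rewrite SST Tx lin0// rdot0r.
have Dsym x y : hdot (D x) y = hdot x (D y).
  by rewrite /D hdotBl hdotBr (positive_sym pS) (positive_sym pT).
apply/funext => x; apply/eqP; rewrite -subr_eq0 -/(D x) -sqn_eq0; apply/eqP.
rewrite -sqnE /rdot Dsym D0 ?hdot0r// => n.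
by rewrite Dsym Dph hdot0r.
Qed.

Lemma trace_norm_positive (T : H -> H) M : positive_op T -> finite_trace e T M ->
  (trace_norm T = \sum_(0 <= j <oo) (rdot (T (e j)) (e j))%:E)%E.
Proof.
move=> pT TM; rewrite /trace_norm; case: asboolP => [bT|/(_ pT.1)//].
have [pS SS] := abs_opP bT; rewrite positive_adjointE// in SS.
by rewrite (square_inj pT TM pS SS) trace_posE.
Qed.

Lemma trace_norm_ge0 (T : H -> H) : (0 <= trace_norm T)%E.
Proof.
rewrite /trace_norm; case: asboolP => // bT; have [pS _] := abs_opP bT.
by apply: esum_ge0 => b _; rewrite lee_fin; exact: positive_ge0.
Qed.

Lemma trace_class_bounded (T : H -> H) : (trace_norm T < +oo)%E -> bounded_op T.
Proof. by rewrite /trace_norm; case: asboolP. Qed.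

Lemma trace_norm_abs (T : H -> H) : (trace_norm T < +oo)%E ->
  finite_trace e (abs_op T) (fine (trace_norm T)).
Proof.
move=> tT; have bT := trace_class_bounded tT; have [pS _] := abs_opP bT.
apply/nneseries_le; first by move=> k; exact: positive_ge0.
rewrite -trace_posE// fineK ?ge0_fin_numE ?trace_norm_ge0//.
by rewrite /trace_norm; case: asboolP.
Qed.

(** Only [abs_op T] is known to have finite trace here, so it takes the place of [T] in
    [square_inj], with [T] as the competing root. *)
Lemma positive_finite_trace (T : H -> H) : positive_op T -> (trace_norm T < +oo)%E ->
  finite_trace e T (fine (trace_norm T)).
Proof.
move=> pT tT; have St := trace_norm_abs tT.
have [pS SS] := abs_opP pT.1; rewrite positive_adjointE// in SS.
by rewrite [X in finite_trace e X _](square_inj pS St pT (esym SS)).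
Qed.

Lemma trace_norm_sqn (T : H -> H) x : (trace_norm T < +oo)%E ->
  sqn (T x) <= fine (trace_norm T) ^+ 2 * sqn x.
Proof.
move=> tT; have St := trace_norm_abs tT; have bT := trace_class_bounded tT.
have [pS _] := abs_opP bT; rewrite -abs_op_sqn//.
apply: rdot_bounded_bounded => //; first by rewrite fine_ge0// trace_norm_ge0.
exact: trace_rdot_bounded.
Qed.

(** The trace norm by duality. In contrast to [trace_norm], this bound is visibly subadditive and,
    being linear in [T] for fixed sequences, compatible with limits and integrals. *)
Definition nuclear_le (T : H -> H) c := forall ph ps : nat -> H, ons ph -> ons ps ->
  forall n, \sum_(0 <= k < n) rdot (T (ph k)) (ps k) <= c.

(** Singular value decomposition: with [ph] the eigenvectors of [adjoint T \o T] and [ps] the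
    normalized images, the sum tested by [nuclear_le] is that of the singular values, which
    dominates the partial traces of [abs_op T]. The bound [K] gives [W] a finite trace, so that its
    eigenvectors are available. *)
Lemma trace_norm_le (T : H -> H) K c : bounded_op T ->
  (forall n, \sum_(0 <= j < n) sqn (T (e j)) <= K) -> nuclear_le T c ->
  (trace_norm T <= c%:E)%E.
Proof.
move=> bT TK Tc; rewrite /trace_norm; case: asboolP => // _.
have [pS SS] := abs_opP bT; set S := abs_op T in pS SS *.
have pW := adjoint_comp_positive bT; set W := adjoint T \o T in SS pW.
have WK : finite_trace e W K.
  by move=> n; under eq_bigr do rewrite adjoint_comp_rdot//; exact: TK.
pose ph := eigenvec e W; pose w := eigval e W.
have oph : ons ph := eigenvec_ons pW WK.
have w0 k : 0 <= w k := eigval_ge0 pW WK k.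
have Sph k : S (ph k) = (Num.sqrt (w k))%:C *: ph k.
  apply: sqrt_eigen; rewrite ?sqrtr_ge0// sqr_sqrtr//.
  rewrite -(eigenvecE pW WK); exact: (congr1 (fun f => f (ph k)) SS).
have S0 x : (forall n, hdot x (ph n) = 0) -> S x = 0.
  move=> x0; apply/eqP; rewrite -sqn_eq0 abs_op_sqn// -adjoint_comp_rdot//.
  by rewrite -[X in rdot X _]/(W x) (eigenvec_complete oe pW WK x0) rdot0l.
have Sx x : \sum_(0 <= k < n) Num.sqrt (w k) * csq (hdot x (ph k)) @[n --> \oo]
    --> rdot (S x) x.
  have [p xp] := ons_series_cvg oph (fun n => ons_bessel x n oph).
  have -> : S x = S p.
    apply/eqP; rewrite -subr_eq0 -(linB (positive_linear pS)); apply/eqP/S0 => n.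
    rewrite hdotBl (ons_series_coef n oph xp).
    by have [->|_] := eqVneq (ph n) 0; rewrite ?hdot0r ?mulr0 ?mulr1 subrr.
  apply: eq_cvg_seq (cvg_rdotl (y := x) (bounded_op_cvg pS.1 xp)) => n.
  rewrite (lin_sum (positive_linear pS)) rdot_suml; apply: eq_bigr => k _.
  rewrite (linZ (positive_linear pS)) Sph scalerA mulrC -scalerA rdotZl.
  by rewrite /rdot hdotZl (hdotC (ph k)) csqE.
rewrite trace_posE//; apply/nneseries_le; first by move=> k; exact: positive_ge0.
move=> J.
have h : \sum_(0 <= k < n) Num.sqrt (w k) *
    (\sum_(0 <= j < J) csq (hdot (e j) (ph k))) @[n --> \oo] -->
    \sum_(0 <= j < J) rdot (S (e j)) (e j).
  apply: eq_cvg_seq (cvg_sum_seq (n := J) (fun j => Sx (e j))) => n.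
  rewrite exchange_big/=; apply: eq_bigr => k _; by rewrite mulr_sumr.
apply: le_lim_seq h (cvg_cst c) _ => n.
(* The left singular vectors; where [w k = 0] the inverse is 0 and the sequence is padded. *)
pose ps k := (Num.sqrt (w k))^-1%:C *: T (ph k).
have TT j k : hdot (T (ph j)) (T (ph k)) = (w j)%:C * hdot (ph j) (ph k).
  by rewrite -(is_adjointC (adjointP bT)) -[X in hdot X _]/(W (ph j)) (eigenvecE pW WK) hdotZl.
have sT k : sqn (T (ph k)) = w k * sqn (ph k).
  by apply: (@complexI R); rewrite -hdotxx TT hdotxx -rmorphM.
have psz k : (ps k != 0) = (w k != 0) && (ph k != 0).
  rewrite -(sqn_eq0 (ps k)) /ps sqnZr sT mulf_eq0 sqrf_eq0 invr_eq0 sqrtr_eq0.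
  rewrite mulf_eq0 sqn_eq0 !negb_or -ltNge lt_neqAle w0 andbT (eq_sym 0).
  by rewrite andbA andbb.
have ops : ons ps.
  move=> j k; rewrite /ps hdotZl hdotZrR TT oph psz.
  have [<-|jk] := eqVneq j k; last by rewrite !mulr0.
  have [_|ph0] /= := eqVneq (ph j) 0; first by rewrite !mulr0 andbF.
  have [->|wj0] /= := eqVneq (w j) 0; first by rewrite !mul0r !mulr0.
  by rewrite mulr1 -!rmorphM mulrA -expr2 exprVn sqr_sqrtr// mulVf.
apply: le_trans (Tc ph ps oph ops n); apply: ler_sum => k _.
rewrite /ps rdotZr sqnE.
rewrite sT.
have -> : (Num.sqrt (w k))^-1 * (w k * sqn (ph k)) = Num.sqrt (w k) * sqn (ph k).
  have [->|wk] := eqVneq (w k) 0; first by rewrite sqrtr0 !mul0r mulr0.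
  rewrite -{2}(sqr_sqrtr (w0 k)) expr2 !mulrA mulVf ?mul1r//.
  by rewrite sqrtr_eq0 -ltNge lt_neqAle w0 andbT eq_sym.
rewrite ler_wpM2l ?sqrtr_ge0//.
under eq_bigr do rewrite hdotC csqJ.
exact: ons_bessel oe.1.
Qed.

End traces.

(** * Duality estimates of the trace norm *)

Section nuclear.
Context {R : realType} {H : hilbertType R}.
Implicit Types (T S : H -> H).

Lemma CS_sum_rdot (u v : nat -> H) n :
  (\sum_(0 <= k < n) rdot (u k) (v k)) ^+ 2 <=
  (\sum_(0 <= k < n) sqn (u k)) * (\sum_(0 <= k < n) sqn (v k)).
Proof.
apply: discr_le; do ?by apply: sumr_ge0 => k _; exact: sqn_ge0.
move=> t; rewrite !mulr_sumr -!big_split/=; apply: sumr_ge0 => k _.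
rewrite (_ : _ + _ = sqn (u k + t%:C *: v k)) ?sqn_ge0//.
by rewrite sqnD sqnZr rdotZr mulrA.
Qed.

Lemma ons_opp (ps : nat -> H) : ons ps -> ons (fun k => - ps k).
Proof. by move=> ops m n; rewrite hdotNl hdotNr opprK ops oppr_eq0. Qed.

Lemma nuclear_leN T c : nuclear_le T c -> nuclear_le (fun x => - T x) c.
Proof.
move=> Tc ph ps oph ops n; under eq_bigr do rewrite rdotNl -rdotNr.
by apply: Tc => //; exact: ons_opp.
Qed.

Lemma nuclear_leD T S a b : nuclear_le T a -> nuclear_le S b ->
  nuclear_le (fun x => T x + S x) (a + b).
Proof.
move=> Ta Sb ph ps oph ops n; under eq_bigr do rewrite rdotDl.
by rewrite big_split/= lerD ?Ta ?Sb.
Qed.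

Lemma nuclear_leB T S a b : nuclear_le T a -> nuclear_le S b ->
  nuclear_le (fun x => T x - S x) (a + b).
Proof. by move=> Ta /nuclear_leN Sb; exact: nuclear_leD. Qed.

Lemma nuclear_le_trans T a b : a <= b -> nuclear_le T a -> nuclear_le T b.
Proof. by move=> ab Ta ph ps oph ops n; rewrite (le_trans _ ab)// Ta. Qed.

Lemma nuclear_le_sum n (T : nat -> H -> H) (c : nat -> R) :
  (forall k, nuclear_le (T k) (c k)) ->
  nuclear_le (fun x => \sum_(0 <= k < n) T k x) (\sum_(0 <= k < n) c k).
Proof.
move=> Tc; elim: n => [|n ih] ph ps oph ops m.
  by rewrite [leRHS]big_geq// big1// => k _; rewrite big_geq// rdot0l.
rewrite big_nat_recr//=; under eq_bigr do rewrite big_nat_recr//=.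
exact: (nuclear_leD ih (Tc n) oph ops m).
Qed.

(** A product of two coefficients is at most the mean of their squares; Bessel applies to each
    half. *)
Lemma nuclear_le_tensor (x y : H) r : sqn x <= 1 -> sqn y <= 1 ->
  nuclear_le (fun u => r%:C *: tensor x y u) `|r|.
Proof.
move=> x1 y1 ph ps oph ops n; under eq_bigr do rewrite rdotZl.
rewrite -mulr_sumr (le_trans (ler_norm _))// normrM -[leRHS]mulr1 ler_wpM2l//.
rewrite (le_trans (ler_norm_sum _ _ _))//.
apply: (@le_trans _ _ (\sum_(0 <= k < n) (csq (hdot y (ph k)) + csq (hdot x (ps k))) / 2)).
  apply: ler_sum => k _; rewrite /rdot /tensor hdotZl (hdotC (ph k)) -(csqJ (hdot y _)).
  case: (hdot y (ph k))^* (hdot x (ps k)) => [a b] [u v]; rewrite /csq/=.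
  rewrite ler_norml; have := sqr_ge0 (a - u); have := sqr_ge0 (b - v).
  have := sqr_ge0 (a + u); have := sqr_ge0 (b + v).
  by rewrite !expr2 => *; apply/andP; split; lra.
rewrite -mulr_suml big_split/= ler_pdivrMr// mul1r.
rewrite [leRHS](_ : 2 = 1 + 1)//; apply: lerD.
  by rewrite (le_trans (ons_bessel _ _ oph)).
by rewrite (le_trans (ons_bessel _ _ ops)).
Qed.

Variables (e : nat -> H).
Hypotheses (hH : hilbert_basis (hbasis H)) (oe : onb e).

Lemma ons_sqn_le Q S K ph n : is_adjoint Q S ->
  (forall n, \sum_(0 <= j < n) sqn (S (e j)) <= K) -> ons ph ->
  \sum_(0 <= k < n) sqn (Q (ph k)) <= K.
Proof.
move=> QS SK oph.
have h : \sum_(0 <= k < n) \sum_(0 <= j < J) csq (hdot (Q (ph k)) (e j))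
    @[J --> \oo] --> \sum_(0 <= k < n) sqn (Q (ph k)).
  by apply: cvg_sum_seq => k; exact: onb_parseval.
apply: le_lim_seq h (cvg_cst K) _ => J; apply: le_trans (SK J).
rewrite exchange_big/=; apply: ler_sum => j _.
under eq_bigr do rewrite QS hdotC csqJ.
exact: ons_bessel.
Qed.

Lemma finite_trace_sqrt T Q M : positive_op Q -> Q \o Q = T ->
  finite_trace e T M -> forall n, \sum_(0 <= j < n) sqn (Q (e j)) <= M.
Proof.
move=> pQ QT TM n; apply: le_trans (TM n); rewrite -QT.
by apply: ler_sum => j _ /=; rewrite (positive_rdotC _ _ pQ).
Qed.

Lemma nuclear_le_positive T M : positive_op T -> finite_trace e T M ->
  nuclear_le T M.
Proof.
move=> pT TM ph ps oph ops n; have [Q pQ QT] := positive_sqrt pT.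
have QM := finite_trace_sqrt pQ QT TM.
have aQ := positive_sym pQ.
have h1 := ons_sqn_le n aQ QM oph; have h2 := ons_sqn_le n aQ QM ops.
apply: (@le_trans _ _ (\sum_(0 <= k < n) (sqn (Q (ph k)) + sqn (Q (ps k))) / 2)).
  by apply: ler_sum => k _; rewrite -QT /= (positive_rdotC _ _ pQ) rdot_le.
rewrite -mulr_suml big_split/= ler_pdivrMr//; lra.
Qed.

Definition eproj n (x : H) := \sum_(0 <= k < n) hdot x (e k) *: e k.

Lemma eproj_adjoint n : is_adjoint (eproj n) (eproj n).
Proof.
move=> x y; rewrite /eproj hdot_suml hdot_sumr; apply: eq_bigr => k _.
by rewrite hdotZl hdotZr mulrC (hdotC (e k)).
Qed.

Lemma eproj_e n j : eproj n (e j) = if (j < n)%N then e j else 0.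
Proof.
rewrite /eproj; case: ifPn => jn.
  rewrite (bigD1_seq j) ?iota_uniq ?mem_index_iota//= big1.
    rewrite addr0 oe.1 eqxx; case: eqP => [->|_]; rewrite ?scaler0//.
    by rewrite scale1r.
  by move=> k kj; rewrite oe.1 eq_sym (negbTE kj) scale0r.
rewrite big_nat_cond big1// => k /andP[/andP[_ kn] _].
rewrite oe.1 (_ : (j == k) = false) ?scale0r//.
by apply: contraNF jn => /eqP ->.
Qed.

Lemma finite_trace_ge0 T M : finite_trace e T M -> 0 <= M.
Proof. by move=> /(_ 0%N); rewrite big_geq. Qed.

(** With [P] the projection and [C = 1 - P], the difference is [C T + P T C]. Writing [T = Q Q],
    each term pairs [Q] or [Q P], of squared Hilbert-Schmidt norm at most [M], with [Q C], of
    squared norm at most the tail [t]; Cauchy-Schwarz yields the root of [M * t] twice. *)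
Lemma nuclear_le_compression T M t n : positive_op T -> finite_trace e T M ->
  (forall J, \sum_(n <= j < J) rdot (T (e j)) (e j) <= t) ->
  nuclear_le (fun x => T x - eproj n (T (eproj n x))) (2 * Num.sqrt (M * t)).
Proof.
move=> pT TM Tt ph ps oph ops m; have [Q pQ QT] := positive_sqrt pT.
have QM := finite_trace_sqrt pQ QT TM.
have aQ := positive_sym pQ; have M0 := finite_trace_ge0 TM.
have t0 : 0 <= t by have := Tt n; rewrite big_geq.
have QE x : T x = Q (Q x) by rewrite -QT.
pose C x := x - eproj n x.
have aC : is_adjoint C C by move=> x y; rewrite /C hdotBl hdotBr eproj_adjoint.
have Ce j : C (e j) = if (j < n)%N then 0 else e j.
  by rewrite /C eproj_e; case: ifP; rewrite ?subrr ?subr0.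
have aP := eproj_adjoint n.
have lQ := positive_linear pQ.
have QCe J : \sum_(0 <= j < J) sqn (Q (C (e j))) <= t.
  apply: le_trans (Tt (n + J)%N).
  apply: (@le_trans _ _ (\sum_(0 <= j < n + J) sqn (Q (C (e j))))).
    by rewrite [leRHS](big_cat_nat (n := J)) ?leq_addl//= lerDl sumr_ge0// => k _; exact: sqn_ge0.
  rewrite (big_cat_nat (n := n)) ?leq_addr//= big_nat_cond big1 ?add0r.
    rewrite [leLHS]big_nat_cond [leRHS]big_nat_cond.
    apply: ler_sum => j /andP[/andP[nj _] _].
    by rewrite Ce ltnNge nj/= QE (positive_rdotC _ _ pQ).
  by move=> j /andP[/andP[_ jn] _]; rewrite Ce jn lin0// sqn0.
have QPe J : \sum_(0 <= j < J) sqn (Q (eproj n (e j))) <= M.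
  apply: le_trans (QM J); apply: ler_sum => j _.
  by rewrite eproj_e; case: ifP => // _; rewrite lin0// sqn0 sqn_ge0.
(* [Q B] and its adjoint [B Q] have the same Hilbert-Schmidt norm. *)
have dual B K : is_adjoint B B ->
    (forall J, \sum_(0 <= j < J) sqn (Q (B (e j))) <= K) ->
    forall ph, ons ph -> \sum_(0 <= k < m) sqn (Q (B (ph k))) <= K.
  move=> aB QBK ph' oph'.
  have aQB := is_adjoint_comp aB aQ.
  apply: (ons_sqn_le (S := B \o Q) (Q := Q \o B)) => //.
  apply/nneseries_le; first by move=> k; exact: sqn_ge0.
  rewrite -(series_sqn_adjoint oe oe aQB).
  by apply/nneseries_le => // k; exact: sqn_ge0.
have aid : is_adjoint (@idfun H) idfun by [].
have h1 := dual _ _ aid QM ph oph.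
have h2 := dual _ _ aC QCe ps ops.
have h3 := dual _ _ aC QCe ph oph.
have h4 := dual _ _ aP QPe ps ops.
have key a b : a ^+ 2 <= b -> 0 <= b -> b <= M * t -> a <= Num.sqrt (M * t).
  move=> ab b0 bMt; rewrite (le_trans (ler_norm _))// -sqrtr_sqr ler_wsqrtr//.
  exact: le_trans bMt.
rewrite (_ : \sum_(_ <= _ < _) _ =
  \sum_(0 <= k < m) rdot (Q (ph k)) (Q (C (ps k))) +
  \sum_(0 <= k < m) rdot (Q (C (ph k))) (Q (eproj n (ps k)))); last first.
  rewrite -big_split/=; apply: eq_bigr => k _.
  rewrite -!(is_adjoint_rdot aQ) -(is_adjoint_rdot aC) -(is_adjoint_rdot aP).
  rewrite -rdotDl -!QE; congr (rdot _ _).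
  rewrite /C (linB (positive_linear pT)) (linB (is_adjoint_linear aP)).
  by rewrite addrA subrK.
rewrite mulr_natl mulr2n; apply: lerD.
  apply: key (CS_sum_rdot _ _ _) _ _.
    by rewrite mulr_ge0// sumr_ge0// => k _; exact: sqn_ge0.
  by rewrite ler_pM// sumr_ge0// => k _; exact: sqn_ge0.
apply: key (CS_sum_rdot _ _ _) _ _.
  by rewrite mulr_ge0// sumr_ge0// => k _; exact: sqn_ge0.
by rewrite (mulrC M) ler_pM// sumr_ge0// => k _; exact: sqn_ge0.
Qed.

(** The Hilbert-Schmidt property in the fixed basis [e], visibly stable under linear combinations;
    it supplies the first hypotheses of [trace_norm_le]. *)
Definition hs T := bounded_op T /\
  exists K, forall n, \sum_(0 <= j < n) sqn (T (e j)) <= K.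

Lemma hsP T M K : linear T -> 0 <= M -> sqn_bounded T M ->
  (forall n, \sum_(0 <= j < n) sqn (T (e j)) <= K) -> hs T.
Proof.
by move=> lT M0 TM TK; split; [apply/bounded_opP => //; exists M|exists K].
Qed.

Lemma hsD T S c : hs T -> hs S -> hs (fun x => T x + c *: S x).
Proof.
move=> [bT [K TK]] [bS [L SL]].
have [M M0 TM] := bounded_op_ex bT; have [N N0 SN] := bounded_op_ex bS.
have h x : sqn (T x + c *: S x) <= 2 * (sqn (T x) + csq c * sqn (S x)).
  by rewrite (le_trans (sqnD_le _ _))// sqnZ.
apply: (@hsP _ (2 * (M + csq c * N)) (2 * (K + csq c * L))).
- by move=> a x y; rewrite bT.1 bS.1 !scalerDr !scalerA (mulrC c) addrACA.
- by rewrite mulr_ge0// addr_ge0// mulr_ge0// csq_ge0.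
- move=> x; rewrite (le_trans (h x))// -mulrA ler_pM2l// [leRHS]mulrDl lerD//.
  by rewrite -[leRHS]mulrA ler_wpM2l ?csq_ge0.
- move=> n; apply: le_trans (ler_sum _ (fun j _ => h (e j))) _.
  by rewrite -mulr_sumr ler_pM2l// big_split/= lerD// -mulr_sumr ler_wpM2l ?csq_ge0.
Qed.

Lemma hs0 : hs (fun=> 0).
Proof.
apply: (@hsP _ 0 0) => //; first by move=> c x y; rewrite scaler0 addr0.
  by move=> x; rewrite sqn0 mul0r.
by move=> n; rewrite big1// => j _; rewrite sqn0.
Qed.

Lemma hs_sum (I : Type) (s : seq I) (P : pred I) (c : I -> R[i]) (T : I -> H -> H) :
  (forall i, P i -> hs (T i)) -> hs (\sum_(i <- s | P i) c i *: T i).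
Proof.
move=> Ths; elim/big_rec: _ => [|i S Pi hS]; first exact: hs0.
by rewrite addrC; apply: hsD => //; exact: Ths.
Qed.

Lemma hs_positive T M : positive_op T -> finite_trace e T M -> hs T.
Proof.
move=> pT TM; have M0 := finite_trace_ge0 TM.
have TMr := trace_rdot_bounded oe pT TM.
apply: (@hsP _ (M ^+ 2) (M * M)); rewrite ?sqr_ge0//; first exact: positive_linear.
  exact: rdot_bounded_bounded.
move=> n; apply: (@le_trans _ _ (\sum_(0 <= j < n) M * rdot (T (e j)) (e j))).
  by apply: ler_sum => j _; exact: rdot_bounded_sqn.
by rewrite -mulr_sumr ler_wpM2l.
Qed.

Lemma hs_tensor (x y : H) : hs (tensor x y).
Proof.
apply: (@hsP _ (sqn x * sqn y) (sqn x * sqn y)); first exact: tensor_linear.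
- by rewrite mulr_ge0 ?sqn_ge0.
- exact: tensor_sqn_bounded.
move=> n; rewrite /tensor; under eq_bigr do rewrite sqnZ hdotC csqJ mulrC.
by rewrite -mulr_sumr ler_wpM2l ?sqn_ge0// ons_bessel//; exact: oe.1.
Qed.

Lemma hs_trace_norm_le T c : hs T -> nuclear_le T c -> (trace_norm T <= c%:E)%E.
Proof. by move=> [bT [K TK]]; exact: trace_norm_le bT TK. Qed.

End nuclear.

Lemma sqn_cauchy_eps {R : realType} {H : hilbertType R} (u : nat -> H) :
  (forall eps, 0 < eps -> exists N, forall m n, (N <= m)%N -> (N <= n)%N ->
    sqn (u m - u n) <= eps) ->
  exists x : H, u n @[n --> \oo] --> x.
Proof.
move=> uc; apply/cvg_ex; apply: cauchy_cvg; apply/cauchyP => -[e1 e2].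
rewrite ltcE/= => /andP[/eqP -> e0].
have [|N hN] := uc (e1 ^+ 2 / 2); first by rewrite divr_gt0// exprn_gt0.
exists (u N); exists N => // n /= Nn; rewrite -ball_normE /=.
rewrite normE ltcR -(@ltr_pXn2r _ 2)// ?nnegrE ?sqrtr_ge0 ?(ltW e0)//.
rewrite sqr_sqrtr ?sqn_ge0// (le_lt_trans (hN _ _ (leqnn _) Nn))//.
by rewrite ltr_pdivrMr// ltr_pMr ?exprn_gt0// ltr1n.
Qed.

(** * Bases and dimension *)

Section bases.
Context {R : realType} {H : hilbertType R}.

Lemma hbasisP N : hilbert_dim H N -> hilbert_basis (hbasis H).
Proof. by move=> [B hB _]; rewrite /hbasis; apply: getPex; exists B. Qed.

Lemma hilbert_dim_onb N : hilbert_dim H N ->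
  exists2 e : nat -> H, onb e & forall n, (e n != 0) = below N n.
Proof.
move=> [B hB]; rewrite card_eq_sym => /card_set_bijP[f [fS fI fsurj]].
have [[B1 B0] dB] := hB.
have fB n : below N n -> B (f n) by move=> nN; exact: fS.
have fne n : below N n -> f n != 0.
  move=> nN; apply/eqP => f0; have := B1 _ (fB n nN).
  by rewrite f0 hdot0l => /eqP; rewrite eq_sym oner_eq0.
exists (fun n => if below N n then f n else 0); last first.
  by move=> n; case: ifP => nN; rewrite ?fne ?nN// eqxx.
split=> [m n|x x0].
  have [nN|nN] := boolP (below N n); last by rewrite hdot0r eqxx andbF.
  rewrite fne// andbT; have [mN|mN] := boolP (below N m); last first.
    by rewrite hdot0l; case: eqP => // mn; rewrite mn nN in mN.
  have [->|/eqP mn] := eqVneq m n; first by rewrite B1//; exact: fB.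
  rewrite B0//; do ?exact: fB.
  by move=> fmn; apply: mn; apply: fI fmn; exact: mem_set.
apply/eqP; rewrite -sqn_eq0 -(inj_eq (@EFin_inj R)); apply/eqP.
rewrite -(basis_parseval x hB); apply: esum1 => b Bb.
have [n nN fn] : (f @` [set n | below N n]) b by exact: fsurj.
by have := x0 n; rewrite nN fn => ->; rewrite csqR expr0n.
Qed.

(** The double sum of [csq (hdot (u j) (e i))] is evaluated by Parseval in [e] and bounded by Bessel
    in [u], each nonzero [e i] contributing at most 1. *)
Lemma ons_dim_le (e u : nat -> H) m K : onb e -> ons u ->
  (forall j, (m <= j)%N -> e j = 0) -> \sum_(0 <= j < K) sqn (u j) <= m%:R.
Proof.
move=> oe ou e0.
have h : \sum_(0 <= j < K) \sum_(0 <= i < n) csq (hdot (u j) (e i)) @[n --> \oo]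
    --> \sum_(0 <= j < K) sqn (u j).
  by apply: cvg_sum_seq => j; exact: onb_parseval.
apply: le_lim_seq h (cvg_cst (m%:R : R)) _ => n; rewrite exchange_big/=.
apply: (@le_trans _ _ (\sum_(0 <= i < n) (i < m)%N%:R)).
  apply: ler_sum => i _; under eq_bigr do rewrite hdotC csqJ.
  apply: le_trans (ons_bessel _ _ ou) _.
  case: ltnP => im; first exact: ons_sqn_le1 oe.1.
  by rewrite e0// sqn0.
apply: (@le_trans _ _ (\sum_(0 <= i < n + m) (i < m)%N%:R)).
  by rewrite [leRHS](big_cat_nat (n := n)) ?leq_addr//= lerDl sumr_ge0.
rewrite (big_cat_nat (n := m)) ?leq_addl//= [X in _ + X]big_nat_cond.
rewrite [X in _ + X]big1 ?addr0.
  rewrite big_nat_cond (eq_bigr (fun=> 1)); last by move=> i /andP[/andP[_ ->]].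
  by rewrite -big_nat_cond sumr_const_nat subn0.
by move=> i /andP[/andP[mi _] _]; rewrite ltnNge mi.
Qed.

Lemma ons_count (u : nat -> H) n : ons u -> (forall k, (k < n)%N -> u k != 0) ->
  \sum_(0 <= k < n) sqn (u k) = n%:R.
Proof.
move=> ou un; rewrite big_nat_cond (eq_bigr (fun=> 1)).
  by rewrite -big_nat_cond sumr_const_nat subn0.
by move=> k /andP[/andP[_ kn] _]; rewrite ons_sqn// un.
Qed.

End bases.

Lemma complex_dim (R : realType) : hilbert_dim R[i] (Some 1%N).
Proof.
exists [set 1 : R[i]]; last first.
  apply/card_set_bijP; exists (fun=> 0%N); split=> //.
    by move=> x y /set_mem -> /set_mem ->.
  by move=> [|n]//= _; exists 1.
split; first split.
- by move=> b ->; rewrite hdotxx /sqn /rdot hdot_norm normr1 expr1n.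
- by move=> b c -> ->.
- move=> O [x Ox] _; exists x; split => //.
  exists [set 1], (fun=> x); split; [exact: finite_set1|by []|].
  by rewrite fsbig_set1 -[LHS]mulr1.
Qed.

(** * Operators with a given positive semidefinite matrix *)

Section matrix_operator.
Context {R : realType} {H : hilbertType R}.
Variables (e : nat -> H) (oe : onb e).
Implicit Types h : nat -> nat -> R[i].

(** The truncation to the first [n] basis vectors, where [h i j] stands for [hdot (f (e i)) (e j)],
    the transpose of the usual matrix. *)
Definition mxop h n : H -> H :=
  \sum_(0 <= i < n) \sum_(0 <= j < n) h i j *: tensor (e j) (e i).

Lemma mxopE h n x : mxop h n x =
  \sum_(0 <= i < n) \sum_(0 <= j < n) (h i j * hdot x (e i)) *: e j.
Proof.
rewrite /mxop fct_sumE; apply: eq_bigr => i _; rewrite fct_sumE.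
by apply: eq_bigr => j _; rewrite -scalerA.
Qed.

Lemma hs_mxop h n : hs e (mxop h n).
Proof.
rewrite /mxop.
rewrite (eq_bigr (fun i => 1 *: \sum_(0 <= j < n) h i j *: tensor (e j) (e i))).
  by apply: hs_sum => i _; apply: hs_sum => j _; exact: hs_tensor.
by move=> i _; rewrite scale1r.
Qed.

Lemma mxop_hdot h n x y : hdot (mxop h n x) y =
  \sum_(0 <= i < n) \sum_(0 <= j < n) h i j * hdot x (e i) * hdot (e j) y.
Proof.
rewrite mxopE hdot_suml; apply: eq_bigr => i _.
by rewrite hdot_suml; apply: eq_bigr => j _; rewrite hdotZl.
Qed.

Lemma sqn_i (x : H) : sqn ('i *: x) = sqn x.
Proof. by rewrite sqnZ csqi mul1r. Qed.

Lemma nuclear_le_mxop h n : nuclear_le (mxop h n)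
  (\sum_(0 <= i < n) \sum_(0 <= j < n)
    (`|complex.Re (h i j)| + `|complex.Im (h i j)|)).
Proof.
have -> : mxop h n = fun x => \sum_(0 <= i < n) \sum_(0 <= j < n)
    ((complex.Re (h i j))%:C *: tensor (e j) (e i) x +
     (complex.Im (h i j))%:C *: tensor ('i *: e j) (e i) x).
  apply/funext => x; rewrite mxopE; apply: eq_bigr => i _; apply: eq_bigr => j _.
  rewrite /tensor !scalerA -scalerDl; congr (_ *: _).
  case: (h i j) (hdot x (e i)) => [a b] [u v] /=.
  by apply/eqP; rewrite eq_complex /=; apply/andP; split; apply/eqP; ring.
apply: nuclear_le_sum => i; apply: nuclear_le_sum => j.
apply: nuclear_leD; apply: nuclear_le_tensor; rewrite ?sqn_i;
  exact: ons_sqn_le1 oe.1.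
Qed.

Lemma proj_compression (f : H -> H) n x : linear f ->
  eproj e n (f (eproj e n x)) = mxop (fun i j => hdot (f (e i)) (e j)) n x.
Proof.
move=> lf; rewrite mxopE {2}/eproj (lin_sum lf) (lin_sum (is_adjoint_linear (eproj_adjoint e n))).
apply: eq_bigr => i _.
rewrite (linZ lf) (linZ (is_adjoint_linear (eproj_adjoint e n))) /eproj scaler_sumr.
by apply: eq_bigr => j _; rewrite scalerA mulrC.
Qed.

Variables (h : nat -> nat -> R[i]) (t : R).
Hypotheses (h_herm : forall i j, h j i = (h i j)^*)
  (h_psd : forall n (c : nat -> R[i]), 0 <= \sum_(0 <= i < n) \sum_(0 <= j < n)
    complex.Re (h i j * c i * (c j)^*))
  (h_tr : forall n, \sum_(0 <= i < n) complex.Re (h i i) <= t)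
  (h0 : forall i j, e j = 0 -> h i j = 0).

Lemma mxop_positive n : positive_op (mxop h n).
Proof.
have [bm _] := hs_mxop h n; have [M M0 TM] := bounded_op_ex bm.
apply: (@positive_opP _ _ _ M) => //; first exact: bm.1.
- move=> x y; rewrite (rdotC x) /rdot !mxop_hdot !raddf_sum/=.
  under eq_bigr do rewrite raddf_sum/=.
  under [RHS]eq_bigr do rewrite raddf_sum/=.
  rewrite [RHS]exchange_big/=; apply: eq_bigr => i _; apply: eq_bigr => j _.
  rewrite (h_herm i j) (hdotC (e j) y) (hdotC (e i) x).
  case: (h i j) (hdot x (e i)) (hdot y (e j)) => [a b] [u v] [p q] /=; ring.
- move=> x; rewrite /rdot mxop_hdot raddf_sum/=.
  under eq_bigr do rewrite raddf_sum/=.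
  apply: le_trans (h_psd n (fun i => hdot x (e i))) _.
  by apply: ler_sum => i _; apply: ler_sum => j _; rewrite (hdotC (e j)).
Qed.

Lemma h0l i j : e i = 0 -> h i j = 0.
Proof. by move=> /h0 hi; rewrite h_herm hi rmorph0. Qed.

Lemma mxop_e n i j : (i < n)%N -> (j < n)%N -> hdot (mxop h n (e i)) (e j) = h i j.
Proof.
move=> iN jN; rewrite mxop_hdot (bigD1_seq i) ?iota_uniq ?mem_index_iota//=.
rewrite [X in _ + X]big1 ?addr0; last first.
  move=> k ki; rewrite big1// => l _.
  by rewrite oe.1 eq_sym (negbTE ki)/= mulr0 mul0r.
rewrite (bigD1_seq j) ?iota_uniq ?mem_index_iota//= [X in _ + X]big1 ?addr0.
  rewrite !oe.1 !eqxx /=; have [/h0l ->|_] := eqVneq (e i) 0; first by rewrite !mul0r.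
  by have [/h0 ->|_] := eqVneq (e j) 0; rewrite ?mul0r// !mulr1.
by move=> k kj; rewrite !oe.1 (negbTE kj)/= mulr0.
Qed.

Lemma mxop_trace n : finite_trace e (mxop h n) t.
Proof.
move=> J; apply: le_trans (h_tr n).
have hj j : rdot (mxop h n (e j)) (e j) = if (j < n)%N then complex.Re (h j j) else 0.
  case: ifPn => jn; first by rewrite /rdot mxop_e.
  rewrite /rdot mxop_hdot big_nat_cond big1// => i /andP[/andP[_ iN] _].
  rewrite big1// => k _; rewrite oe.1 (_ : j == i = false) ?mulr0 ?mul0r//.
  by apply: contraNF jn => /eqP ->.
have hp j : 0 <= rdot (mxop h n (e j)) (e j) by exact/positive_ge0/mxop_positive.
apply: (@le_trans _ _ (\sum_(0 <= j < n + J) rdot (mxop h n (e j)) (e j))).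
  by rewrite [leRHS](big_cat_nat (n := J)) ?leq_addl//= lerDl sumr_ge0.
rewrite (big_cat_nat (n := n)) ?leq_addr//= [X in _ + X]big_nat_cond.
rewrite [X in _ + X]big1 ?addr0.
  rewrite [leLHS]big_nat_cond [leRHS]big_nat_cond.
  by apply: ler_sum => j /andP[/andP[_ jn] _]; rewrite hj jn.
by move=> j /andP[/andP[nj _] _]; rewrite hj ltnNge nj.
Qed.

Lemma mxop_bounded n : sqn_bounded (mxop h n) (t ^+ 2).
Proof.
apply: rdot_bounded_bounded; first exact: mxop_positive.
  by have := h_tr 0; rewrite big_geq.
exact: trace_rdot_bounded (mxop_positive n) (@mxop_trace n).
Qed.

(** The truncations are bounded uniformly in [n], because a positive operator is bounded by its
    trace; hence each row of [h] is square summable. *)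
Lemma mxop_cvg_e i : exists z : H, mxop h n (e i) @[n --> \oo] --> z.
Proof.
have E n : (i < n)%N -> mxop h n (e i) = \sum_(0 <= j < n) h i j *: e j.
  move=> iN; rewrite mxopE (bigD1_seq i) ?iota_uniq ?mem_index_iota//=.
  rewrite [X in _ + X]big1 ?addr0.
    apply: eq_bigr => j _; rewrite oe.1 eqxx/=.
    by have [/h0l ->|_] := eqVneq (e i) 0; rewrite ?mul0r// mulr1.
  move=> k ki; rewrite big1// => l _.
  by rewrite oe.1 eq_sym (negbTE ki)/= mulr0 scale0r.
have [n|z hz] := @ons_series_cvg _ _ e (h i) (t ^+ 2) oe.1.
  apply: (@le_trans _ _ (\sum_(0 <= j < i.+1 + n) csq (h i j))).
    by rewrite [leRHS](big_cat_nat (n := n)) ?leq_addl//= lerDl sumr_ge0// => *; exact: csq_ge0.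
  apply: le_trans (le_trans (mxop_bounded (i.+1 + n) (e i)) _); last first.
    by rewrite ler_piMr ?sqr_ge0// (ons_sqn_le1 _ oe.1).
  rewrite E ?leq_addr// sqn_comb ?iota_uniq//; last by move=> *; exact: oe.1.
  apply: ler_sum => j _; have [/(h0 i) ->|_] := eqVneq (e j) 0.
    by rewrite csqR expr0n mul0r.
  by rewrite mulr1.
exists z; apply: cvg_trans hz; apply: near_eq_cvg.
by exists i.+1 => // n /= iN; rewrite E.
Qed.

Lemma mxop_cvg x : exists z : H, mxop h n x @[n --> \oo] --> z.
Proof.
have lm n : linear (mxop h n) by exact: positive_linear (mxop_positive n).
have cp k : exists z : H, mxop h n (eproj e k x) @[n --> \oo] --> z.
  rewrite /eproj; elim: k => [|k [z hz]].
    exists 0; under eq_fun do rewrite big_geq// lin0//; exact: cvg_cst.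
  have [y hy] := mxop_cvg_e k; exists (z + hdot x (e k) *: y).
  under eq_fun do rewrite big_nat_recr//= linD// linZ//.
  by apply: cvgD => //; apply: cvgZr.
apply: sqn_cauchy_eps => eps eps0.
(* Chosen so that [4 * t ^+ 2 * sqn y] is at most [eps / 4]; the added 1 keeps [K] positive when
   [t = 0]. The other part of the difference is also at most [eps / 4], and [sqnD_le] doubles the
   sum of the two to [eps / 2 + eps / 2]. *)
pose K := 8 * t ^+ 2 + 1.
have K0 : 0 < K by rewrite ltr_wpDl// mulr_ge0// sqr_ge0.
have /csqnP/eps_cvg0 := @onb_expansion _ _ e x oe.
move=> /(_ (eps / (2 * K))) [|k hk]; first by rewrite divr_gt0// mulr_gt0.
have {hk} : sqn (x - eproj e k x) <= eps / (2 * K) by rewrite sqnBC; exact: hk.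
set y := x - _ => hy.
have [z /csqnP/eps_cvg0] := cp k.
move=> /(_ (eps / 16)) [|N hN]; first by rewrite divr_gt0.
exists N => m n Nm Nn.
have -> : mxop h m x - mxop h n x = (mxop h m y - mxop h n y) +
   (mxop h m (eproj e k x) - z - (mxop h n (eproj e k x) - z)).
  rewrite /y !(linB (lm _)).
  move: (mxop h m x) (mxop h n x) (mxop h m (eproj e k x)) (mxop h n (eproj e k x)) => a b p q.
  rewrite [p - z - _](_ : _ = p - q); last by rewrite opprB subrKA.
  by rewrite opprD [a - p + _]addrACA -opprD subrK.
rewrite (le_trans (sqnD_le _ _))//.
have h1 : sqn (mxop h m y - mxop h n y) <= 4 * t ^+ 2 * sqn y.
  rewrite (le_trans (sqnB_le _ _))//; have := mxop_bounded m y; have := mxop_bounded n y; lra.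
have h3 := sqnB_le (mxop h m (eproj e k x) - z) (mxop h n (eproj e k x) - z).
have := hN m Nm; have := hN n Nn.
have : 4 * t ^+ 2 * sqn y <= eps / 4.
  have -> : eps / 4 = (K / 2) * (eps / (2 * K)) by field; rewrite gt_eqF.
  apply: ler_pM; rewrite ?sqn_ge0//.
    by rewrite mulr_ge0// sqr_ge0.
  by rewrite /K; lra.
lra.
Qed.

Lemma psd_operator : exists2 f : H -> H, positive_op f &
  forall i j, hdot (f (e i)) (e j) = h i j.
Proof.
have [f hf] := choice mxop_cvg.
have pm := mxop_positive; have lm n := positive_linear (pm n).
exists f.
  apply: (@positive_opP _ _ _ (t ^+ 2)).
  - move=> c x y; apply: cvg_H_uniq (hf _) _.
    apply: (@eq_cvg_seq _ (fun n => c *: mxop h n x + mxop h n y)).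
      by move=> n; rewrite lm.
    by apply: cvgD => //; apply: cvgZr; exact: hf.
  - move=> x y; apply: cvg_R_uniq (cvg_rdotl (y := y) (hf x)) _.
    apply: eq_cvg_seq (cvg_rdotr (y := x) (hf y)) => n.
    by rewrite (positive_rdotC _ _ (pm n)).
  - move=> x; apply: le_lim_seq (cvg_cst 0) (cvg_rdotl (y := x) (hf x)) _ => n.
    exact: positive_ge0.
  - exact: sqr_ge0.
  - move=> x; apply: le_lim_seq (cvg_sqn (hf x)) (cvg_cst _) _ => n.
    exact: mxop_bounded.
move=> i j.
have ri x : rdot (f (e i)) (x *: e j) = complex.Re (x^* * h i j).
  apply: cvg_R_uniq (cvg_rdotl (y := x *: e j) (hf (e i))) _.
  apply: cvg_near_cst; exists (maxn i j).+1 => // n /=.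
  rewrite gtn_max => /andP[iN jN].
  by rewrite /rdot hdotZr mxop_e// eqxx.
rewrite hdotE -[X in rdot _ X +i* _]scale1r !ri.
by case: (h i j) => a b; apply/eqP; rewrite eq_complex /=; apply/andP; split; apply/eqP; ring.
Qed.

End matrix_operator.

(** * The operator-valued density *)

Section real_integrals.
Context {R : realType} {d : measure_display} {L : measurableType d}.
Variable mu : {measure set L -> \bar R}.
Implicit Types (A : set L) (g : L -> R) (r : R).

(** Integrability together with a real value, which keeps linear computations free of side
    conditions on infinite values. *)
Definition is_int A g r := mu.-integrable A (EFin \o g) /\
  (\int[mu]_(l in A) (g l)%:E = r%:E)%E.

Lemma is_intD A g1 g2 r1 r2 : measurable A -> is_int A g1 r1 -> is_int A g2 r2 ->
  is_int A (fun l => g1 l + g2 l) (r1 + r2).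
Proof.
move=> mA [i1 e1] [i2 e2]; split; first by apply: eq_integrable (integrableD mA i1 i2).
by under eq_integral do rewrite EFinD; rewrite integralD// e1 e2.
Qed.

Lemma is_intZ A g c r : measurable A -> is_int A g r ->
  is_int A (fun l => c * g l) (c * r).
Proof.
move=> mA [i e]; split; first by apply: eq_integrable (integrableZl mA c i).
by under eq_integral do rewrite EFinM; rewrite integralZl// e.
Qed.

Lemma is_int_cst0 A : measurable A -> is_int A (fun=> 0) 0.
Proof. by move=> mA; split; [exact: integrable0|rewrite integral0]. Qed.

Lemma is_int_sum A n (g : nat -> L -> R) (r : nat -> R) : measurable A ->
  (forall k, is_int A (g k) (r k)) ->
  is_int A (fun l => \sum_(0 <= k < n) g k l) (\sum_(0 <= k < n) r k).
Proof.
move=> mA h; elim: n => [|n ih].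
  rewrite big_geq//; under eq_fun do rewrite big_geq//.
  exact: is_int_cst0.
rewrite big_nat_recr//=; under eq_fun do rewrite big_nat_recr//=.
exact: is_intD.
Qed.

Lemma is_int_uniq A g r1 r2 : is_int A g r1 -> is_int A g r2 -> r1 = r2.
Proof. by move=> [_ e1] [_ e2]; apply/EFin_inj; rewrite -e1 -e2. Qed.

Lemma is_int_ae A g1 g2 r : measurable A -> measurable_fun A g2 ->
  {ae mu, forall l, A l -> g1 l = g2 l} -> is_int A g1 r -> is_int A g2 r.
Proof.
move=> mA m2 ae12 [i1 e1].
have m1 := measurable_int _ i1.
have /measurable_EFinP me2 := m2.
have ae' : ae_eq mu A (EFin \o g1) (EFin \o g2).
  by apply: filterS ae12 => l h /h /= ->.
have e2 : (\int[mu]_(l in A) (g2 l)%:E = r%:E)%E.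
  by rewrite -e1; apply/esym; apply: ae_eq_integral.
split => //; apply/integrableP; split => //.
have /integrableP[_] := i1; 
rewrite (_ : \int[mu]_(x in A) `|(EFin \o g1) x| =
  \int[mu]_(x in A) `|(EFin \o g2) x|)%E//.
apply: ae_eq_integral => //; first exact: measurableT_comp.
  exact: measurableT_comp.
by apply: filterS ae' => l h /h /= [->].
Qed.

Lemma is_int_dct A (gn : nat -> L -> R) g G (rn : nat -> R) r :
  measurable A -> (forall n, is_int A (gn n) (rn n)) ->
  (forall l, A l -> gn n l @[n --> \oo] --> g l) ->
  (forall n l, A l -> `|gn n l| <= G l) -> mu.-integrable A (EFin \o G) ->
  rn n @[n --> \oo] --> r -> is_int A g r.
Proof.
move=> mA gnr cg gG iG cr.
have mgn n : measurable_fun A (gn n).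
  by apply/measurable_EFinP; have [/measurable_int] := gnr n.
have mg : measurable_fun A g by exact: measurable_fun_cvg mgn cg.
have := @dominated_convergence _ _ _ mu A mA (fun n l => (gn n l)%:E) (EFin \o g) (EFin \o G).
case=> //.
- by move=> n; have [/measurable_int] := gnr n.
- exact/measurable_EFinP.
- by apply: aeW => l Al; apply/cvg_EFin; [exact: nearW|exact: cg].
- by apply: aeW => l n Al; rewrite lee_fin gG.
move=> ig _ h; split => //.
have h2 : (fun n => (rn n)%:E) @ \oo --> (\int[mu]_(l in A) (g l)%:E)%E.
  by under eq_fun do rewrite -(gnr _).2; exact: h.
have h3 : (fun n => (rn n)%:E) @ \oo --> r%:E.
  by apply/cvg_EFin; [exact: nearW|exact: cr].
exact: (cvg_unique (@ereal_hausdorff R) h2 h3).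
Qed.

Lemma is_int_ae_eq g1 g2 (r : set L -> R) : measurable_fun setT g2 ->
  (forall A, measurable A -> is_int A g1 (r A)) ->
  (forall A, measurable A -> is_int A g2 (r A)) ->
  {ae mu, forall l, g1 l = g2 l}.
Proof.
move=> m2 h1 h2.
have h : ae_eq mu setT (EFin \o g1) (EFin \o g2).
  apply: integral_ae_eq => //; first exact: (h1 _ measurableT).1.
    exact/measurable_EFinP.
  by move=> E _ mE; rewrite (h1 _ mE).2 (h2 _ mE).2.
by apply: filterS h => l /(_ Logic.I)[].
Qed.

(** Over any measurable subset of [g < 0] the integral is at once nonpositive and nonnegative, so
    [g] is almost everywhere 0 there. *)
Lemma is_int_ae_ge0 g (r : set L -> R) : measurable_fun setT g ->
  (forall A, measurable A -> is_int A g (r A)) ->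
  (forall A, measurable A -> 0 <= r A) -> {ae mu, forall l, 0 <= g l}.
Proof.
move=> mg h r0; pose D := [set l | g l < 0].
have mD : measurable D by rewrite -[D]setTI; exact: measurable_fun_ltr.
have h0 E : E `<=` D -> measurable E -> (\int[mu]_(l in E) (g l)%:E = 0)%E.
  move=> ED mE; apply/eqP; rewrite eq_le; apply/andP; split; last first.
    by rewrite (h E mE).2 lee_fin r0.
  have [_ e1] := is_intZ (-1) mE (h E mE).
  have : (0 <= \int[mu]_(l in E) (-1 * g l)%:E)%E.
    by apply: integral_ge0 => l /ED /ltW gl; rewrite lee_fin mulN1r oppr_ge0.
  by rewrite e1 (h E mE).2 !lee_fin mulN1r oppr_ge0.
have e0 : ae_eq mu D (EFin \o g) (cst 0%E).
  apply: integral_ae_eq => //; first exact: (h _ mD).1.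
  by move=> E ED mE; rewrite h0// integral0.
apply: filterS e0 => l hl; rewrite leNgt; apply/negP => gl.
by have [/eqP] := hl gl; rewrite lt_eqF.
Qed.

End real_integrals.

Section povm_measure.
Context {R : realType} {H : hilbertType R} (e : nat -> H).
Hypotheses (hH : hilbert_basis (hbasis H)) (oe : onb e).
Context {d : measure_display} {L : measurableType d}.
Variables (nu : set L -> H -> H) (nu_povm : tc_povm nu).
Implicit Types (A : set L) (x y : H).

Lemma povm_positive A : measurable A -> positive_op (nu A).
Proof. by move=> /nu_povm.1[]. Qed.

Lemma povm_trace A : measurable A -> finite_trace e (nu A) (fine (povm_variation nu A)).
Proof. by move=> /nu_povm.1[pA tA]; exact: positive_finite_trace. Qed.

Lemma povm_variationE A : measurable A ->
  povm_variation nu A = (\sum_(0 <= j <oo) (rdot (nu A (e j)) (e j))%:E)%E.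
Proof.
move=> mA; apply: (trace_norm_positive hH oe) (povm_positive mA) (povm_trace mA).
Qed.

Lemma povm_variation_fin A : measurable A -> povm_variation nu A \is a fin_num.
Proof.
move=> /nu_povm.1[pA tA]; rewrite ge0_fin_numE//; exact: trace_norm_ge0 oe _.
Qed.

Lemma povm_rdot_cvg (F : nat -> set L) x y : (forall n, measurable (F n)) ->
  trivIset setT F ->
  \sum_(0 <= k < n) rdot (nu (F k) x) y @[n --> \oo] -->
    rdot (nu (\bigcup_n F n) x) y.
Proof.
move=> mF tF; have h := nu_povm.2 F mF tF x y.
have E (z : R[i]) : rdot z 1 = complex.Re z.
  by rewrite /rdot /hdot/= /cdot rmorph1 mulr1.
have := @cvg_rdotl _ _ _ _ (1 : R[i]) h; rewrite E; apply: eq_cvg_seq => n.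
by rewrite E raddf_sum.
Qed.

(** Countable additivity applied to the constant sequence of empty sets: the multiples of [c]
    converge, so [c = 0]. *)
Lemma povm0 : nu set0 = 0.
Proof.
apply/funext => x; apply: rdot_injl => y; rewrite rdot0l.
have := @povm_rdot_cvg (fun=> set0) x y (fun=> measurable0) _.
rewrite bigcup0//; set c := rdot _ _ => h.
have {}h : \sum_(0 <= k < n) c @[n --> \oo] --> c.
  by apply: h => i j _ _ [z []].
have /cauchy_real : cvgn (fun n => \sum_(0 <= k < n) c) by apply/cvg_ex; exists c.
move=> ch; have [//|c0] := eqVneq c 0.
have c1 : 0 < `|c| / 2 by apply: divr_gt0; rewrite ?normr_gt0.
have [N hN] := ch _ c1; have := hN N.+1 N (leqnSn N) (leqnn N).
rewrite big_nat_recr//= addrAC subrr add0r ler_pdivlMr// -[leRHS]mulr1.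
by rewrite ler_pM2l ?normr_gt0// lern1.
Qed.

(** On positive operators the trace norm is the trace, a series of the countably additive set
    functions [rdot (nu A (e j)) (e j)]; additivity follows by exchanging two nonnegative sums. *)
Lemma povm_variation_measure : exists m : {finite_measure set L -> \bar R},
  povm_variation nu = m.
Proof.
have t0 : povm_variation nu set0 = 0%E.
  by rewrite povm_variationE// eseries0// => j _ _; rewrite povm0 rdot0l.
have tge0 A : (0 <= povm_variation nu A)%E by exact: trace_norm_ge0 oe _.
have tsig : semi_sigma_additive (povm_variation nu).
  move=> F mF tF mU; rewrite povm_variationE//.
  have pos A x : measurable A -> (0 <= (rdot (nu A x) x)%:E)%E.
    by move=> mA; rewrite lee_fin positive_ge0//; exact: povm_positive.
  have -> : (\sum_(0 <= j <oo) (rdot (nu (\bigcup_n F n) (e j)) (e j))%:E =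
      \sum_(0 <= n <oo) povm_variation nu (F n))%E.
    under [RHS]eq_eseriesr do rewrite povm_variationE//.
    rewrite nneseries_interchange; last by move=> i j; exact: pos.
    apply: eq_eseriesr => j _; apply/esym/cvg_lim => //.
    under eq_fun do rewrite sumEFin.
    by apply/cvg_EFin; [exact: nearW|exact: povm_rdot_cvg].
  by apply: is_cvg_nneseries => n _ _.
pose M := isMeasure.Build _ _ _ (povm_variation nu) t0 tge0 tsig.
pose m0 : {measure set L -> \bar R} := HB.pack (povm_variation nu) M.
pose F := Measure_isFinite.Build _ _ _ m0 povm_variation_fin.
pose m : {finite_measure set L -> \bar R} := HB.pack (Measure.sort m0) F.
by exists m.
Qed.

End povm_measure.

(** * Hermitian forms tested on Gaussian integers *)

Section gaussian_integers.
Context {R : realType}.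
Implicit Types (a b : nat -> nat -> R) (p q : nat -> R).

(* The value at [c = p + 'i q] of the Hermitian form with matrix [a + 'i b]. *)
Definition qform a b n p q := \sum_(0 <= i < n) \sum_(0 <= j < n)
  (a i j * (p i * p j + q i * q j) - b i j * (q i * p j - p i * q j)).

Lemma qformE a b n (c : nat -> R[i]) :
  \sum_(0 <= i < n) \sum_(0 <= j < n)
    complex.Re ((a i j +i* b i j) * c i * (c j)^*) =
  qform a b n (fun i => complex.Re (c i)) (fun i => complex.Im (c i)).
Proof.
apply: eq_bigr => i _; apply: eq_bigr => j _.
case: (c i) (c j) => [u v] [s t] /=; ring.
Qed.

Lemma qformZ a b n r p q :
  qform a b n (fun i => r * p i) (fun i => r * q i) = r ^+ 2 * qform a b n p q.
Proof.
rewrite /qform mulr_sumr; apply: eq_bigr => i _; rewrite mulr_sumr.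
by apply: eq_bigr => j _; ring.
Qed.

Lemma floor_cvg (x : R) :
  (m.+1%:R^-1 * (Num.floor (m.+1%:R * x))%:~R : R) @[m --> \oo] --> x.
Proof.
apply/subr_cvg0/cvgr0Pnorm_le => eps eps0.
have /cvgr0Pnorm_le /(_ _ eps0) := @cvg_harmonic R; apply: filterS => m.
rewrite /harmonic /= ger0_norm ?invr_ge0// => h; apply: le_trans h.
have m0 : 0 < m.+1%:R :> R by [].
set y := m.+1%:R * x; have -> : x = m.+1%:R^-1 * y.
  by rewrite /y mulrA mulVf ?mul1r// gt_eqF.
rewrite -mulrBr normrM ger0_norm ?invr_ge0// -[leRHS]mulr1 ler_pM2l ?invr_gt0//.
have /andP[h1 h2] := floor_itv y.
rewrite ler_norml; rewrite intrD in h2; apply/andP; split; lra.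
Qed.

(** The type [seq (int * int)] is countable, so almost everywhere statements can be intersected over
    it. Integer vectors suffice since the form is homogeneous: a real vector is the limit of
    [floor (m.+1 * p) / m.+1]. *)
Definition gauss (s : seq (int * int)) (i : nat) : R * R :=
  ((nth 0 s i).1%:~R, (nth 0 s i).2%:~R).

Lemma qform_gauss_ge0 a b n :
  (forall s, 0 <= qform a b n (fun i => (gauss s i).1) (fun i => (gauss s i).2)) ->
  forall p q, 0 <= qform a b n p q.
Proof.
move=> h p q.
pose s m := mkseq (fun i => (Num.floor (m.+1%:R * p i), Num.floor (m.+1%:R * q i))) n.
pose P m i : R := m.+1%:R^-1 * (Num.floor (m.+1%:R * p i))%:~R.
pose Q m i : R := m.+1%:R^-1 * (Num.floor (m.+1%:R * q i))%:~R.
have cP i : P m i @[m --> \oo] --> p i by exact: floor_cvg.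
have cQ i : Q m i @[m --> \oo] --> q i by exact: floor_cvg.
have cf : qform a b n (P m) (Q m) @[m --> \oo] --> qform a b n p q.
  apply: cvg_sum_seq => i; apply: cvg_sum_seq => j.
  apply: cvgB; (apply: cvgM; first exact: cvg_cst).
    by apply: cvgD; exact: cvgM.
  by apply: cvgB; exact: cvgM.
apply: (le_lim_seq (cvg_cst (0 : R)) cf) => m.
have -> : qform a b n (P m) (Q m) = m.+1%:R^-1 ^+ 2 *
    qform a b n (fun i => (gauss (s m) i).1) (fun i => (gauss (s m) i).2).
  rewrite -qformZ /qform [LHS]big_nat_cond [RHS]big_nat_cond.
  apply: eq_bigr => i /andP[/andP[_ iN] _].
  rewrite [LHS]big_nat_cond [RHS]big_nat_cond.
  apply: eq_bigr => j /andP[/andP[_ jN] _].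
  by rewrite /gauss /s !nth_mkseq.
by rewrite mulr_ge0 ?sqr_ge0.
Qed.

End gaussian_integers.

Section povm_density.
Context {R : realType} {H : hilbertType R} (e : nat -> H).
Hypotheses (hH : hilbert_basis (hbasis H)) (oe : onb e).
Context {d : measure_display} {L : measurableType d}.
Variables (nu : set L -> H -> H) (nu_povm : tc_povm nu).
Variables (m : {finite_measure set L -> \bar R}) (nu_m : povm_variation nu = m).
Implicit Types (A : set L) (x y : H).

Lemma povm_null A : measurable A -> m A = 0%E -> nu A = 0.
Proof.
move=> mA mA0; apply/funext => x; apply/eqP; rewrite -sqn_eq0 eq_le sqn_ge0 andbT.
have tA : trace_norm (nu A) = 0%E by rewrite -/(povm_variation nu A) nu_m.
have := @trace_norm_sqn _ _ e hH oe (nu A) x; rewrite tA ltry => /(_ isT) /=.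
by rewrite expr0n mul0r.
Qed.

Lemma povm_scalar_density x y : exists2 g : L -> R, measurable_fun setT g &
  forall A, measurable A -> is_int m A g (rdot (nu A x) y).
Proof.
pose k A : \bar R := (rdot (nu A x) y)%:E.
have k0 : k set0 = 0%E by rewrite /k (povm0 nu_povm) rdot0l.
have kf A : measurable A -> k A \is a fin_num by [].
have ks : semi_sigma_additive k.
  move=> F mF tF mU; rewrite /k; under eq_fun do rewrite sumEFin.
  by apply/cvg_EFin; [exact: nearW|exact: povm_rdot_cvg].
pose K := isCharge.Build _ _ _ k k0 kf ks.
pose kc : {charge set L -> \bar R} := HB.pack k K.
have dom : kc `<< m.
  move=> A nA B mB BA; have mB0 : m B = 0%E by exact: nA.
  by rewrite /kc/= /k (povm_null mB mB0) rdot0l.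
pose f := Radon_Nikodym kc m.
have fE l : (fine (f l))%:E = f l by rewrite fineK// Radon_Nikodym_fin_num.
have iF : m.-integrable setT (EFin \o (fun l => fine (f l))).
  by apply: eq_integrable (Radon_Nikodym_integrable dom) => // l _ /=; rewrite fE.
exists (fun l => fine (f l)); first exact/measurable_EFinP/(measurable_int _ iF).
move=> A mA; split; first exact: integrableS iF.
rewrite -[RHS]/(kc A) (Radon_Nikodym_integral dom mA).
by apply: eq_integral => l _; rewrite fE.
Qed.

End povm_density.

Section real_trace.
Context {R : realType} {H : hilbertType R} (e : nat -> H).
Hypotheses (hH : hilbert_basis (hbasis H)) (oe : onb e).
Implicit Types (T : H -> H) (x y : H).

Definition rtr T : R := limn (fun n => \sum_(0 <= j < n) rdot (T (e j)) (e j)).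

Section positive_trace.
Variables (T : H -> H) (M : R) (pT : positive_op T) (TM : finite_trace e T M).

Lemma rtr_cvg : \sum_(0 <= j < n) rdot (T (e j)) (e j) @[n --> \oo] --> rtr T.
Proof. by apply: bounded_series_cvg TM => k; exact: positive_ge0. Qed.

Lemma rtr_finite_trace : finite_trace e T (rtr T).
Proof.
move=> n; apply: nondecreasing_cvgn_le; last by apply/cvg_ex; exists (rtr T); exact: rtr_cvg.
by apply: nondecreasing_series => k _ _; exact: positive_ge0.
Qed.

Lemma rtr_ge0 : 0 <= rtr T.
Proof. exact: finite_trace_ge0 rtr_finite_trace. Qed.

Lemma rtr_series : (\sum_(0 <= j <oo) (rdot (T (e j)) (e j))%:E = (rtr T)%:E)%E.
Proof.
apply/cvg_lim => //; under eq_fun do rewrite sumEFin.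
by apply/cvg_EFin; [exact: nearW|exact: rtr_cvg].
Qed.

Lemma rtr_rdot_le x y : `|rdot (T x) y| <= rtr T * ((sqn x + sqn y) / 2).
Proof.
have Tt := trace_rdot_bounded oe pT rtr_finite_trace.
have [Q pQ QT] := positive_sqrt pT.
have E u : sqn (Q u) = rdot (T u) u by rewrite -QT /= (positive_rdotC _ _ pQ).
rewrite -{1}QT /= (positive_rdotC _ _ pQ) (le_trans (rdot_norm_le _ _))// !E.
by rewrite mulrA ler_pM2r ?invr_gt0// mulrDr lerD.
Qed.

End positive_trace.

Lemma cvg_rdot (u v : nat -> H) x y : u n @[n --> \oo] --> x ->
  v n @[n --> \oo] --> y -> rdot (u n) (v n) @[n --> \oo] --> rdot x y.
Proof.
move=> ux vy.
have E (a b : H) : rdot a b = (sqn (a + b) - sqn a - sqn b) / 2.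
  by rewrite sqnD; field.
rewrite E; apply: eq_cvg_seq (fun n => esym (E (u n) (v n))) _.
apply: cvgM; last exact: cvg_cst.
by do ?apply: cvgB; apply: cvg_sqn => //; exact: cvgD.
Qed.

Lemma rdot_eproj T n x y : linear T ->
  rdot (T (eproj e n x)) (eproj e n y) =
  \sum_(0 <= i < n) \sum_(0 <= j < n)
    (complex.Re (hdot x (e i) * (hdot y (e j))^*) * rdot (T (e i)) (e j) +
     - complex.Im (hdot x (e i) * (hdot y (e j))^*) * rdot (T (e i)) ('i *: e j)).
Proof.
move=> lT; rewrite /eproj (lin_sum lT) rdot_suml; apply: eq_bigr => i _.
rewrite rdot_sumr; apply: eq_bigr => j _; rewrite (linZ lT).
rewrite {1}/rdot hdotZl hdotZr (hdotE (T (e i))).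
case: (hdot x (e i)) (hdot y (e j)) => [a b] [u v] /=; ring.
Qed.

Lemma cvg_rdot_eproj T x y : bounded_op T ->
  rdot (T (eproj e n x)) (eproj e n y) @[n --> \oo] --> rdot (T x) y.
Proof.
move=> bT; apply: cvg_rdot; last exact: onb_expansion.
by apply: bounded_op_cvg => //; exact: onb_expansion.
Qed.

Lemma sqn_eproj_le n x : sqn (eproj e n x) <= sqn x.
Proof.
exact: le_trans (ons_sqn_comb_le _ _ _ oe.1) (ons_bessel _ _ oe.1).
Qed.

End real_trace.

Section trace_class_families.
Context {R : realType} {H : hilbertType R} (e : nat -> H).
Hypotheses (hH : hilbert_basis (hbasis H)) (oe : onb e).
Context {d : measure_display} {L : measurableType d}.
Implicit Types (f : L -> H -> H) (x y : H).

(** The conditions hold at every point, not almost everywhere, so the spectral construction can be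
    carried out for each [l]. *)
Definition tc_family f := [/\ forall l, positive_op (f l),
  forall l, exists M, finite_trace e (f l) M &
  forall x y, measurable_fun setT (fun l => rdot (f l x) y)].

Lemma measurable_sum_nat n (g : nat -> L -> R) :
  (forall k, measurable_fun setT (g k)) ->
  measurable_fun setT (fun l => \sum_(0 <= k < n) g k l).
Proof. by move=> mg; apply: measurable_sum => k. Qed.

Lemma measurable_lim (g : nat -> L -> R) (h : L -> R) :
  (forall n, measurable_fun setT (g n)) ->
  (forall l, g n l @[n --> \oo] --> h l) -> measurable_fun setT h.
Proof. by move=> mg cg; apply: measurable_fun_cvg mg _ => l _; exact: cg. Qed.

Lemma tc_family_intro f : (forall l, positive_op (f l)) ->
  (forall l, exists M, finite_trace e (f l) M) ->
  (forall i j, measurable_fun setT (fun l => rdot (f l (e i)) (e j))) ->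
  (forall i j, measurable_fun setT (fun l => rdot (f l (e i)) ('i *: e j))) ->
  tc_family f.
Proof.
move=> pf tf m1 m2; split=> // x y.
apply: (@measurable_lim (fun n l => rdot (f l (eproj e n x)) (eproj e n y))).
  move=> n; under eq_fun do rewrite (rdot_eproj _ _ _ _ (positive_linear (pf _))).
  apply: measurable_sum_nat => i; apply: measurable_sum_nat => j.
  by apply: measurable_funD; apply: measurable_funM => //; exact: measurable_cst.
by move=> l; apply: cvg_rdot_eproj => //; exact: (pf l).1.
Qed.

Section family.
Variables (f : L -> H -> H) (ff : tc_family f).
Let pf l : positive_op (f l). Proof. by case: ff. Qed.

Lemma family_trace l : finite_trace e (f l) (rtr e (f l)).
Proof. by case: ff => _ /(_ l)[M fM] _; exact: rtr_finite_trace fM. Qed.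

Lemma family_rtr_ge0 l : 0 <= rtr e (f l).
Proof. exact: rtr_ge0 (family_trace l). Qed.

Lemma measurable_rtr : measurable_fun setT (fun l => rtr e (f l)).
Proof.
apply: (@measurable_lim (fun n l => \sum_(0 <= j < n) rdot (f l (e j)) (e j))).
  by move=> n; apply: measurable_sum_nat => j; case: ff.
by move=> l; exact: rtr_cvg (family_trace l).
Qed.

Variables (mu : {measure set L -> \bar R}).
Hypothesis (intf : mu.-integrable setT (EFin \o (fun l => rtr e (f l)))).

(** Entries in the basis determine all entries by dominated convergence along [eproj e n];
    [rtr_rdot_le] provides the integrable bound. *)
Lemma family_is_int A v : measurable A -> bounded_op v ->
  (forall i j, is_int mu A (fun l => rdot (f l (e i)) (e j)) (rdot (v (e i)) (e j))) ->
  (forall i j, is_int mu A (fun l => rdot (f l (e i)) ('i *: e j))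
    (rdot (v (e i)) ('i *: e j))) ->
  forall x y, is_int mu A (fun l => rdot (f l x) y) (rdot (v x) y).
Proof.
move=> mA bv h1 h2 x y; pose K := (sqn x + sqn y) / 2.
have K0 : 0 <= K by rewrite divr_ge0// addr_ge0// sqn_ge0.
apply: (@is_int_dct _ _ _ _ _ (fun n l => rdot (f l (eproj e n x)) (eproj e n y)) _
  (fun l => K * rtr e (f l)) (fun n => rdot (v (eproj e n x)) (eproj e n y))) => //.
- move=> n; under eq_fun do rewrite (rdot_eproj _ _ _ _ (positive_linear (pf _))).
  rewrite (rdot_eproj _ _ _ _ bv.1).
  apply: is_int_sum => // i; apply: is_int_sum => // j.
  by apply: is_intD => //; exact: is_intZ.
- by move=> l _; apply: cvg_rdot_eproj => //; exact: (pf l).1.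
- move=> n l _; apply: le_trans (rtr_rdot_le oe (pf l) (family_trace l) _ _) _.
  rewrite mulrC ler_wpM2r ?family_rtr_ge0// ler_pM2r ?invr_gt0//.
  by apply: lerD; exact: sqn_eproj_le.
- apply: integrableS (integrableZl measurableT K intf) => //.
- exact: cvg_rdot_eproj.
Qed.

End family.

End trace_class_families.

Section operator_density.
Context {R : realType} {H : hilbertType R} (e : nat -> H).
Hypotheses (hH : hilbert_basis (hbasis H)) (oe : onb e).
Context {d : measure_display} {L : measurableType d}.
Variables (nu : set L -> H -> H) (nu_povm : tc_povm nu).
Variables (m : {finite_measure set L -> \bar R}) (nu_m : povm_variation nu = m).
Implicit Types (A : set L) (x y : H).

Lemma ae_conj (P Q : L -> Prop) : {ae m, forall l, P l} -> {ae m, forall l, Q l} ->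
  {ae m, forall l, P l /\ Q l}.
Proof. by apply: filterS2. Qed.

Lemma ae_countable (I : countType) (P : I -> L -> Prop) :
  (forall i, {ae m, forall l, P i l}) -> {ae m, forall l, forall i, P i l}.
Proof.
move=> h; have : {ae m, forall l, forall n,
    (if @choice.unpickle I n is Some i then P i l else True)}.
  by apply: ae_foralln => n; case: choice.unpickle => [i|]; [exact: h|exact: aeW].
by apply: filterS => l hl i; have := hl (choice.pickle i); rewrite choice.pickleK.
Qed.

Let good (a b : nat -> nat -> L -> R) l :=
  [/\ forall i j, a j i l = a i j l, forall i j, b j i l = - b i j l,
    forall i j, e j = 0 -> a i j l = 0 /\ b i j l = 0,
    forall n p q, 0 <= qform (fun i j => a i j l) (fun i j => b i j l) n p q &
    exists t, forall n, \sum_(0 <= i < n) a i i l <= t].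

Lemma povm_rdotC A i j : measurable A ->
  rdot (nu A (e j)) ('i *: e i) = - rdot (nu A (e i)) ('i *: e j).
Proof.
move=> mA; have pA := povm_positive nu_povm mA.
by rewrite (positive_rdotC _ _ pA) (linZ (positive_linear pA)) rdotC rdotiZl.
Qed.

Lemma qform_rdot (T : H -> H) n (p q : nat -> R) : linear T ->
  let v := \sum_(0 <= i < n) (p i +i* q i) *: e i in
  qform (fun i j => rdot (T (e i)) (e j)) (fun i j => rdot (T (e i)) ('i *: e j)) n p q
  = rdot (T v) v.
Proof.
move=> lT v; rewrite /v (lin_sum lT) rdot_suml; apply: eq_bigr => i _.
rewrite rdot_sumr; apply: eq_bigr => j _; rewrite (linZ lT).
rewrite [RHS]/rdot hdotZl hdotZr (hdotE (T (e i))) /=; ring.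
Qed.

Lemma matrix_density_good (a b : nat -> nat -> L -> R) :
  (forall i j, measurable_fun setT (a i j)) ->
  (forall i j, measurable_fun setT (b i j)) ->
  (forall i j A, measurable A -> is_int m A (a i j) (rdot (nu A (e i)) (e j))) ->
  (forall i j A, measurable A -> is_int m A (b i j) (rdot (nu A (e i)) ('i *: e j))) ->
  {ae m, forall l, good a b l}.
Proof.
move=> ma mb ha hb.
have lnu A : measurable A -> linear (nu A).
  by move=> mA; exact: positive_linear (povm_positive nu_povm mA).
have h1 : {ae m, forall l, forall i j, a j i l = a i j l}.
  apply: ae_countable => i; apply: ae_countable => j.
  apply: (is_int_ae_eq (r := fun A => rdot (nu A (e i)) (e j))) => // A mA; last exact: ha.
  by rewrite rdotC -(positive_rdotC _ _ (povm_positive nu_povm mA)); exact: ha.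
have h2 : {ae m, forall l, forall i j, b j i l = - b i j l}.
  apply: ae_countable => i; apply: ae_countable => j.
  apply: (is_int_ae_eq (r := fun A => rdot (nu A (e j)) ('i *: e i))) => //.
  - exact: measurable_funN.
  - by move=> A mA; exact: hb.
  - move=> A mA; rewrite povm_rdotC//.
    by have := is_intZ (-1) mA (hb i j A mA); rewrite mulN1r; under eq_fun do rewrite mulN1r.
have h3 : {ae m, forall l, forall i j, e j = 0 -> a i j l = 0 /\ b i j l = 0}.
  apply: ae_countable => i; apply: ae_countable => j.
  have [ej|/eqP ej] := eqVneq (e j) 0; last by apply: aeW.
  have ha0 : {ae m, forall l, a i j l = 0}.
    apply: (is_int_ae_eq (r := fun=> 0)) => // A mA; last exact: is_int_cst0.
    by have := ha i j A mA; rewrite ej rdot0r.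
  have hb0 : {ae m, forall l, b i j l = 0}.
    apply: (is_int_ae_eq (r := fun=> 0)) => // A mA; last exact: is_int_cst0.
    by have := hb i j A mA; rewrite ej scaler0 rdot0r.
  by apply: filterS (ae_conj ha0 hb0) => l.
have h4 : {ae m, forall l, forall n s, 0 <= qform (fun i j => a i j l) (fun i j => b i j l) n
    (fun i => (gauss s i).1) (fun i => (gauss s i).2)}.
  apply: ae_countable => n; apply: ae_countable => s.
  pose p i : R := (gauss s i).1; pose q i : R := (gauss s i).2.
  pose v := \sum_(0 <= i < n) (p i +i* q i) *: e i.
  apply: (is_int_ae_ge0 (r := fun A => rdot (nu A v) v)).
  - apply: measurable_sum_nat => i; apply: measurable_sum_nat => j.
    by apply: measurable_funB; apply: measurable_funM => //; exact: measurable_cst.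
  - move=> A mA; rewrite /v -qform_rdot; last exact: lnu.
    apply: is_int_sum => // i; apply: is_int_sum => // j.
    have := is_intD mA (is_intZ (p i * p j + q i * q j) mA (ha i j A mA))
      (is_intZ (- (q i * p j - p i * q j)) mA (hb i j A mA)).
    set r := (X in is_int _ _ _ X -> _); set g := (X in is_int _ _ X _ -> _) => hI.
    have -> : (fun l => a i j l * (p i * p j + q i * q j) -
        b i j l * (q i * p j - p i * q j)) = g.
      by apply/funext => l; rewrite /g; ring.
    by rewrite (_ : _ - _ = r)// /r; ring.
  - by move=> A mA; exact/positive_ge0/povm_positive.
(* The series of diagonal entries has the integral [povm_variation nu setT], which is finite, so the
   series is finite almost everywhere. Absolute values make its terms nonnegative at all points. *)
have h5 : {ae m, forall l, exists t, forall n, \sum_(0 <= i < n) a i i l <= t}.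
  have a0 i : {ae m, forall l, 0 <= a i i l}.
    apply: (is_int_ae_ge0 (r := fun A => rdot (nu A (e i)) (e i))) => //.
      by move=> A mA; exact: ha.
    by move=> A mA; exact/positive_ge0/povm_positive.
  have ia i : is_int m setT (fun l => `|a i i l|) (rdot (nu setT (e i)) (e i)).
    apply: is_int_ae (ha i i _ measurableT) => //.
      exact: measurableT_comp.
    by apply: filterS (a0 i) => l h _; rewrite ger0_norm.
  have iS : m.-integrable setT (fun l => \sum_(0 <= i <oo) (`|a i i l|)%:E)%E.
    apply/integrableP; split.
      apply: ge0_emeasurable_sum => // i _; apply/measurable_EFinP.
      exact: measurableT_comp.
    under eq_integral => l _.
      rewrite gee0_abs; last by apply: nneseries_ge0 => *; rewrite lee_fin.
      over.
    rewrite integral_nneseries//; last first.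
      by move=> i; apply/measurable_EFinP; exact: measurableT_comp.
    under eq_eseriesr do rewrite (ia _).2.
    rewrite -(povm_variationE hH oe nu_povm)// ltey_eq.
    by rewrite (povm_variation_fin oe nu_povm).
  have := integrable_ae measurableT iS; apply: filterS => l /(_ Logic.I) hl.
  exists (fine (\sum_(0 <= i <oo) (`|a i i l|)%:E)%E) => n.
  apply: (@le_trans _ _ (\sum_(0 <= i < n) `|a i i l|)).
    by apply: ler_sum => i _; exact: ler_norm.
  apply: (nneseries_le _ _).1 => //; by rewrite fineK.
have h := ae_conj h1 (ae_conj h2 (ae_conj h3 (ae_conj h4 h5))).
apply: filterS h => l [? [? [? [h6 ?]]]]; split=> // n p q.
exact: qform_gauss_ge0.
Qed.

Theorem povm_operator_density : exists f : L -> H -> H,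
  [/\ tc_family e f, m.-integrable setT (EFin \o (fun l => rtr e (f l))) &
    forall A, measurable A -> forall x y,
      is_int m A (fun l => rdot (f l x) y) (rdot (nu A x) y)].
Proof.
have dens := povm_scalar_density hH oe nu_povm nu_m.
have [a ha] := choice (fun ij : nat * nat =>
  let: ex_intro2 g mg hg := dens (e ij.1) (e ij.2) in ex_intro
    (fun g => measurable_fun setT g /\ forall A, measurable A ->
      is_int m A g (rdot (nu A (e ij.1)) (e ij.2))) g (conj mg hg)).
have [b hb] := choice (fun ij : nat * nat =>
  let: ex_intro2 g mg hg := dens (e ij.1) ('i *: e ij.2) in ex_intro
    (fun g => measurable_fun setT g /\ forall A, measurable A ->
      is_int m A g (rdot (nu A (e ij.1)) ('i *: e ij.2))) g (conj mg hg)).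
pose a' i j := a (i, j); pose b' i j := b (i, j).
have ma i j : measurable_fun setT (a' i j) by have [] := ha (i, j).
have mb i j : measurable_fun setT (b' i j) by have [] := hb (i, j).
have ia i j A : measurable A -> is_int m A (a' i j) (rdot (nu A (e i)) (e j)).
  by have [_] := ha (i, j); apply.
have ib i j A : measurable A -> is_int m A (b' i j) (rdot (nu A (e i)) ('i *: e j)).
  by have [_] := hb (i, j); apply.
have [N0 [mN0 N00 badN0]] := matrix_density_good ma mb ia ib.
have goodN0 l : ~ N0 l -> good a' b' l.
  by move=> hl; apply: contrapT => hb'; apply: hl; exact: badN0.
(* Cutting off on the null set of bad points defines the operator everywhere, as 0 there, and keeps
   its entries measurable. *)
pose u : L -> R := \1_(~` N0).
have mu1 : measurable_fun setT u by apply: measurable_indic; exact: measurableC.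
have opl l : exists T : H -> H, [/\ positive_op T, exists M, finite_trace e T M &
    forall i j, hdot (T (e i)) (e j) = (u l * a' i j l) +i* (u l * b' i j l)].
  have [Nl|Nl] := pselect (N0 l).
    exists (fun=> 0); split.
    - apply: (@positive_opP _ _ _ 0) => //.
      + by move=> c x y; rewrite scaler0 addr0.
      + by move=> x y; rewrite rdot0l rdot0r.
      + by move=> x; rewrite rdot0l.
      + by move=> x; rewrite sqn0 mul0r.
    - by exists 0 => n; rewrite big1// => i _; rewrite rdot0l.
    - move=> i j; rewrite hdot0l /u indicE in_setC mem_set//= !mul0r.
      by apply/eqP; rewrite eq_complex /= eqxx.
  have [g1 g2 g3 g4 [t g5]] := goodN0 l Nl.
  have ul : u l = 1 by rewrite /u indicE in_setC memNset.
  pose h i j := a' i j l +i* b' i j l.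
  have [||||T pT hT] := @psd_operator _ _ _ oe h t.
  - by move=> i j; rewrite /h g1 g2.
  - by move=> n c; rewrite qformE.
  - exact: g5.
  - by move=> i j /(g3 i) []; rewrite /h => -> ->.
  exists T; split => //; last by move=> i j; rewrite hT ul !mul1r.
  exists t => n; apply: le_trans (g5 n); apply: ler_sum => j _.
  by rewrite /rdot hT.
have [f hf] := choice opl.
have pf l : positive_op (f l) by have [] := hf l.
have fa i j l : rdot (f l (e i)) (e j) = u l * a' i j l.
  by have [_ _ h] := hf l; rewrite /rdot h.
have fb i j l : rdot (f l (e i)) ('i *: e j) = u l * b' i j l.
  have [_ _ /(_ i j)] := hf l; rewrite hdotE => /eqP.
  by rewrite eq_complex/= => /andP[_ /eqP].
have ff : tc_family e f.
  apply: tc_family_intro => //; first by move=> l; have [] := hf l.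
    by move=> i j; under eq_fun do rewrite fa; exact: measurable_funM.
  by move=> i j; under eq_fun do rewrite fb; exact: measurable_funM.
have aeu (g : L -> R) A : {ae m, forall l, A l -> g l = u l * g l}.
  exists N0; split => // l /= h; apply: contrapT => Nl; apply: h => _.
  by rewrite /u indicE in_setC memNset//= mul1r.
have ifa i j A : measurable A ->
    is_int m A (fun l => rdot (f l (e i)) (e j)) (rdot (nu A (e i)) (e j)).
  move=> mA; under eq_fun do rewrite fa; apply: is_int_ae (ia i j A mA) => //.
  exact/measurable_funTS/measurable_funM.
have ifb i j A : measurable A ->
    is_int m A (fun l => rdot (f l (e i)) ('i *: e j)) (rdot (nu A (e i)) ('i *: e j)).
  move=> mA; under eq_fun do rewrite fb; apply: is_int_ae (ib i j A mA) => //.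
  exact/measurable_funTS/measurable_funM.
have intf : m.-integrable setT (EFin \o (fun l => rtr e (f l))).
  apply/integrableP; split; first exact/measurable_EFinP/(measurable_rtr ff).
  under eq_integral => l _.
    rewrite gee0_abs /=; last by rewrite lee_fin (family_rtr_ge0 ff).
    rewrite -(rtr_series (pf l) (family_trace ff l)); over.
  rewrite integral_nneseries//; last 2 first.
    by move=> i; apply/measurable_EFinP; case: ff.
    by move=> i l _; rewrite lee_fin; exact: positive_ge0.
  under eq_eseriesr do rewrite (ifa _ _ _ measurableT).2.
  rewrite -(povm_variationE hH oe nu_povm)// ltey_eq.
  by rewrite (povm_variation_fin oe nu_povm).
exists f; split => // A mA.
apply: (family_is_int oe ff intf) => //; last by move=> i j; exact: ifb.
  by have [] := povm_positive nu_povm mA.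
by move=> i j; exact: ifa.
Qed.

End operator_density.

(** * Bochner integrals *)

Section simple_functions.
Context {R : realType} {d : measure_display} {L : measurableType d}.

Definition simple {V : Type} (s : L -> V) :=
  finite_set (range s) /\ forall v, measurable (s @^-1` [set v]).

Lemma simple_cst (V : Type) (v : V) : simple (fun=> v : V).
Proof.
split.
  by apply: (@sub_finite_set _ _ [set v]) => // w [l _ <-].
move=> w; have [->|vw] := pselect (w = v).
  by rewrite (_ : _ @^-1` _ = setT)//; apply/seteqP; split.
by rewrite (_ : _ @^-1` _ = set0)//; apply/seteqP; split => // l /= /esym.
Qed.

Lemma simple_map2 (V1 V2 W : Type) (op : V1 -> V2 -> W) (s1 : L -> V1) (s2 : L -> V2) :
  simple s1 -> simple s2 -> simple (fun l => op (s1 l) (s2 l)).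
Proof.
move=> [f1 m1] [f2 m2]; have fX := finite_setX f1 f2.
split.
  apply: (sub_finite_set _ (finite_image (fun p => op p.1 p.2) fX)).
  by move=> _ [l _ <-]; exists (s1 l, s2 l) => //; split; exists l.
move=> w.
rewrite (_ : _ @^-1` _ = \bigcup_(p in (range s1 `*` range s2) `&` [set p | op p.1 p.2 = w])
    (s1 @^-1` [set p.1] `&` s2 @^-1` [set p.2])).
  apply: fin_bigcup_measurable.
    by apply: sub_finite_set fX => p [].
  by move=> p _; exact: measurableI.
apply/seteqP; split=> [l /= lw|l [[p1 p2] [[_ _] /= <-]] [/= -> ->]//].
by exists (s1 l, s2 l) => //; split => //; split; exists l.
Qed.

Lemma simple_sum (V : nmodType) n (s : nat -> L -> V) : (forall k, simple (s k)) ->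
  simple (fun l => \sum_(0 <= k < n) s k l).
Proof.
move=> ss; elim: n => [|n ih].
  by under eq_fun do rewrite big_geq//; exact: simple_cst.
by under eq_fun do rewrite big_nat_recr//=; exact: simple_map2.
Qed.

Lemma simple_measurable (s : L -> R) B : (forall l, `|s l| <= B) ->
  measurable_fun setT s -> simple (fun l => Num.floor (s l)).
Proof.
move=> sB ms; split.
  pose N := `|Num.ceil B|%N.
  have BN : B <= N%:R.
    by rewrite /N natr_absz (le_trans (ceil_ge B))// ler_int ler_norm.
  apply: (sub_finite_set _ (finite_image (fun k : nat => k%:Z - N%:Z)
    (finite_II (N + N).+1))) => _ [l _ <-].
  have /ler_normlP[h3 h4] := sB l.
  have h5 : - (N%:Z) <= Num.floor (s l).
    rewrite -[leLHS](@intrKfloor R) rmorphN /=.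
    by apply: le_floor; rewrite lerNl (le_trans h3).
  have h6 : Num.floor (s l) <= N%:Z.
    by rewrite -[leRHS](@intrKfloor R); apply: le_floor; rewrite (le_trans h4).
  exists (absz (Num.floor (s l) + N%:Z)); last by lia.
  by rewrite /=; lia.
move=> k.
rewrite (_ : _ @^-1` _ = s @^-1` `[k%:~R, (k + 1)%:~R[%classic).
  by rewrite -[X in measurable X]setTI; exact: ms.
apply/seteqP; split=> l /=.
  by move=> <-; rewrite in_itv/= floor_itv.
by rewrite in_itv/= => h; exact: floor_def.
Qed.

End simple_functions.

Lemma is_int_sum_seq {R : realType} {d : measure_display} {L : measurableType d}
  (mu : {measure set L -> \bar R}) A (I : Type) (s : seq I) (g : I -> L -> R) (r : I -> R) :
  measurable A -> (forall k, is_int mu A (g k) (r k)) ->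
  is_int mu A (fun l => \sum_(k <- s) g k l) (\sum_(k <- s) r k).
Proof.
move=> mA h; elim: s => [|k s ih].
  by rewrite big_nil; under eq_fun do rewrite big_nil; exact: is_int_cst0.
by rewrite big_cons; under eq_fun do rewrite big_cons; exact: is_intD.
Qed.

Section simple_integrals.
Context {R : realType} {H : hilbertType R} {d : measure_display} {L : measurableType d}.
Variables (mu : {measure set L -> \bar R}) (N : (H -> H) -> \bar R).

Lemma simple_is_int (s : L -> H -> H) A x y : simple_integrable N mu s ->
  measurable A -> is_int mu A (fun l => rdot (s l x) y)
    (rdot (simple_integral mu A s x) y).
Proof.
move=> [fs ms _ s0] mA; pose I := fset_set (range s).
rewrite /simple_integral fsbig_finite//= fct_sumE rdot_suml.
have E l : rdot (s l x) y = \sum_(v <- I) rdot (v x) y * \1_(s @^-1` [set v]) l.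
  have sl : s l \in I by rewrite in_fset_set//; apply/mem_set; exists l.
  rewrite (bigD1_seq (s l)) ?fset_uniq//= indicE mem_set// mulr1 big1 ?addr0//.
  move=> v vs; rewrite indicE memNset ?mulr0// => /= sv.
  by rewrite sv eqxx in vs.
under eq_fun do rewrite E.
apply: is_int_sum_seq => // v.
have -> : ((fine (mu (A `&` s @^-1` [set v])))%:C *: v) x =
    (fine (mu (A `&` s @^-1` [set v])))%:C *: v x by [].
(* The level set of [0] may have infinite measure, but its contribution is 0. *)
rewrite rdotZl mulrC; have [->|v0] := eqVneq v 0.
  rewrite [X in is_int _ _ _ X](_ : _ = 0); last by rewrite rdot0l mul0r.
  by under eq_fun do rewrite rdot0l mul0r; exact: is_int_cst0.
have fin : (mu (A `&` s @^-1` [set v]) < +oo)%E.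
  apply: le_lt_trans (s0 v v0); apply: le_measure; try exact: mem_set.
  - by apply/mem_set; exact: measurableI.
  - exact: subIsetr.
have e1 : (\int[mu]_(l in A) (\1_(s @^-1` [set v]) l)%:E = mu (A `&` s @^-1` [set v]))%E.
  by rewrite integral_indic// setIC.
apply: is_intZ => //; split; last by rewrite e1 fineK// ge0_fin_numE.
apply/integrableP; split.
  by apply/measurable_EFinP/measurable_funTS/measurable_indic.
under eq_integral do rewrite /= ger0_norm//.
by rewrite e1.
Qed.

End simple_integrals.

Section bochner_approximation.
Context {R : realType} {H : hilbertType R} (e : nat -> H).
Hypotheses (hH : hilbert_basis (hbasis H)) (oe : onb e).
Context {d : measure_display} {L : measurableType d}.
Variables (mu : {sigma_finite_measure set L -> \bar R}).
Variables (f : L -> H -> H) (ff : tc_family e f).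
Hypothesis (intf : mu.-integrable setT (EFin \o (fun l => rtr e (f l)))).

Let pf l : positive_op (f l). Proof. by case: ff. Qed.
Let t l := rtr e (f l).
Let t0 l : 0 <= t l. Proof. exact: family_rtr_ge0 ff l. Qed.
Let mt : measurable_fun setT t. Proof. exact: measurable_rtr ff. Qed.

Variables (F : nat -> set L).
Hypotheses (FT : setT = \bigcup_n F n) (ndF : nondecreasing_seq F)
  (mF : forall n, measurable (F n) /\ (mu (F n) < +oo)%E).

Let G n := F n `&` [set l | t l <= n%:R].
Let mG n : measurable (G n).
Proof.
apply: measurableI; first exact: (mF n).1.
rewrite (_ : [set l | _] = t @^-1` `]-oo, n%:R]%classic).
  by rewrite -[X in measurable X]setTI; exact: mt.
by apply/seteqP; split => l /=; rewrite in_itv.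
Qed.

(** Rounding changes the real and the imaginary part of each of the [n * n] entries by at most
    [1 / K n], whence the bound [c n]. The factors of [K n] make [c n] times the measure of [F n] at
    most [1 / n.+1], and [+ 1] keeps [K n] positive. *)
Let K n : R := 2 * n.+1%:R ^+ 3 * (fine (mu (F n)) + 1).
Let c n : R := (n%:R * n%:R * 2) / K n.

Let mF0 n : 0 <= fine (mu (F n)). Proof. exact: fine_ge0. Qed.

Let K0 n : 0 < K n.
Proof. by rewrite !mulr_gt0// ?exprn_gt0// ltr_wpDl. Qed.

Let c0 n : 0 <= c n.
Proof. by rewrite /c divr_ge0// ?ltW// !mulr_ge0. Qed.

Let c_le n : c n * (fine (mu (F n)) + 1) <= n.+1%:R^-1.
Proof.
have h : 0 < fine (mu (F n)) + 1 by rewrite ltr_wpDl.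
have hn : (n%:R : R) <= n.+1%:R by rewrite ler_nat.
have n1 : 0 < n.+1%:R :> R by rewrite ltr0n.
have n0 : 0 <= n%:R :> R by rewrite ler0n.
rewrite /c /K; move: hn n1 n0; move: (n%:R) n.+1%:R => p q pq q0 p0.
rewrite -(@ler_pM2r _ (q ^+ 3)) ?exprn_gt0//.
rewrite (_ : _ * q ^+ 3 = p ^+ 2); last by field; rewrite !gt_eqF.
rewrite (_ : q^-1 * _ = q ^+ 2); last by field; rewrite gt_eqF.
by rewrite ler_pXn2r ?nnegrE// ltW.
Qed.

(* Rounding to multiples of [1 / K n] makes the entries of [f] simple on [G n],
   where [f] has trace at most [n]. *)
Let trunc n (x : L -> R) l : R := \1_(G n) l * ((Num.floor (K n * x l))%:~R / K n).

Let u n l : R := \1_(G n) l.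
Let mu1 n : measurable_fun setT (u n). Proof. exact: measurable_indic. Qed.
Let u1 n l : G n l -> u n l = 1. Proof. by move=> h; rewrite /u indicE mem_set. Qed.
Let u0 n l : ~ G n l -> u n l = 0. Proof. by move=> h; rewrite /u indicE memNset. Qed.

Let re i j l := rdot (f l (e i)) (e j).
Let im i j l := rdot (f l (e i)) ('i *: e j).

Let coef_le (y : H) i l : sqn y <= 1 -> `|rdot (f l (e i)) y| <= t l.
Proof.
move=> y1; apply: le_trans (rtr_rdot_le oe (pf l) (family_trace ff l) _ _) _.
rewrite -[leRHS]mulr1; apply: ler_wpM2l; first exact: t0.
have h := ons_sqn_le1 i oe.1; lra.
Qed.

Let re_le i j l : `|re i j l| <= t l.
Proof. by apply: coef_le; exact: ons_sqn_le1 oe.1. Qed.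
Let im_le i j l : `|im i j l| <= t l.
Proof. by apply: coef_le; rewrite sqn_i; exact: ons_sqn_le1 oe.1. Qed.

Let trunc_simple n (x : L -> R) : measurable_fun setT x ->
  (forall l, `|x l| <= t l) -> simple (trunc n x).
Proof.
move=> mx xt.
have s1 : simple (fun l => Num.floor (K n * (u n l * x l))).
  apply: (@simple_measurable _ _ _ _ (K n * n%:R)).
    move=> l; rewrite normrM [X in X * _]ger0_norm; last exact: ltW (K0 n).
    apply: ler_wpM2l; first exact: ltW (K0 n).
    have [Gl|Gl] := pselect (G n l); last by rewrite u0// mul0r normr0.
    by rewrite u1// mul1r (le_trans (xt l))//; case: Gl.
  apply: measurable_funM; first exact: measurable_cst.
  exact: measurable_funM.
have s2 : simple (u n).
  have h : forall l, `|u n l| <= 1.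
    by move=> l; rewrite /u indicE; case: (_ \in _); rewrite ?normr1// normr0.
  rewrite (_ : u n = fun l => (Num.floor (u n l))%:~R); last first.
    apply/funext => l; rewrite /u indicE.
    by case: (_ \in _); rewrite ?(floor1, floor0).
  exact: (simple_map2 (fun a b : int => a%:~R : R) (simple_measurable h (mu1 n))
    (simple_cst (0 : int))).
have -> : trunc n x = fun l => u n l * ((Num.floor (K n * (u n l * x l)))%:~R / K n).
  apply/funext => l; rewrite /trunc -/(u n l).
  have [Gl|Gl] := pselect (G n l); last by rewrite u0// !mul0r.
  by rewrite u1// !mul1r.
exact: (simple_map2 (fun a (b : int) => a * (b%:~R / K n)) s2 s1).
Qed.

Let trunc_err n (x : L -> R) l : G n l -> `|trunc n x l - x l| <= (K n)^-1.
Proof.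
move=> Gl; rewrite /trunc -/(u n l) u1// mul1r.
have /andP[h1 h2] := floor_itv (K n * x l); rewrite intrD in h2.
rewrite [X in _ - X](_ : _ = K n * x l / K n); last first.
  by rewrite mulrAC mulfV ?mul1r// gt_eqF.
have Ki : 0 <= (K n)^-1 by rewrite invr_ge0 ltW.
rewrite -mulrBl normrM (ger0_norm Ki) -[leRHS]mul1r; apply: ler_wpM2r => //.
rewrite ler_norml; apply/andP; split; lra.
Qed.

Definition approx_s n l : H -> H :=
  mxop e (fun i j => trunc n (re i j) l +i* trunc n (im i j) l) n.

Let tail n l := t l - \sum_(0 <= j < n) re j j l.

(** Three errors: off [G n] the approximation is 0, the compression to [n] basis vectors loses the
    tail of the trace, and the entries are rounded. *)
Definition approx_b n l : R :=
  (1 - u n l) * t l + 2 * Num.sqrt (t l * tail n l) + c n * u n l.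

Let tail0 n l : 0 <= tail n l.
Proof. by rewrite subr_ge0; exact: (family_trace ff l). Qed.

Let tail_le n l : tail n l <= t l.
Proof.
rewrite /tail gerBl; apply: sumr_ge0 => j _; exact: positive_ge0.
Qed.

Lemma approx_b_ge0 n l : 0 <= approx_b n l.
Proof.
have h : 0 <= 1 - u n l.
  by rewrite subr_ge0 /u indicE; case: (_ \in _).
have h2 : 0 <= u n l by rewrite /u indicE.
by rewrite !addr_ge0// mulr_ge0// sqrtr_ge0.
Qed.

Lemma approx_hs n l : hs e (approx_s n l). Proof. exact: hs_mxop. Qed.

Lemma f_hs l : hs e (f l). Proof. exact: hs_positive (family_trace ff l). Qed.

Lemma approx_nuclear n l : nuclear_le (fun x => approx_s n l x - f l x) (approx_b n l).
Proof.
have fM := family_trace ff l.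
have [Gl|Gl] := pselect (G n l); last first.
  have s0 x : approx_s n l x = 0.
    rewrite /approx_s mxopE big1// => i _; rewrite big1// => j _.
    by rewrite /trunc -/(u n l) u0// !mul0r scale0r.
  have -> : (fun x => approx_s n l x - f l x) = fun x => - f l x.
    by apply/funext => x; rewrite s0 sub0r.
  apply: nuclear_le_trans (nuclear_leN (nuclear_le_positive oe (pf l) fM)).
  by rewrite /approx_b u0// subr0 mul1r mulr0 addr0 lerDl mulr_ge0// sqrtr_ge0.
pose z i j := (trunc n (re i j) l - re i j l) +i* (trunc n (im i j) l - im i j l).
have -> : (fun x => approx_s n l x - f l x) =
    fun x => mxop e z n x - (f l x - eproj e n (f l (eproj e n x))).
  apply/funext => x; rewrite proj_compression; last exact: positive_linear.
  rewrite opprB addrA; congr (_ - _); rewrite /approx_s !mxopE -big_split/=.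
  apply: eq_bigr => i _; rewrite -big_split/=; apply: eq_bigr => j _.
  rewrite -scalerDl -mulrDl; congr ((_ * _) *: _).
  by rewrite (hdotE (f l (e i))); apply/eqP; rewrite eq_complex/= !subrK !eqxx.
apply: nuclear_le_trans (nuclear_leB (nuclear_le_mxop oe z n)
  (@nuclear_le_compression _ _ _ oe (f l) (t l) (tail n l) n (pf l) fM _)); last first.
  move=> J; rewrite /tail lerBrDl.
  have [nJ|Jn] := leqP n J.
    by rewrite -big_cat_nat//; exact: fM.
  by rewrite [X in _ + X]big_geq ?addr0 1?ltnW//; exact: fM.
rewrite /approx_b u1// subrr mul0r add0r mulr1 addrC lerD2l.
apply: (@le_trans _ _ (\sum_(0 <= i < n) \sum_(0 <= j < n) (2 / K n))).
  apply: ler_sum => i _; apply: ler_sum => j _.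
  by rewrite mulr_natl mulr2n lerD//; exact: trunc_err.
rewrite !sumr_const_nat !subn0 -[leLHS]mulr_natl -[X in _ * X]mulr_natl /c.
by rewrite !mulrA lexx.
Qed.

Let inG l : exists n0, forall n, (n0 <= n)%N -> G n l.
Proof.
have [k _ Fk] : (\bigcup_n F n) l by rewrite -FT.
exists (maxn k (Num.truncn (t l)).+1) => n; rewrite geq_max => /andP[kn tn].
split; first by have /subsetPset := ndF kn; apply.
by rewrite /= ltW// (lt_le_trans (truncnS_gt _))// ler_nat.
Qed.

Let tail_cvg l : tail n l @[n --> \oo] --> (0 : R).
Proof.
rewrite -(subrr (t l)); apply: cvgB; first exact: cvg_cst.
exact: rtr_cvg (pf l) (family_trace ff l).
Qed.

(** The part of [approx_b] dominated by [3 * t]; the integral of the remaining term is controlled by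
    [c_le]. *)
Let b1 n l : R := (1 - u n l) * t l + 2 * Num.sqrt (t l * tail n l).

Let b1_cvg l : b1 n l @[n --> \oo] --> (0 : R).
Proof.
rewrite -(addr0 0); apply: cvgD.
  apply: cvg_near_cst; have [n0 hn0] := inG l; exists n0 => // n /= /hn0 Gl.
  by rewrite u1// subrr mul0r.
rewrite -(mulr0 2); apply: cvgM; first exact: cvg_cst.
apply: (@sqr_cvg0 _ _ (fun n => t l * tail n l)).
  by move=> n; rewrite sqr_sqrtr// mulr_ge0.
by rewrite -(mulr0 (t l)); apply: cvgM => //; exact: cvg_cst.
Qed.

Let u01 n l : 0 <= u n l <= 1.
Proof. by rewrite /u indicE; case: (_ \in _); rewrite ?lexx ?ler01. Qed.

Let c_le1 n : c n <= n.+1%:R^-1.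
Proof. by apply: le_trans (c_le n); rewrite ler_peMr// lerDr. Qed.

Lemma approx_b_cvg l : approx_b n l @[n --> \oo] --> (0 : R).
Proof.
rewrite -(addr0 0); apply: cvgD; first exact: b1_cvg.
apply: (@cvg_squeeze0 _ _ (fun n => n.+1%:R^-1)); last exact: cvg_harmonic.
move=> n; have /andP[h1 h2] := u01 n l.
by rewrite mulr_ge0//= (le_trans _ (c_le1 n))// ler_piMr.
Qed.

Let mtail n : measurable_fun setT (tail n).
Proof.
apply: measurable_funB => //; apply: measurable_sum_nat => j.
by case: ff => _ _; exact.
Qed.

Let mb1 n : measurable_fun setT (b1 n).
Proof.
apply: measurable_funD; apply: measurable_funM => //; try exact: measurable_cst.
  by apply: measurable_funB => //; exact: measurable_cst.
apply: (measurableT_comp (continuous_measurable_fun (@sqrt_continuous R))).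
exact: measurable_funM.
Qed.

Let b1_le n l : `|b1 n l| <= 3 * t l.
Proof.
have /andP[h1 h2] := u01 n l.
have h3 : (1 - u n l) * t l <= t l by rewrite ler_piMl// lerBlDr lerDl.
have h4 : 0 <= (1 - u n l) * t l by rewrite mulr_ge0// subr_ge0.
have h5 : Num.sqrt (t l * tail n l) <= t l.
  rewrite -[leRHS](ger0_norm (t0 l)) -sqrtr_sqr ler_wsqrtr// expr2.
  exact: ler_wpM2l.
have := sqrtr_ge0 (t l * tail n l).
rewrite /b1 => h6; rewrite ger0_norm ?addr_ge0 ?mulr_ge0//; lra.
Qed.

Lemma approx_b_int : exists2 I : nat -> R,
  (forall n, is_int mu setT (approx_b n) (I n)) & I n @[n --> \oo] --> (0 : R).
Proof.
have i3 : mu.-integrable setT (fun l => (3 * t l)%:E).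
  by under eq_fun do rewrite EFinM; exact: integrableZl.
have ib n : mu.-integrable setT (EFin \o b1 n).
  apply: le_integrable i3 => //; first exact/measurable_EFinP.
  by move=> l _ /=; rewrite lee_fin (le_trans (b1_le n l))// ler_norm.
have cb : (\int[mu]_l (b1 n l)%:E)%E @[n --> \oo] --> 0%E.
  rewrite -(integral0 mu setT).
  have := @dominated_convergence _ _ _ mu setT measurableT
    (fun n l => (b1 n l)%:E) (cst 0%E) (fun l => (3 * t l)%:E).
  case=> //.
  - by move=> n; exact: measurable_int (ib n).
  - apply: aeW => l _; apply/cvg_EFin; first exact: nearW.
    exact: b1_cvg.
  - by apply: aeW => l n _; rewrite lee_fin b1_le.
have fG n : (mu (G n) < +oo)%E.
  apply: le_lt_trans (mF n).2; apply: le_measure; try exact: mem_set.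
    by apply/mem_set; exact: (mF n).1.
  exact: subIsetl.
have iu n : is_int mu setT (u n) (fine (mu (G n))).
  split; last by rewrite integral_indic// setIT fineK// ge0_fin_numE.
  apply/integrableP; split; first exact/measurable_EFinP.
  under eq_integral do rewrite /= ger0_norm//.
  by rewrite integral_indic// setIT; exact: fG.
have finb n : (\int[mu]_l (b1 n l)%:E)%E \is a fin_num.
  exact: (integrable_fin_num measurableT (ib n)).
exists (fun n => fine (\int[mu]_l (b1 n l)%:E) + c n * fine (mu (G n))).
  move=> n; apply: is_intD => //; last exact: is_intZ.
  split; [exact: ib|exact: (esym (fineK (finb n)))].
rewrite -(addr0 0); apply: cvgD.
  by move/fine_cvgP : cb => [].
apply: (@cvg_squeeze0 _ _ (fun n => n.+1%:R^-1)); last exact: cvg_harmonic.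
move=> n; rewrite mulr_ge0 ?fine_ge0//= (le_trans _ (c_le n))// ler_wpM2l//.
rewrite (@le_trans _ _ (fine (mu (F n))))// ?lerDl//.
rewrite fine_le ?ge0_fin_numE//; first exact: (mF n).2.
apply: le_measure; try exact: mem_set.
  by apply/mem_set; exact: (mF n).1.
exact: subIsetl.
Qed.

Lemma measurable_re_im n i j : simple (trunc n (re i j)) /\ simple (trunc n (im i j)).
Proof.
split; apply: trunc_simple; [by case: ff => _ _; exact|exact: re_le|
  by case: ff => _ _; exact|exact: im_le].
Qed.

Lemma approx_simple n : simple_integrable trace_norm mu (approx_s n).
Proof.
have [fs ms] : simple (approx_s n).
  rewrite /approx_s /mxop; apply: simple_sum => i; apply: simple_sum => j.
  have [h1 h2] := measurable_re_im n i j.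
  exact: (simple_map2 (fun a b : R => (a +i* b) *: tensor (e j) (e i)) h1 h2).
split=> // [l|v v0].
  have [c1 c2] := approx_hs n l.
  by apply: le_lt_trans (hs_trace_norm_le hH oe (approx_hs n l) (nuclear_le_mxop oe _ n)) (ltry _).
apply: le_lt_trans (mF n).2; apply: le_measure; try exact: mem_set.
  by apply/mem_set; exact: (mF n).1.
move=> l /= sv; apply: contrapT => Fl; move/eqP : v0; apply.
rewrite -sv; apply/funext => x; rewrite /approx_s mxopE big1// => i _.
rewrite big1// => j _; rewrite /trunc -/(u n l) u0 ?mul0r ?scale0r//.
by move=> [].
Qed.

End bochner_approximation.

Section lower_integral.
Context {R : realType} {d : measure_display} {L : measurableType d}.
Variable mu : {measure set L -> \bar R}.

(* The integral of a nonnegative function is a supremum over the simple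
   functions below it, even if the function is not measurable. *)
Lemma ge0_le_lower_integral (g h : L -> \bar R) : (forall l, 0 <= g l)%E ->
  (forall l, g l <= h l)%E -> (\int[mu]_l g l <= \int[mu]_l h l)%E.
Proof.
move=> g0 gh; have h0 l : (0 <= h l)%E by apply: le_trans (gh l).
rewrite (ge0_integralTE _ g0) (ge0_integralTE _ h0).
apply: ge_ereal_sup => _ [k /= kg <-]; apply: ereal_sup_ubound.
by exists k => //= l; apply: le_trans (gh l).
Qed.

Lemma is_int_le A g1 g2 r1 r2 : measurable A -> is_int mu A g1 r1 -> is_int mu A g2 r2 ->
  (forall l, A l -> g1 l <= g2 l) -> r1 <= r2.
Proof.
move=> mA [i1 e1] [i2 e2] g12; rewrite -lee_fin -e1 -e2.
by apply: le_integral => // l /set_mem Al; rewrite lee_fin g12.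
Qed.

Lemma is_int_subset A g r : measurable A -> (forall l, 0 <= g l) ->
  is_int mu setT g r -> exists2 r', is_int mu A g r' & r' <= r.
Proof.
move=> mA g0 [i e].
have iA : mu.-integrable A (EFin \o g) by apply: integrableS i.
have fA := integrable_fin_num mA iA.
exists (fine (\int[mu]_(l in A) (g l)%:E)); first by split=> //; rewrite fineK.
rewrite -lee_fin fineK// -e; apply: ge0_subset_integral => //.
  exact: measurable_int i.
by move=> l _; rewrite lee_fin.
Qed.

End lower_integral.

Section bochner_family.
Context {R : realType} {H : hilbertType R} (e : nat -> H).
Hypotheses (hH : hilbert_basis (hbasis H)) (oe : onb e).
Context {d : measure_display} {L : measurableType d}.
Variables (mu : {sigma_finite_measure set L -> \bar R}).
Variables (f : L -> H -> H) (ff : tc_family e f).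
Hypothesis (intf : mu.-integrable setT (EFin \o (fun l => rtr e (f l)))).

(** One approximating sequence serves for all [A]. For fixed orthonormal sequences the sum tested by
    [nuclear_le] on the difference of integrals is the integral of the pointwise sums, each at most
    [b n l]; duality thus turns a weak identity into convergence in trace norm. *)
Lemma bochner_family : exists2 s, bochner_approx trace_norm mu f s &
  forall A v, measurable A -> hs e v ->
    (forall x y, is_int mu A (fun l => rdot (f l x) y) (rdot (v x) y)) ->
    trace_norm (simple_integral mu A (s n) - v)%R @[n --> \oo] --> (0 : \bar R).
Proof.
have /sigma_finiteP[F [FT ndF mF]] := sigma_finiteT mu.
pose s := approx_s e mu f F; pose b := approx_b e mu f F.
have b0 n l : 0 <= b n l by exact: approx_b_ge0.
have [I bI I0] := approx_b_int ff intf FT ndF mF.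
have In0 n : 0 <= I n.
  by have [_ h] := bI n; rewrite -lee_fin -h; apply: integral_ge0 => l _; rewrite lee_fin b0.
have hsd n l : hs e (s n l - f l).
  have := hsD (-1) (approx_hs oe mu f F n l) (f_hs oe ff l).
  by congr hs; apply/funext => x; rewrite scaleN1r.
have sb n l : (trace_norm (s n l - f l)%R <= (b n l)%:E)%E.
  apply: (hs_trace_norm_le hH oe (hsd n l)); exact: (approx_nuclear oe mu ff F n l).
have n0 (T : H -> H) : (0 <= trace_norm T)%E by exact: trace_norm_ge0 oe T.
exists s.
  split; first exact: approx_simple.
    apply: aeW => l; apply: (@squeeze_cvge _ _ _ _ (cst 0%E) _ (fun n => (b n l)%:E)).
    - by apply: nearW => n; rewrite n0 sb.
    - exact: cvg_cst.
    - by apply/cvg_EFin; [exact: nearW|exact: approx_b_cvg].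
  apply: (@squeeze_cvge _ _ _ _ (cst 0%E) _ (fun n => (I n)%:E)).
  - apply: nearW => n; rewrite integral_ge0//= -(bI n).2.
    exact: ge0_le_lower_integral.
  - exact: cvg_cst.
  - by apply/cvg_EFin; [exact: nearW|exact: I0].
move=> A v mA hv vf.
have hsS n : hs e (simple_integral mu A (s n)).
  have [fs _ _ _] := approx_simple hH oe ff mF n.
  rewrite /simple_integral fsbig_finite//= big_seq_cond.
  apply: hs_sum => w /andP[]; rewrite in_fset_set// => /set_mem[l _ <-] _.
  exact: approx_hs.
have hsB n : hs e (simple_integral mu A (s n) - v).
  have := hsD (-1) (hsS n) hv.
  by congr hs; apply/funext => x; rewrite scaleN1r.
apply: (@squeeze_cvge _ _ _ _ (cst 0%E) _ (fun n => (I n)%:E)).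
- apply: nearW => n; rewrite n0/=; apply: (hs_trace_norm_le hH oe (hsB n)).
  move=> ph ps oph ops k.
  have [I' bI' II'] := is_int_subset mA (b0 n) (bI n).
  apply: le_trans II'.
  apply: (is_int_le mA (g1 := fun l => \sum_(0 <= i < k) rdot ((s n l - f l) (ph i)) (ps i)) _ bI').
    apply: is_int_sum => // i.
    have h1 := simple_is_int (ph i) (ps i) (approx_simple hH oe ff mF n) mA.
    have h2 := is_intD mA h1 (is_intZ (-1) mA (vf (ph i) (ps i))).
    move: h2; congr is_int; last by rewrite mulN1r -rdotBl.
    by apply/funext => l; rewrite mulN1r -rdotBl.
  by move=> l _; exact: approx_nuclear.
- exact: cvg_cst.
- by apply/cvg_EFin; [exact: nearW|exact: I0].
Qed.

Lemma bochner_integrable_family : bochner_integrable trace_norm mu f.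
Proof. by have [s hs _] := bochner_family; exists s. Qed.

Lemma is_density_family (nu : set L -> H -> H) :
  (forall A, measurable A -> hs e (nu A)) ->
  (forall A, measurable A ->
    forall x y, is_int mu A (fun l => rdot (f l x) y) (rdot (nu A x) y)) ->
  is_density nu mu f.
Proof.
move=> hnu h; split; first exact: bochner_integrable_family.
have [s hs1 hs2] := bochner_family.
by move=> A mA; exists s => //; exact: hs2 (hnu A mA) (h A mA).
Qed.

End bochner_family.

Section ae_lower_integral.
Context {R : realType} {d : measure_display} {L : measurableType d}.
Variable mu : {measure set L -> \bar R}.

(** A simple function below [g] is cut off on the exceptional null set, which brings it below [h]
    everywhere and leaves its integral unchanged. *)
Lemma ae_le_lower_integral (g h : L -> \bar R) : (forall l, 0 <= g l)%E ->
  (forall l, 0 <= h l)%E -> {ae mu, forall l, (g l <= h l)%E} ->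
  (\int[mu]_l g l <= \int[mu]_l h l)%E.
Proof.
move=> g0 h0 [Z [mZ Z0 gh]]; rewrite (ge0_integralTE _ g0).
apply: ge_ereal_sup => _ [k /= kg <-]; rewrite -integralT_nnsfun.
have mk : measurable_fun setT (fun l => (k l)%:E) by exact/measurable_EFinP.
have m1 : measurable_fun setT (\1_(~` Z) : L -> R).
  by apply: measurable_indic; exact: measurableC.
rewrite (_ : \int[mu]_l (k l)%:E = \int[mu]_l (k l * \1_(~` Z) l)%:E)%E.
  apply: ge0_le_lower_integral => [l|l]; first by rewrite lee_fin mulr_ge0.
  have [Zl|Zl] := pselect (Z l).
    by rewrite indicE memNset ?mulr0//; apply.
  rewrite indicE mem_set// mulr1; apply: le_trans (kg l) _.
  by apply: contrapT => ngh; apply: Zl; exact: gh.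
apply: ge0_ae_eq_integral => //.
- by apply/measurable_EFinP; exact: measurable_funM.
- by move=> l _; rewrite lee_fin.
- by move=> l _; rewrite lee_fin mulr_ge0.
exists Z; split=> // l /= hl; apply: contrapT => Zl; apply: hl => _.
by rewrite indicE mem_set// mulr1.
Qed.

End ae_lower_integral.

(** * Scalar testing of Bochner integrals and uniqueness *)

Section weak_bochner.
Context {R : realType} {H : hilbertType R} (e : nat -> H).
Hypotheses (hH : hilbert_basis (hbasis H)) (oe : onb e).

(** The trace norm dominates the operator norm, so [c x y] bounds the pairing with [x] and [y]; the
    added 1 permits division. *)
Let c (x y : H) : R := Num.sqrt (sqn x * sqn y) + 1.
Let c_gt0 x y : 0 < c x y. Proof. by rewrite ltr_wpDl// sqrtr_ge0. Qed.

Lemma rdot_trace_norm_le (T : H -> H) x y :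
  ((`|rdot (T x) y| / c x y)%:E <= trace_norm T)%E.
Proof.
have := trace_norm_ge0 oe T; case E : (trace_norm T) => [r| |]; [|by move=> _; exact: leey|by []].
rewrite !lee_fin => r0; rewrite ler_pdivrMr//.
have := @trace_norm_sqn _ _ e hH oe T x; rewrite E ltry => /(_ isT)/= h.
have h1 : rdot (T x) y ^+ 2 <= r ^+ 2 * (sqn x * sqn y).
  by rewrite mulrA (le_trans (CS_rdot _ _))// ler_wpM2r// sqn_ge0.
have s0 : 0 <= sqn x * sqn y by rewrite mulr_ge0// sqn_ge0.
have h2 : `|rdot (T x) y| <= r * Num.sqrt (sqn x * sqn y).
  rewrite -(@ler_pXn2r _ 2) ?nnegrE ?mulr_ge0 ?sqrtr_ge0//.
  by rewrite exprMn sqr_sqrtr// -normrX ger0_norm// sqr_ge0.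
by rewrite (le_trans h2)// ler_wpM2l// lerDl.
Qed.

Lemma trace_norm_cvg_rdot (T : nat -> H -> H) v x y :
  trace_norm (T n - v)%R @[n --> \oo] --> (0 : \bar R) ->
  rdot (T n x) y @[n --> \oo] --> rdot (v x) y.
Proof.
move=> TN; have h : (`|rdot ((T n - v) x) y| / c x y)%:E @[n --> \oo] --> (0 : \bar R).
  apply: (@squeeze_cvge _ _ _ _ (cst 0%E) _ (fun n => trace_norm (T n - v)%R)) => //.
    apply: nearW => n; rewrite rdot_trace_norm_le lee_fin divr_ge0//.
    exact: ltW.
  exact: cvg_cst.
have {}h : `|rdot ((T n - v) x) y| / c x y @[n --> \oo] --> (0 : R).
  by move/fine_cvgP : h => [].
apply/subr_cvg0/norm_cvg0P; rewrite -(mul0r (c x y)).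
apply: eq_cvg_seq (cvgM h (cvg_cst (c x y))) => n.
by rewrite divfK ?gt_eqF// -rdotBl.
Qed.

Context {d : measure_display} {L : measurableType d}.
Variable mu : {measure set L -> \bar R}.

(** The function [w] is a measurable version of [rdot (g l x) y]: the pairings of the simple
    functions are cut off on the null set where convergence fails, and [w] is their limit.
    Convergence of the integrals of trace norms makes this a limit in mean. *)
Lemma bochner_weak (g : L -> H -> H) s x y : bochner_approx trace_norm mu g s ->
  exists w : L -> R, {ae mu, forall l, w l = rdot (g l x) y} /\
    forall A v, measurable A ->
      trace_norm (simple_integral mu A (s n) - v)%R @[n --> \oo] --> (0 : \bar R) ->
      is_int mu A w (rdot (v x) y).
Proof.
move=> [ss [Z [mZ Z0 cg]] sg].
pose a := c x y; have a0 : 0 < a := c_gt0 x y.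
pose one l : R := \1_(~` Z) l.
pose u n l := one l * rdot (s n l x) y.
pose w l := one l * rdot (g l x) y.
have uw n l : `|u n l - w l| / a = one l * (`|rdot ((s n l - g l)%R x) y| / a).
  rewrite /u /w -mulrBr -rdotBl normrM mulrA; congr (_ * _ / _).
  by rewrite ger0_norm// /one indicE.
have one_in l : ~ Z l -> one l = 1 by move=> Zl; rewrite /one indicE mem_set.
have one_out l : Z l -> one l = 0 by move=> Zl; rewrite /one indicE memNset//; apply.
have cg' l : ~ Z l -> trace_norm (s n l - g l)%R @[n --> \oo] --> (0 : \bar R).
  by move=> Zl; apply: contrapT => h; apply: Zl; apply: cg.
have cu l : u n l @[n --> \oo] --> w l.
  have [Zl|/[dup] Zl /cg' h] := pselect (Z l).
    by rewrite /w /u one_out// mul0r; under eq_fun do rewrite mul0r; exact: cvg_cst.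
  apply: cvgM; first exact: cvg_cst.
  exact: (@trace_norm_cvg_rdot (fun n => s n l)).
have i1 n A : measurable A ->
    is_int mu A (fun l => rdot (s n l x) y) (rdot (simple_integral mu A (s n) x) y).
  by move=> mA; exact: simple_is_int.
have m1 : measurable_fun setT one by apply: measurable_indic; exact: measurableC.
have mu_ n : measurable_fun setT (u n).
  apply: measurable_funM => //; apply/measurable_EFinP.
  exact: measurable_int (i1 n _ measurableT).1.
have mw : measurable_fun setT w := measurable_lim mu_ cu.
have aew : {ae mu, forall l, w l = rdot (g l x) y}.
  by exists Z; split=> // l /= h; apply: contrapT => Zl; apply: h; rewrite /w one_in// mul1r.
have aeu n : {ae mu, forall l, rdot (s n l x) y = u n l}.
  by exists Z; split=> // l /= h; apply: contrapT => Zl; apply: h; rewrite /u one_in// mul1r.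
have iu n A : measurable A -> is_int mu A (u n) (rdot (simple_integral mu A (s n) x) y).
  move=> mA; apply: is_int_ae (i1 n A mA) => //.
    exact: measurable_funS (mu_ n).
  by have [Y [mY Y0 h]] := aeu n; exists Y; split=> // l /= h2; apply: h => /= h3; exact: h2.
pose D n l := `|u n l - w l| / a.
have D0 n l : 0 <= D n l by rewrite divr_ge0// ltW.
have mD n : measurable_fun setT (D n).
  apply: measurable_funM; last exact: measurable_cst.
  by apply: measurableT_comp => //; exact: measurable_funB.
have cD : (\int[mu]_l (D n l)%:E)%E @[n --> \oo] --> (0 : \bar R).
  apply: (@squeeze_cvge _ _ _ _ (cst 0%E) _ _ _ _ _ sg); last exact: cvg_cst.
  apply: nearW => n; rewrite integral_ge0//=.
    apply: ge0_le_lower_integral => l; first by rewrite lee_fin.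
    rewrite /D uw; have [Zl|Zl] := pselect (Z l).
      by rewrite one_out// mul0r; exact: trace_norm_ge0 oe _.
    by rewrite one_in// mul1r rdot_trace_norm_le.
  by move=> l _; rewrite lee_fin.
have /fine_cvgP[[n0 _ fD] cfD] := cD.
have iD n : (\int[mu]_l (D n l)%:E)%E \is a fin_num ->
    is_int mu setT (D n) (fine (\int[mu]_l (D n l)%:E)).
  move=> fn; split; last by rewrite fineK.
  apply/integrableP; split; first exact/measurable_EFinP.
  under eq_integral do rewrite /= ger0_norm//.
  by rewrite -ge0_fin_numE// integral_ge0// => l _; rewrite lee_fin.
have iDiff n : mu.-integrable setT (EFin \o D n) ->
    mu.-integrable setT (fun l => (u n l - w l)%:E).
  move=> h; apply: le_integrable (integrableZl measurableT a h) => //.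
    by apply/measurable_EFinP; exact: measurable_funB.
  move=> l _ /=; rewrite lee_fin /D mulrCA mulfV ?gt_eqF// mulr1.
  by rewrite (ger0_norm (normr_ge0 _)).
(* For the index [n0], from which the integrals of [D n] are finite, [w] is [u n0] minus an
   integrable difference. *)
have iw : mu.-integrable setT (EFin \o w).
  have h := iDiff n0 (iD n0 (fD n0 (leqnn n0))).1.
  have := integrableB measurableT (iu n0 _ measurableT).1 h.
  by apply: eq_integrable => // l _ /=; rewrite -EFinB; congr EFin; ring.
have {}iD n : is_int mu setT (D n) (fine (\int[mu]_l (D n l)%:E)).
  apply: iD; apply: integrable_fin_num => //.
  have := integrableZl measurableT a^-1
    (integrable_abse (integrableB measurableT (iu n _ measurableT).1 iw)).
  by apply: eq_integrable => // l _; rewrite /= /D [in RHS]mulrC EFinM.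
exists w; split=> // A v mA cv.
have iwA : mu.-integrable A (EFin \o w) by apply: integrableS iw.
have rw : is_int mu A w (fine (\int[mu]_(l in A) (w l)%:E)).
  by split=> //; rewrite fineK//; exact: integrable_fin_num.
move: (fine _) rw => r rw; suff <- : r = rdot (v x) y by [].
pose S n := rdot (simple_integral mu A (s n) x) y.
have Sr n : `|S n - r| <= a * fine (\int[mu]_l (D n l)%:E).
  have [r' ir' r'r] := is_int_subset mA (D0 n) (iD n).
  have ia := is_intZ a mA ir'.
  have i2 := is_intD mA (iu n A mA) (is_intZ (-1) mA rw).
  have i3 := is_intZ (-1) mA i2.
  have le1 := is_int_le mA i2 ia; have le2 := is_int_le mA i3 ia.
  have aD l : a * D n l = `|u n l - w l| by rewrite /D mulrCA mulfV ?gt_eqF// mulr1.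
  have {}le1 : S n + -1 * r <= a * r'.
    by apply: le1 => l _; rewrite aD mulN1r ler_norm.
  have {}le2 : -1 * (S n + -1 * r) <= a * r'.
    by apply: le2 => l _; rewrite aD !mulN1r -normrN ler_norm.
  apply: (@le_trans _ _ (a * r')); last by rewrite ler_wpM2l// ltW.
  by rewrite ler_norml -mulN1r; apply/andP; split; lra.
have cS : S n @[n --> \oo] --> r.
  apply/subr_cvg0/norm_cvg0P.
  apply: (@cvg_squeeze0 _ _ (fun n => a * fine (\int[mu]_l (D n l)%:E))).
    by move=> n; rewrite normr_ge0 Sr.
  by rewrite -(mulr0 a); apply: cvgM; [exact: cvg_cst|exact: cfD].
apply: cvg_R_uniq cS _.
exact: (trace_norm_cvg_rdot (T := fun n => simple_integral mu A (s n))).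
Qed.

End weak_bochner.

Section bochner_uniqueness.
Context {R : realType} {H : hilbertType R} (e : nat -> H).
Hypotheses (hH : hilbert_basis (hbasis H)) (oe : onb e).

Lemma trace_norm0 : trace_norm (0 : H -> H) = 0%E.
Proof.
apply/eqP; rewrite eq_le (trace_norm_ge0 oe) andbT.
rewrite (hs_trace_norm_le hH oe (c := 0)) //; last first.
  by move=> ph ps _ _ n; rewrite big1// => k _; exact: rdot0l.
exact: hs0.
Qed.

Context {d : measure_display} {L : measurableType d}.
Variable mu : {finite_measure set L -> \bar R}.
Implicit Types g : L -> H -> H.

Lemma bochner_approx_ae g g' s : {ae mu, forall l, g l = g' l} ->
  bochner_approx trace_norm mu g s -> bochner_approx trace_norm mu g' s.
Proof.
move=> gg' [ss cs sg]; split; first exact: ss.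
  by apply: filterS (ae_conj gg' cs) => l [->].
apply: (@squeeze_cvge _ _ _ _ (cst 0%E) _ _ _ _ _ sg); last exact: cvg_cst.
apply: nearW => n; rewrite integral_ge0/=; last by move=> l _; exact: trace_norm_ge0 oe _.
apply: ae_le_lower_integral => [l|l|]; try exact: trace_norm_ge0 oe _.
by apply: filterS gg' => l ->.
Qed.

Lemma bochner_integrable_ae g g' : {ae mu, forall l, g l = g' l} ->
  bochner_integrable trace_norm mu g -> bochner_integrable trace_norm mu g'.
Proof. by move=> gg' [s hs]; exists s; exact: bochner_approx_ae gg' hs. Qed.

Lemma bochner_approx0 : bochner_approx trace_norm mu (fun _ : L => 0 : H -> H)
  (fun _ _ => 0).
Proof.
have n0 : trace_norm (0 - 0 : H -> H) = 0%E by rewrite subr0 trace_norm0.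
split=> [n||].
- have [f0 m0] : simple (fun _ : L => 0 : H -> H) by exact: simple_cst.
  split=> // [l|v v0]; first by rewrite trace_norm0.
  rewrite (_ : _ @^-1` _ = set0) ?measure0//.
  by apply/seteqP; split => // l /= /esym/eqP; rewrite (negbTE v0).
- by apply: aeW => l; rewrite n0; exact: cvg_cst.
- by rewrite n0 integral0; exact: cvg_cst.
Qed.

(** Since 0 is a Bochner integral, [get] returns one; scalar testing shows that it can only be 0. *)
Lemma get_bochner_integral0 g : {ae mu, forall l, g l = 0} ->
  get (is_bochner_integral trace_norm mu setT g) = 0.
Proof.
move=> g0; have g0' : {ae mu, forall l, 0 = g l} by apply: filterS g0 => l ->.
have : is_bochner_integral trace_norm mu setT g 0.
  exists (fun _ _ => 0); first exact: bochner_approx_ae g0' bochner_approx0.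
  rewrite (_ : simple_integral _ _ _ = 0).
    by rewrite subr0 trace_norm0; exact: cvg_cst.
  rewrite /simple_integral fsbig1// => v [_ _ <-].
  by rewrite scaler0.
move=> /getI; move: (get _) => v [s hs cv].
apply/funext => x; apply: rdot_injl => y; rewrite rdot0l.
have [w [w0 iw]] := bochner_weak hH oe x y hs.
have i1 := iw setT v measurableT cv.
apply: (is_int_uniq _ (is_int_cst0 mu measurableT)).
apply: is_int_ae i1 => //.
by apply: filterS (ae_conj g0 w0) => l [-> ->] _; rewrite rdot0l.
Qed.

(** At a point of convergence, [g l] differs from the trace-class operator [s n l] by a trace-class
    one as soon as [n] is large. *)
Lemma bochner_bounded g : bochner_integrable trace_norm mu g ->
  {ae mu, forall l, bounded_op (g l)}.
Proof.
move=> [s [ss cs _]]; apply: filterS cs => l /fine_cvgP[[n _ /(_ n (leqnn n)) h] _].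
have bs : bounded_op (s n l) by apply: trace_class_bounded; case: (ss n) => _ _ ->.
have bd : bounded_op (s n l - g l)%R.
  by apply: trace_class_bounded; rewrite -ge0_fin_numE// (trace_norm_ge0 oe).
have [M1 M10 h1] := bounded_op_ex bs; have [M2 M20 h2] := bounded_op_ex bd.
have E x : g l x = s n l x - (s n l - g l) x by rewrite opprB addrC subrK.
have lin : linear (g l).
  move=> a x y; rewrite !E (linD bs.1) (linZ bs.1) (linD bd.1) (linZ bd.1).
  by rewrite opprD addrACA -scalerBr.
apply/bounded_opP => //; exists (2 * (M1 + M2)); first by rewrite mulr_ge0// addr_ge0.
move=> x; rewrite E (le_trans (sqnB_le _ _))// -mulrA ler_wpM2l// mulrDl.
by rewrite lerD.
Qed.

(** The approximating sequence, and with it the scalar version, may depend on [A]; all versions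
    agree almost everywhere with that of [setT]. *)
Lemma density_weak (nu : set L -> H -> H) g x y : is_density nu mu g ->
  exists w : L -> R, {ae mu, forall l, w l = rdot (g l x) y} /\
    forall A, measurable A -> is_int mu A w (rdot (nu A x) y).
Proof.
move=> [_ h].
have [s0 hs0 cv0] := h setT measurableT.
have [w0 [aew0 iw0]] := bochner_weak hH oe x y hs0.
have [iw _] := iw0 _ _ measurableT cv0.
have mw : measurable_fun setT w0 by apply/measurable_EFinP; exact: measurable_int iw.
exists w0; split=> // A mA.
have [s hs cv] := h A mA; have [w [aew iwA]] := bochner_weak hH oe x y hs.
apply: is_int_ae (iwA _ _ mA cv) => //; first exact: measurable_funS mw.
by apply: filterS (ae_conj aew0 aew) => l [-> ->].
Qed.

Lemma bounded_op_ext (T S : H -> H) : bounded_op T -> bounded_op S ->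
  (forall i j (b : bool), let z := if b then 'i *: e j else e j in
     rdot (T (e i)) z = rdot (S (e i)) z) -> T = S.
Proof.
move=> bT bS h; have TSe i : T (e i) = S (e i).
  apply/eqP; rewrite -subr_eq0; apply/eqP; apply: oe.2 => j.
  rewrite hdotBl; apply/eqP; rewrite subr_eq0; apply/eqP; apply: hdot_eq.
    exact: (h i j false).
  exact: (h i j true).
apply/funext => x; have cx := @onb_expansion _ _ e x oe.
have c1 := bounded_op_cvg bT cx; have c2 := bounded_op_cvg bS cx.
apply: cvg_H_uniq c1 _; apply: eq_cvg_seq c2 => n.
rewrite (lin_sum bT.1) (lin_sum bS.1); apply: eq_bigr => k _.
by rewrite (linZ bT.1) (linZ bS.1) TSe.
Qed.

(** A bounded operator is determined by countably many real entries, each of which is a scalar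
    density of the same set function. *)
Lemma density_unique (nu : set L -> H -> H) (f : L -> H -> H) g : tc_family e f ->
  (forall A, measurable A -> forall x y,
     is_int mu A (fun l => rdot (f l x) y) (rdot (nu A x) y)) ->
  is_density nu mu g -> {ae mu, forall l, g l = f l}.
Proof.
move=> [pf _ mf] hf dg; have bg := bochner_bounded dg.1.
pose z j (b : bool) := if b then 'i *: e j else e j.
have h (k : nat * nat * bool) : {ae mu, forall l,
    rdot (g l (e k.1.1)) (z k.1.2 k.2) = rdot (f l (e k.1.1)) (z k.1.2 k.2)}.
  have [w [aew iw]] := density_weak (e k.1.1) (z k.1.2 k.2) dg.
  have h2 := is_int_ae_eq (mf _ _) iw (fun A mA => hf A mA _ _).
  by apply: filterS (ae_conj aew h2) => l [<- ->].
apply: filterS (ae_conj bg (ae_countable h)) => l [bgl hl].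
apply: bounded_op_ext => //; first exact: (pf l).1.
by move=> i j b; exact: (hl (i, j, b)).
Qed.

End bochner_uniqueness.

(** * Measurability of the spectral data *)

Section weakly_measurable.
Context {R : realType} {d : measure_display} {L : measurableType d}.

Lemma measurable_inv (g : L -> R) : (forall l, 0 <= g l) ->
  measurable_fun setT g -> measurable_fun setT (fun l => (g l)^-1).
Proof.
move=> g0 mg; rewrite (_ : (fun l => _) = fun l => g l `^ (-1)).
  exact: (measurableT_comp (measurable_powR (-1))).
by apply/funext => l; rewrite powR_inv1.
Qed.

Context {H : hilbertType R}.
Implicit Types (f g : L -> H).

(** Weak measurability passes through sums, limits and positive operators; in the separable case
    [pettis] turns it into Borel measurability at the end. *)
Definition wmeas f := forall y, measurable_fun setT (fun l => rdot (f l) y).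

Lemma wmeas_cst x : wmeas (fun=> x).
Proof. by move=> y; exact: measurable_cst. Qed.

Lemma wmeasD f g : wmeas f -> wmeas g -> wmeas (fun l => f l + g l).
Proof. by move=> mf mg y; under eq_fun do rewrite rdotDl; exact: measurable_funD. Qed.

Lemma wmeasZ (c : L -> R[i]) f : measurable_fun setT (fun l => complex.Re (c l)) ->
  measurable_fun setT (fun l => complex.Im (c l)) -> wmeas f ->
  wmeas (fun l => c l *: f l).
Proof.
move=> m1 m2 mf y.
rewrite (_ : (fun l => _) = fun l => complex.Re (c l) * rdot (f l) y -
    complex.Im (c l) * rdot (f l) ('i *: y)).
  by apply: measurable_funB; exact: measurable_funM.
apply/funext => l; rewrite /rdot hdotZl hdotZr; case: (c l) => a b.
by case: (hdot _ _) => u v /=; ring.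
Qed.

Lemma wmeasZr (c : L -> R) f : measurable_fun setT c -> wmeas f ->
  wmeas (fun l => (c l)%:C *: f l).
Proof. by move=> mc; apply: wmeasZ => //=; exact: measurable_cst. Qed.

Lemma wmeasB f g : wmeas f -> wmeas g -> wmeas (fun l => f l - g l).
Proof. by move=> mf mg y; under eq_fun do rewrite rdotBl; exact: measurable_funB. Qed.

Lemma wmeas_lim (u : nat -> L -> H) f : (forall n, wmeas (u n)) ->
  (forall l, u n l @[n --> \oo] --> f l) -> wmeas f.
Proof.
move=> mu cu y; apply: (@measurable_lim _ _ _ (fun n l => rdot (u n l) y)).
  by move=> n; exact: mu.
by move=> l; exact: (cvg_rdotl (cu l)).
Qed.

Lemma wmeas_sum n (u : nat -> L -> H) : (forall n, wmeas (u n)) ->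
  wmeas (fun l => \sum_(0 <= k < n) u k l).
Proof.
move=> mu y; under eq_fun do rewrite rdot_suml.
by apply: measurable_sum_nat => k; exact: mu.
Qed.

Lemma wmeas_if (b : L -> bool) f g : measurable_fun setT b -> wmeas f -> wmeas g ->
  wmeas (fun l => if b l then f l else g l).
Proof.
move=> mb mf mg y; under eq_fun do rewrite (fun_if (fun z => rdot z y)).
exact: measurable_fun_ifT.
Qed.

Variables (e : nat -> H) (oe : onb e).

Lemma measurable_sqn f : wmeas f -> measurable_fun setT (fun l => sqn (f l)).
Proof.
move=> mf; apply: (@measurable_lim _ _ _
  (fun n l => \sum_(0 <= k < n) csq (hdot (f l) (e k)))); last first.
  by move=> l; exact: onb_parseval.
move=> n; apply: measurable_sum_nat => k.
under eq_fun do rewrite hdotE /csq/=.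
by apply: measurable_funD; apply: measurable_funX; exact: mf.
Qed.

Lemma measurable_rdot f g : wmeas f -> wmeas g ->
  measurable_fun setT (fun l => rdot (f l) (g l)).
Proof.
move=> mf mg.
rewrite (_ : (fun l => _) = fun l => (sqn (f l + g l) - sqn (f l) - sqn (g l)) / 2).
  apply: measurable_funM; last exact: measurable_cst.
  apply: measurable_funB; last exact: measurable_sqn.
  by apply: measurable_funB; apply: measurable_sqn => //; exact: wmeasD.
by apply/funext => l; rewrite sqnD; field.
Qed.

Lemma wmeas_tensor f x : wmeas f -> wmeas (fun l => tensor (f l) (f l) x).
Proof.
have E l : complex.Re (hdot x (f l)) = rdot x (f l) by [].
have E2 l : complex.Im (hdot x (f l)) = - rdot ('i *: x) (f l).
  by rewrite hdotE/= rdotiZl opprK.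
move=> mf; apply: wmeasZ => //.
  by under eq_fun do rewrite E; apply: measurable_rdot => //; exact: wmeas_cst.
under eq_fun do rewrite E2; apply: measurableT_comp => //.
by apply: measurable_rdot => //; exact: wmeas_cst.
Qed.

Lemma wmeas_app (A : L -> H -> H) f : (forall l, positive_op (A l)) ->
  (forall x, wmeas (fun l => A l x)) -> wmeas f -> wmeas (fun l => A l (f l)).
Proof.
move=> pA mA mf y; under eq_fun do rewrite (positive_rdotC _ _ (pA _)).
exact: measurable_rdot.
Qed.

Lemma wmeas_power_lim (A : L -> H -> H) x : (forall l, positive_op (A l)) ->
  (forall l, rdot_bounded (A l) 1) ->
  (forall x, wmeas (fun l => A l x)) -> wmeas (fun l => power_lim (A l) x).
Proof.
move=> pA bA mA; apply: (@wmeas_lim (fun n l => iter n (A l) x)).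
  elim=> [|n ih]; first exact: wmeas_cst.
  by under eq_fun do rewrite iterS; exact: wmeas_app.
by move=> l; exact: power_lim_cvg.
Qed.

Lemma wmeas_first_lim (u : nat -> L -> H) : (forall n, wmeas (u n)) ->
  wmeas (fun l => first_lim (u ^~ l)).
Proof.
move=> mu; apply: (@wmeas_lim (fun n l => first_nz (u ^~ l) n)); last first.
  by move=> l; exact: first_lim_cvg.
elim=> [|n ih]; first exact: wmeas_cst.
apply: wmeas_if => //; under eq_fun do rewrite -sqn_eq0.
by apply: measurable_fun_eqr; [exact: measurable_sqn|exact: measurable_cst].
Qed.

Lemma wmeas_normalize f : wmeas f -> wmeas (fun l => normalize (f l)).
Proof.
move=> mf; apply: wmeasZr => //; apply: measurable_inv.
  by move=> l; exact: sqrtr_ge0.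
apply: (measurableT_comp (continuous_measurable_fun (@sqrt_continuous R))).
exact: measurable_sqn.
Qed.

End weakly_measurable.

Section dense_sequences.
Context {R : realType} {H : hilbertType R}.

Definition dense_seq (z : nat -> H) :=
  forall x (r : R), 0 < r -> exists n, sqn (x - z n) < r.

Lemma separable_dense_seq : separable_space H -> exists z, dense_seq z.
Proof.
move=> [D /countable_injP[k kinj] dD].
(* Indices outside the image of [k] receive arbitrary vectors, which is harmless for density. *)
exists (fun n => get [set z | D z /\ k z = n]) => x r r0.
have [z Dz xz] := dense_sqn x dD r0; exists (k z).
have [Dy ky] : [set z' | D z' /\ k z' = k z] (get [set z' | D z' /\ k z' = k z]).
  exact: (@getI _ _ z (conj Dz erefl)).
have -> // : get [set z' | D z' /\ k z' = k z] = z.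
by apply: kinj; [exact: mem_set|exact: mem_set|].
Qed.

Variables (z : nat -> H) (dz : dense_seq z).

Lemma dense_seq_cvg (x : H) : exists k : nat -> nat, z (k n) @[n --> \oo] --> x.
Proof.
have h n : exists k, sqn (x - z k) < n.+1%:R^-1.
  by apply: dz; rewrite invr_gt0.
have [k hk] := choice h; exists k => //; apply/cvg_sqnP.
apply: (@cvg_squeeze0 _ _ (fun n => n.+1%:R^-1)); last exact: cvg_harmonic.
by move=> n; rewrite sqn_ge0 sqnBC ltW.
Qed.

(** The form of [A] is the squared norm of its square root, hence continuous, so a dense sequence
    sees the whole supremum. It is written with [sups] in order to apply [measurable_fun_sups]. *)
Lemma top_dense (A : H -> H) : positive_op A ->
  top A = sups (fun n => rdot (A (z n)) (z n) / sqn (z n)) 0.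
Proof.
move=> pA; set q := fun n => _.
have q_le n : q n <= top A.
  by apply: sup_upper_bound; [exact: top_has_sup|exists (z n)].
have hq : has_sup (range q).
  by split; [exists (q 0%N), 0%N|exists (top A) => _ [n _ <-]].
have E : sups q 0 = sup (range q).
  by rewrite /sups /sdrop; congr sup; apply/seteqP; split => _ [n _ <-]; exists n.
have q0 n : 0 <= q n by rewrite divr_ge0 ?sqn_ge0// positive_ge0.
rewrite E; apply/eqP; rewrite eq_le; apply/andP; split; last first.
  by apply: sup_le_ub; [exists (q 0%N), 0%N|move=> _ [n _ <-]].
have s0 : 0 <= sup (range q).
  by apply: (le_trans (q0 0%N)); apply: sup_upper_bound => //; exists 0%N.
apply: top_le => // x.
have [k kx] := dense_seq_cvg x.
have [S pS SA] := positive_sqrt pA.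
have Aq y : rdot (A y) y = sqn (S y) by rewrite -SA /= (positive_rdotC _ _ pS).
rewrite Aq; apply: (@le_lim_seq _ (fun n => sqn (S (z (k n))))
  (fun n => sup (range q) * sqn (z (k n)))).
- by apply: cvg_sqn; exact: bounded_op_cvg pS.1 kx.
- by apply: cvgM; [exact: cvg_cst|exact: cvg_sqn].
- move=> n; rewrite -Aq; have [->|z0] := eqVneq (z (k n)) 0.
    by rewrite rdot0r sqn0 mulr0.
  by rewrite -ler_pdivrMr ?sqn_gt0//; apply: sup_upper_bound => //; exists (k n).
Qed.

End dense_sequences.

Section pettis.
Context {R : realType} {d : measure_display} {L : measurableType d}.
Context {H : hilbertType R}.

(** An open set is the union of the balls around the [z n] of squared radius [1 / m.+1] that it
    contains, as far as values of [f] are concerned. Only these values have to be approximated,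
    which allows scalar functions to use the sequence [hdot x (z n)]. *)
Lemma pettis (e : nat -> H) (f : L -> H) (z : nat -> H) : onb e ->
  (forall l (r : R), 0 < r -> exists n, sqn (f l - z n) < r) ->
  wmeas f -> borel_measurable f.
Proof.
move=> oe dz mf; rewrite /borel_measurable.
apply: (@measurability _ _ L (g_sigma_algebraType (@open H)) setT f (@open H)) => //
  _ [U oU <-].
pose B n m := [set l | sqn (f l - z n) < m.+1%:R^-1].
pose I n := [set m : nat | forall y, sqn (y - z n) < m.+1%:R^-1 -> U y].
have mB n m : measurable (B n m).
  rewrite -[B n m]setTI; apply: measurable_fun_ltr => //.
  by apply: (measurable_sqn oe); apply: wmeasB => //; exact: wmeas_cst.
rewrite setTI (_ : f @^-1` U = \bigcup_n \bigcup_(m in I n) B n m).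
  by apply: bigcup_measurable => n _; apply: bigcup_measurable => m _; exact: mB.
apply/seteqP; split=> [l Ul|l [n _ [m Im /Im]]//].
have [r r0 hr] : exists2 r : R, 0 < r & forall y, sqn (f l - y) < r -> U y.
  have /nbhs_ballP[eps /= eps0 hU] : nbhs (f l) U by exact: open_nbhs_nbhs.
  move: eps eps0 hU => [a b]; rewrite ltcE/= => /andP[/eqP -> a0] hU.
  exists (a ^+ 2); first by rewrite exprn_gt0.
  move=> y fy; apply: hU; rewrite -ball_normE/= normE ltcR.
  by rewrite -(ltr_pXn2r (n := 2)) ?nnegrE ?sqrtr_ge0 ?(ltW a0)// sqr_sqrtr ?sqn_ge0.
(* Two squared distances below [1 / m.+1] add up, by [sqnB_le], to one below [4 / m.+1]. *)
have [m hm] : exists m : nat, 4 * m.+1%:R^-1 < r.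
  exists (Num.truncn (4 / r)); rewrite ltr_pdivrMr// mulrC -ltr_pdivrMr//.
  exact: truncnS_gt.
have [|n hn] := dz l m.+1%:R^-1; first by rewrite invr_gt0.
exists n => //; exists m => // y hy; apply: hr; apply: le_lt_trans hm.
rewrite (_ : f l - y = (f l - z n) - (y - z n)); last by rewrite opprB addrA subrK.
rewrite (le_trans (sqnB_le _ _))//.
rewrite (_ : 4 * _ = 2 * (m.+1%:R^-1 + m.+1%:R^-1)); last by ring.
by rewrite ler_wpM2l// lerD// ltW.
Qed.

End pettis.

Section spectral_measurability.
Context {R : realType} {d : measure_display} {L : measurableType d}.
Context {H : hilbertType R} (e : nat -> H) (oe : onb e).
Variables (z : nat -> H) (dz : dense_seq z).
Variables (f : L -> H -> H) (ff : tc_family e f).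

Let pf l : positive_op (f l). Proof. by case: ff. Qed.
Let ft l := family_trace ff l.
Let A n l := (deflation e (f l) n).1.
Let Q n l := (deflation e (f l) n).2.
Let pA n l : positive_op (A n l).
Proof. by case: (deflation_deflated (pf l) (ft l) n). Qed.

Lemma measurable_top (B : L -> H -> H) : (forall l, positive_op (B l)) ->
  (forall x, wmeas (fun l => B l x)) -> measurable_fun setT (fun l => top (B l)).
Proof.
move=> pB mB; under eq_fun do rewrite (top_dense dz (pB _)).
apply: measurable_fun_sups.
  move=> l _; exists (top (B l)) => _ [n _ <-].
  by apply: sup_upper_bound; [exact: top_has_sup|exists (z n)].
move=> n; apply: measurable_funM; last exact: measurable_cst.
exact: mB.
Qed.

Let step n : (forall x, wmeas (fun l => A n l x)) ->
  (forall x, wmeas (fun l => Q n l x)) ->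
  wmeas (fun l => eigenvec e (f l) n).
Proof.
move=> mA mQ; apply: (wmeas_normalize oe).
apply: (@wmeas_first_lim _ _ _ _ _ oe
  (fun j l => power_lim (normal_op (A n l) (Q n l)) (e j))) => j.
have df l := deflation_deflated (pf l) (ft l) n.
apply: (wmeas_power_lim oe).
- by move=> l; exact: normal_op_positive (df l).
- by move=> l; exact: normal_op_bounded (df l).
move=> x; have mt := measurable_top (pA n) mA.
rewrite /normal_op; under eq_fun do rewrite (fun_if (fun T : H -> H => T x)).
apply: wmeas_if; first by apply: measurable_fun_ltr => //; exact: measurable_cst.
  apply: wmeasZr => //; apply: measurable_inv => // l; exact: top_ge0.
exact: mQ.
Qed.

Lemma measurable_deflation n : (forall x, wmeas (fun l => A n l x)) /\
  (forall x, wmeas (fun l => Q n l x)).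
Proof.
elim: n => [|n [mA mQ]].
  by split=> x; [case: ff => _ _ /(_ x)|exact: wmeas_cst].
have mv := step mA mQ.
split=> x; rewrite /A /Q.
  under eq_fun do rewrite deflationS/=.
  apply: wmeasB; first exact: mA.
  by apply: wmeasZr; [exact: (measurable_top (pA n) mA)|exact: (wmeas_tensor oe)].
under eq_fun do rewrite deflationS/=.
apply: wmeasB; first exact: mQ.
by apply: wmeasZr; [exact: measurable_cst|exact: (wmeas_tensor oe)].
Qed.

Lemma measurable_eigval n : measurable_fun setT (fun l => eigval e (f l) n).
Proof. exact: measurable_top (pA n) (measurable_deflation n).1. Qed.

Lemma wmeas_eigenvec n : wmeas (fun l => eigenvec e (f l) n).
Proof. by have [h1 h2] := measurable_deflation n; exact: step. Qed.

End spectral_measurability.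

(** * The spectral decomposition of the density *)

Lemma nonneg_change_of_measure {R : realType} {d : measure_display} {L : measurableType d}
    (m : {finite_measure set L -> \bar R}) (mu : {sigma_finite_measure set L -> \bar R}) :
  m `<< mu -> exists r : L -> R, [/\ forall l, 0 <= r l, measurable_fun setT r &
    forall A g c, measurable A -> (forall l, 0 <= g l) -> is_int m A g c ->
      is_int mu A (fun l => r l * g l) c].
Proof.
move=> mm; pose q := Radon_Nikodym_SigmaFinite.f m mu.
have q0 l : (0 <= q l)%E by exact: Radon_Nikodym_SigmaFinite.f_ge0.
have qE l : (fine (q l))%:E = q l.
  by rewrite fineK//; exact: Radon_Nikodym_SigmaFinite.f_fin_num.
exists (fine \o q); split.
- by move=> l; exact: fine_ge0.
- apply: measurableT_comp => //.
  exact: measurable_int (Radon_Nikodym_SigmaFinite.f_integrable mm).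
move=> A g c mA g0 [ig eg].
have E l : (EFin \o (fun l => (fine \o q) l * g l)) l = ((g l)%:E * q l)%E.
  by rewrite /= EFinM qE muleC.
split; last first.
  under eq_integral do rewrite EFinM /= qE muleC.
  rewrite (@Radon_Nikodym_SigmaFinite.change_of_variables _ _ _ m mu mm (EFin \o g))//.
  exact: measurable_int ig.
have := @Radon_Nikodym_SigmaFinite.integrableM _ _ _ m mu mm (EFin \o g) A.
move=> /(_ _ mA ig) h; by apply: eq_integrable (h _) => // l _; rewrite E.
Qed.

Section scaled_family.
Context {R : realType} {H : hilbertType R} (e : nat -> H).
Hypothesis oe : onb e.

Lemma positive_scale (c : R) (T : H -> H) : 0 <= c -> positive_op T ->
  positive_op (fun x => c%:C *: T x).
Proof.
move=> c0 pT; have lT := positive_linear pT; have [M M0 TM] := bounded_op_ex pT.1.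
apply: (@positive_opP _ _ _ (c ^+ 2 * M)).
- by move=> a x y; rewrite (linD lT) (linZ lT) scalerDr !scalerA [c%:C * _]mulrC.
- by move=> x y; rewrite rdotZl rdotZr (is_adjoint_rdot (positive_sym pT)).
- by move=> x; rewrite rdotZl mulr_ge0// positive_ge0.
- by rewrite mulr_ge0// sqr_ge0.
- by move=> x; rewrite sqnZr -mulrA ler_wpM2l// sqr_ge0.
Qed.

Lemma finite_trace_scale (c : R) (T : H -> H) M : 0 <= c -> finite_trace e T M ->
  finite_trace e (fun x => c%:C *: T x) (c * M).
Proof.
move=> c0 TM n; under eq_bigr do rewrite rdotZl.
by rewrite -mulr_sumr ler_wpM2l.
Qed.

Lemma rtr_scale (c : R) (T : H -> H) M : 0 <= c -> positive_op T -> finite_trace e T M ->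
  rtr e (fun x => c%:C *: T x) = c * rtr e T.
Proof.
move=> c0 pT TM.
have h1 := rtr_cvg (positive_scale c0 pT) (finite_trace_scale c0 TM).
apply: cvg_R_uniq h1 _; under eq_fun do (under eq_bigr do rewrite rdotZl).
under eq_fun do rewrite -mulr_sumr.
by apply: cvgM; [exact: cvg_cst|exact: rtr_cvg pT TM].
Qed.

Context {d : measure_display} {L : measurableType d}.
Variables (r : L -> R) (f : L -> H -> H).
Hypotheses (r0 : forall l, 0 <= r l) (mr : measurable_fun setT r) (ff : tc_family e f).

Lemma tc_family_scale : tc_family e (fun l x => (r l)%:C *: f l x).
Proof.
case: (ff) => pf tf mf; split=> [l|l|x y]; first exact: positive_scale.
  by have [M fM] := tf l; exists (r l * M); exact: finite_trace_scale.
by under eq_fun do rewrite rdotZl; exact: measurable_funM.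
Qed.

Hypothesis hH : hilbert_basis (hbasis H).
Variables (m : {finite_measure set L -> \bar R}) (mu : {sigma_finite_measure set L -> \bar R}).
Hypothesis rm : forall A g c, measurable A -> (forall l, 0 <= g l) -> is_int m A g c ->
      is_int mu A (fun l => r l * g l) c.
Hypothesis fm : m.-integrable setT (EFin \o (fun l => rtr e (f l))).
Variable nu : set L -> H -> H.
Hypothesis nuf : forall A, measurable A -> forall x y,
  is_int m A (fun l => rdot (f l x) y) (rdot (nu A x) y).
Hypothesis hsnu : forall A, measurable A -> hs e (nu A).

Lemma is_density_scale : is_density nu mu (fun l x => (r l)%:C *: f l x).
Proof.
have pf l : positive_op (f l) by case: ff.
have int_rtr A : measurable A -> exists c, is_int m A (fun l => rtr e (f l)) c.
  move=> mA; have iA : m.-integrable A (EFin \o (fun l => rtr e (f l))).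
    by apply: integrableS fm.
  exists (fine (\int[m]_(l in A) (rtr e (f l))%:E)); split=> //.
  by rewrite fineK//; exact: integrable_fin_num.
apply: (is_density_family hH oe tc_family_scale) => //.
  have [c /(rm measurableT (family_rtr_ge0 ff))[h _]] := int_rtr _ measurableT.
  apply: eq_integrable h => // l _ /=; congr EFin.
  by rewrite (rtr_scale (r0 l) (pf l) (family_trace ff l)).
move=> A mA x y; have [c ic] := int_rtr A mA.
(* The change of measure is stated for nonnegative functions: the entry is shifted by
   [k * rtr e (f l)], which dominates its absolute value, and the shift is subtracted afterwards. *)
pose k := (sqn x + sqn y) / 2; have k0 : 0 <= k by rewrite divr_ge0// addr_ge0 ?sqn_ge0.
have ik := is_intZ k mA ic.
have h1 := rm mA (fun l => mulr_ge0 k0 (family_rtr_ge0 ff l)) ik.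
have i2 := is_intD mA (nuf mA x y) ik.
have h2 := rm mA _ i2.
have {}h2 : is_int mu A (fun l => r l * (rdot (f l x) y + k * rtr e (f l)))
    (rdot (nu A x) y + k * c).
  apply: h2 => l.
  have := rtr_rdot_le oe (pf l) (family_trace ff l) x y.
  by rewrite -/k mulrC => /ler_normlP[]; lra.
have := is_intD mA h2 (is_intZ (-1) mA h1).
rewrite mulN1r addrK; congr is_int; apply/funext => l.
by rewrite rdotZl; ring.
Qed.

End scaled_family.

(** * Strong sums of rank-one projections *)

Section projections.
Context {R : realType} {H : hilbertType R} (u : nat -> H) (ou : ons u).

Lemma ons_projection : exists P : H -> H,
  [/\ forall x, \sum_(0 <= k < n) tensor (u k) (u k) x @[n --> \oo] --> P x,
      positive_op P, sqn_bounded P 1 &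
      forall x j, hdot (P x) (u j) = hdot x (u j)].
Proof.
have h x : exists y : H, \sum_(0 <= k < n) hdot x (u k) *: u k @[n --> \oo] --> y.
  by apply: (ons_series_cvg ou) => n; exact: ons_bessel.
have [P cP] := choice h.
have lP : linear P.
  move=> a x y; apply: cvg_H_uniq (cP _) _.
  apply: (eq_cvg_seq (f := fun n => a *: (\sum_(0 <= k < n) hdot x (u k) *: u k) +
     \sum_(0 <= k < n) hdot y (u k) *: u k)).
    move=> n; rewrite scaler_sumr -big_split/=; apply: eq_bigr => k _.
    by rewrite hdotDl hdotZl scalerDl scalerA.
  apply: cvgD; last exact: cP.
  by apply: cvgZr; exact: cP.
have P1 : sqn_bounded P 1.
  move=> x; rewrite mul1r; apply: le_lim_seq (cvg_sqn (cP x)) (cvg_cst _) _ => n.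
  exact: le_trans (ons_sqn_comb_le _ _ _ ou) (ons_bessel _ _ ou).
have cPr x y : \sum_(0 <= k < n) rdot (hdot x (u k) *: u k) y @[n --> \oo] --> rdot (P x) y.
  apply: eq_cvg_seq (cvg_rdotl (y := y) (cP x)) => n.
  by rewrite rdot_suml.
have sw x y k : rdot (hdot x (u k) *: u k) y = rdot x (hdot y (u k) *: u k).
  exact: is_adjoint_rdot (tensor_adjoint (u k) (u k)) x y.
exists P; split=> //.
  apply: (positive_opP lP _ _ ler01 P1).
    move=> x y; rewrite [RHS]rdotC; apply: cvg_R_uniq (cPr x y) _.
    apply: eq_cvg_seq (cPr y x) => n; apply: eq_bigr => k _.
    by rewrite sw rdotC.
  move=> x; apply: le_lim_seq (cvg_cst _) (cPr x x) _ => n.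
  by apply: sumr_ge0 => k _; rewrite [X in _ <= X]tensor_rdot csq_ge0.
move=> x j; rewrite (ons_series_coef j ou (cP x)).
have [->|] := eqVneq (u j) 0; first by rewrite hdot0r mul0r.
by rewrite mulr1.
Qed.

End projections.

Section spectral_expansion.
Context {R : realType} {H : hilbertType R} (e : nat -> H).
Variables (T : H -> H) (M : R).
Hypotheses (oe : onb e) (pT : positive_op T) (TM : finite_trace e T M).
Notation sg := (eigval e T).
Notation ph := (eigenvec e T).

Lemma eigenvec_eq0 m n : (m <= n)%N -> ph m = 0 -> ph n = 0.
Proof.
move=> mn m0; rewrite (eigenvec0_expansion oe pT TM (ph n) m0) big_nat_cond big1//.
move=> k /andP[/andP[_ km] _]; rewrite (eigenvec_ons pT TM) gtn_eqF ?scale0r//.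
exact: leq_trans mn.
Qed.

(** Counting in both directions: if [ph n] is nonzero, [n.+1] orthonormal vectors fit into the
    dimension. If it is zero, [ph] is complete with at most [n] nonzero vectors, too few when [n] is
    below [N]. *)
Lemma eigenvec_neq0 N n : (forall n, (e n != 0) = below N n) ->
  (ph n != 0) = below N n.
Proof.
move=> eN; have op := eigenvec_ons pT TM.
have be i : (i <= n)%N -> below N n -> below N i.
  by case: N {eN} => //= k ik; exact: leq_ltn_trans.
apply/idP/idP => [pn|bn].
  case: N eN be => // k eN _ /=; rewrite ltnNge; apply/negP => kn.
  have ek j : (k <= j)%N -> e j = 0.
    by move=> kj; apply/eqP; rewrite -[_ == _]negbK eN /= -leqNgt.
  have := @ons_dim_le _ _ e ph k n.+1 oe op ek.
  rewrite (ons_count (n := n.+1) op) ?ler_nat ?ltnNge ?kn// => i ik.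
  by apply: contra_neq pn; exact: eigenvec_eq0.
apply/negP => /eqP p0.
have cp : onb ph.
  split=> // x xp; rewrite (eigenvec0_expansion oe pT TM x p0) big1// => k _.
  by rewrite xp scale0r.
have := @ons_dim_le _ _ ph e n n.+1 cp oe.1 (fun j nj => eigenvec_eq0 nj p0).
rewrite (ons_count (n := n.+1) oe.1); last by move=> k kn; rewrite eN be.
by rewrite ler_nat ltnn.
Qed.

(** The defect [w] is orthogonal to all eigenvectors, so [T w = 0]; hence [w] is orthogonal to
    [T y], and also to [P (T y)]. *)
Lemma eigenvec_range P :
  (forall x, \sum_(0 <= k < n) tensor (ph k) (ph k) x @[n --> \oo] --> P x) ->
  (forall x j, hdot (P x) (ph j) = hdot x (ph j)) ->
  forall y, P (T y) = T y.
Proof.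
move=> cP Pu y; pose w := T y - P (T y).
have wp k : hdot w (ph k) = 0 by rewrite /w hdotBl Pu subrr.
have Tw : T w = 0 := eigenvec_complete oe pT TM wp.
have Pw : rdot (P (T y)) w = 0.
  apply: cvg_R_uniq (cvg_rdotl (y := w) (cP (T y))) _.
  apply: (eq_cvg_seq (f := fun=> 0)); last exact: cvg_cst.
  move=> n; rewrite rdot_suml big1// => k _.
  by rewrite rdotC /rdot /tensor hdotZr wp mulr0.
apply/esym/eqP; rewrite -subr_eq0 -/w -sqn_eq0; apply/eqP.
by rewrite /sqn {1}/w rdotBl Pw subr0 (is_adjoint_rdot (positive_sym pT)) Tw rdot0r.
Qed.

Hypothesis hH : hilbert_basis (hbasis H).

Lemma trace_norm_tensor (c : R) (x : H) : 0 <= c ->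
  (trace_norm (c%:C *: tensor x x) <= (c * sqn x)%:E)%E.
Proof.
move=> c0; have pt : positive_op (tensor x x).
  apply: (@positive_opP _ _ _ (sqn x * sqn x)).
  - exact: tensor_linear.
  - exact: is_adjoint_rdot (tensor_adjoint x x).
  - by move=> y; rewrite tensor_rdot csq_ge0.
  - by rewrite mulr_ge0// sqn_ge0.
  - exact: tensor_sqn_bounded.
have ft : finite_trace e (tensor x x) (sqn x).
  move=> n; under eq_bigr do rewrite tensor_rdot hdotC csqJ.
  exact: ons_bessel oe.1.
have ps := positive_scale c0 pt; have fs := finite_trace_scale c0 ft.
exact: (hs_trace_norm_le hH oe (hs_positive oe ps fs) (nuclear_le_positive oe ps fs)).
Qed.

(** In the trace of the n-th deflation, the first [J] diagonal terms are at most [sg n] and the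
    others at most those of [T], with sum at most [t J]. Choosing [J] first and then [n] makes both
    parts small. *)
Lemma deflation_trace_norm (c : R) : 0 <= c ->
  trace_norm (fun x => c%:C *: (deflation e T n).1 x) @[n --> \oo] --> (0 : \bar R).
Proof.
move=> c0; pose t J := rtr e T - \sum_(0 <= j < J) rdot (T (e j)) (e j).
have pA n : positive_op (deflation e T n).1.
  by case: (deflation_deflated pT TM n).
have AT n x : rdot ((deflation e T n).1 x) x <= rdot (T x) x.
  rewrite deflationE rdotBl rdot_suml gerBl; apply: sumr_ge0 => k _.
  by rewrite rdotZl tensor_rdot mulr_ge0 ?csq_ge0// (eigval_ge0 pT TM).
have TR := rtr_finite_trace pT TM.
have b n J : finite_trace e (deflation e T n).1 (J%:R * sg n + t J).
  move=> K; have s0 := eigval_ge0 pT TM n.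
  have h0 j : 0 <= rdot ((deflation e T n).1 (e j)) (e j) by exact: positive_ge0.
  rewrite (@le_trans _ _ (\sum_(0 <= j < J + K) rdot ((deflation e T n).1 (e j)) (e j)))//.
    by rewrite addnC (@big_cat_nat _ _ _ K _ (K + J))//= ?leq_addr// lerDl sumr_ge0.
  rewrite (@big_cat_nat _ _ _ J)//= ?leq_addr// lerD//.
    apply: (@le_trans _ _ (\sum_(0 <= j < J) sg n)).
      apply: ler_sum => j _; rewrite (le_trans (top_bounded (pA n) _))// ler_piMr//.
      exact: ons_sqn_le1 oe.1.
    by rewrite sumr_const_nat subn0 mulr_natl.
  rewrite /t lerBrDl (le_trans _ (TR (J + K)%N))//.
  rewrite (@big_cat_nat _ _ _ J 0%N (J + K))//= ?leq_addr// lerD2l.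
  by apply: ler_sum => j _; exact: AT.
have tn n J : (trace_norm (fun x => c%:C *: (deflation e T n).1 x)
    <= (c * (J%:R * sg n + t J))%:E)%E.
  have ps := positive_scale c0 (pA n); have fs := finite_trace_scale c0 (b n J).
  exact: (hs_trace_norm_le hH oe (hs_positive oe ps fs) (nuclear_le_positive oe ps fs)).
have n0 (S : H -> H) : (0 <= trace_norm S)%E := trace_norm_ge0 oe S.
pose a n := fine (trace_norm (fun x => c%:C *: (deflation e T n).1 x)).
have aE n : trace_norm (fun x => c%:C *: (deflation e T n).1 x) = (a n)%:E.
  by rewrite fineK// ge0_fin_numE// (le_lt_trans (tn n 0%N))// ltry.
under eq_fun do rewrite aE; apply: cvg_EFin; first exact: nearW.
have a0 n : 0 <= a n by exact: fine_ge0.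
have at_ n J : a n <= c * (J%:R * sg n + t J) by rewrite -lee_fin -aE.
apply: (@cvg_eps0 _ a) => // eps eps0.
have ct : t J @[J --> \oo] --> (0 : R).
  rewrite -(subrr (rtr e T)); apply: cvgB; first exact: cvg_cst.
  exact: rtr_cvg pT TM.
have c1 : 0 < c + 1 by rewrite ltr_wpDl.
have [J hJ] := eps_cvg0 ct (divr_gt0 (divr_gt0 eps0 c1) (ltr0Sn _ 1)).
have cs : J%:R * sg n @[n --> \oo] --> (0 : R).
  rewrite -(mulr0 J%:R); apply: cvgM; first exact: cvg_cst.
  exact: eigval_cvg0 oe pT TM.
have [n1 hn1] := eps_cvg0 cs (divr_gt0 (divr_gt0 eps0 c1) (ltr0Sn _ 1)).
exists n1 => n n1n; apply: le_trans (at_ n J) _.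
have h1 := hJ J (leqnn J); have h2 := hn1 n n1n.
have h3 : J%:R * sg n + t J <= eps / (c + 1).
  by rewrite [leRHS](splitr); exact: lerD.
apply: (@le_trans _ _ (c * (eps / (c + 1)))); first by rewrite ler_wpM2l.
rewrite mulrCA ler_piMr ?(ltW eps0)// ler_pdivrMr// mul1r lerDl//.
Qed.

End spectral_expansion.

(** * Gramian densities as compressions of the density *)

Section compressions.
Context {R : realType} {H G : hilbertType R} (e : nat -> H) (u : nat -> G).
Hypotheses (oe : onb e) (ou : onb u) (hH : hilbert_basis (hbasis H)).

Lemma is_adjoint_adjoint (Q : H -> G) : bounded_op Q -> is_adjoint Q (adjoint Q).
Proof. by move=> /(adjoint_exists oe)[S aS]; rewrite (adjointE aS). Qed.

(** The two roots meet in the middle and multiply to [T], which removes the root chosen by [get]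
    from the Gramian densities. *)
Lemma mul_sqrt_adjoint (Q Q' : H -> G) T : positive_op T -> bounded_op Q' ->
  (Q \o sqrt_op T) \o adjoint (Q' \o sqrt_op T) = Q \o T \o adjoint Q'.
Proof.
move=> pT bQ'; have [pS ST] := sqrt_opP pT.
rewrite (adjointE (is_adjoint_comp (positive_sym pS) (is_adjoint_adjoint bQ'))).
by rewrite -[in RHS]ST.
Qed.

Variables (Q : H -> G) (K : R) (T : H -> H) (M : R).
Hypotheses (lQ : linear Q) (K0 : 0 <= K) (QK : sqn_bounded Q K).
Hypotheses (pT : positive_op T) (TM : finite_trace e T M).

Let bQ : bounded_op Q. Proof. by apply/bounded_opP => //; exists K. Qed.
Let aQ := is_adjoint_adjoint bQ.

Lemma compression_positive : positive_op (Q \o T \o adjoint Q).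
Proof.
have [B B0 TB] := bounded_op_ex pT.1; have lT := positive_linear pT.
have la := is_adjoint_linear (is_adjointC aQ).
apply: (@positive_opP _ _ _ (K * (B * K))).
- by move=> a x y /=; rewrite (linD la) (linZ la) (linD lT) (linZ lT) lQ.
- move=> x y /=; rewrite (is_adjoint_rdot aQ) (is_adjoint_rdot (positive_sym pT)).
  by rewrite rdotC -(is_adjoint_rdot aQ) rdotC.
- by move=> x /=; rewrite (is_adjoint_rdot aQ) positive_ge0.
- by rewrite !mulr_ge0.
move=> x /=; rewrite (le_trans (QK _))// -mulrA ler_wpM2l// (le_trans (TB _))//.
by rewrite -mulrA ler_wpM2l// (is_adjoint_bounded K0 aQ).
Qed.

Let sqrt_series : (\sum_(0 <= j <oo) (sqn (Q (sqrt_op T (e j))))%:E <= (K * M)%:E)%E.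
Proof.
have [pS ST] := sqrt_opP pT.
apply/nneseries_le => [k|n]; first exact: sqn_ge0.
apply: (@le_trans _ _ (\sum_(0 <= j < n) K * rdot (T (e j)) (e j))).
  apply: ler_sum => j _; apply: le_trans (QK _) _; rewrite ler_wpM2l//.
  by rewrite -[X in rdot (X _)]ST /= (is_adjoint_rdot (positive_sym pS)).
by rewrite -mulr_sumr ler_wpM2l.
Qed.

Lemma mul_sqrt_hilbert_schmidt : hilbert_schmidt (Q \o sqrt_op T).
Proof.
have [pS ST] := sqrt_opP pT; have [B B0 SB] := bounded_op_ex pS.1.
have bQS : bounded_op (Q \o sqrt_op T).
  have lS := positive_linear pS.
  apply/bounded_opP; first by move=> a x y /=; rewrite lS lQ.
  exists (K * B); first by rewrite mulr_ge0.
  by move=> x; rewrite (le_trans (QK _))// -mulrA ler_wpM2l.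
split=> //; rewrite (trace_pos_sqn hH oe ou bQS).
exact: le_lt_trans sqrt_series (ltry _).
Qed.

(** This trace is the squared Hilbert-Schmidt norm of the adjoint of [Q \o sqrt_op T], the same as
    that of the operator itself. *)
Lemma compression_trace : finite_trace u (Q \o T \o adjoint Q) (K * M).
Proof.
have [pS ST] := sqrt_opP pT.
have aQS := is_adjoint_comp (positive_sym pS) aQ.
have := sqrt_series; rewrite (series_sqn_adjoint oe ou aQS).
move/nneseries_le => h n; apply: le_trans (h _ n); last by move=> k; exact: sqn_ge0.
apply: ler_sum => j _ /=; rewrite (is_adjoint_rdot aQ) -{1}ST /=.
by rewrite (is_adjoint_rdot (positive_sym pS)).
Qed.

End compressions.

Section operator_families.
Context {R : realType} {H G : hilbertType R} (e : nat -> H) (u : nat -> G).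
Hypotheses (oe : onb e) (ou : onb u).
Hypotheses (hH : hilbert_basis (hbasis H)) (hG : hilbert_basis (hbasis G)).
Context {d : measure_display} {L : measurableType d}.
Variables (nu : set L -> H -> H) (m : {finite_measure set L -> \bar R}).
Hypotheses (nu_m : povm_variation nu = m).
Variables (f : L -> H -> H) (ff : tc_family e f).
Hypothesis fm : m.-integrable setT (EFin \o (fun l => rtr e (f l))).
Hypothesis rnf : {ae m, forall l, rn_density nu l = f l}.

Let pf l : positive_op (f l). Proof. by case: ff. Qed.

Let gramian_density_ae (Q Q' : L -> H -> G) : (forall l, bounded_op (Q' l)) ->
  {ae m, forall l, Q l \o f l \o adjoint (Q' l) =
    gramian_density nu (fun l => total_op (Q l)) (fun l => total_op (Q' l)) l}.
Proof.
move=> bQ'; apply: filterS rnf => l El.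
by rewrite /gramian_density /mul_sqrt_density /= El (mul_sqrt_adjoint oe _ (pf l) (bQ' l)).
Qed.

Lemma gramian_eq0 (Q Q' : L -> H -> G) : (forall l, bounded_op (Q' l)) ->
  (forall l x, Q l (f l (adjoint (Q' l) x)) = 0) ->
  gramian nu (fun l => total_op (Q l)) (fun l => total_op (Q' l)) = 0.
Proof.
move=> bQ' Q0; rewrite /gramian nu_m; apply: (get_bochner_integral0 hG ou).
apply: filterS (gramian_density_ae Q bQ') => l <-.
by apply/funext => x; exact: Q0.
Qed.

Variables (Q : L -> H -> G) (K : R).
Hypotheses (lQ : forall l, linear (Q l)) (K0 : 0 <= K).
Hypotheses (QK : forall l, sqn_bounded (Q l) K).
Hypothesis wQ : forall x, wmeas (fun l => Q l x).
Hypothesis mQ : forall x, borel_measurable (fun l => Q l x).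

Let bQ l : bounded_op (Q l). Proof. by apply/bounded_opP => //; exists K. Qed.

Let compression_family : tc_family u (fun l => Q l \o f l \o adjoint (Q l)).
Proof.
split=> [l|l|x y]; first exact: (compression_positive oe (@lQ l) K0 (@QK l) (pf l)).
  exists (K * rtr e (f l)).
  exact: (compression_trace oe ou (@lQ l) K0 (@QK l) (pf l) (family_trace ff l)).
have aQ l := is_adjoint_adjoint oe (bQ l).
have mA w : wmeas (fun l => adjoint (Q l) w).
  move=> v; under eq_fun do rewrite rdotC -(is_adjoint_rdot (aQ _)).
  exact: wQ.
under eq_fun do rewrite /= (is_adjoint_rdot (aQ _)).
apply: (measurable_rdot oe) => //; apply: (wmeas_app oe) => //.
by move=> v; case: ff => _ _ /(_ v).
Qed.

(** The uniform bound [K] on the operators dominates the trace of the Gramian density by [K] times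
    that of [f]. *)
Lemma L2_total_op : L2 nu (fun l => total_op (Q l)).
Proof.
split.
- split=> [l|x|].
  + by split=> // a x y _ _; split=> //=; exact: lQ.
  + rewrite (_ : [set l | _] = setT)//.
  + by exists (fun _ => Q); split=> // l x _; exact: cvg_cst.
- rewrite nu_m; apply: filterS rnf => l El; split=> //.
  rewrite /mul_sqrt_density El /=.
  exact: (mul_sqrt_hilbert_schmidt oe ou hH (@lQ l) K0 (@QK l) (pf l) (family_trace ff l)).
rewrite nu_m; apply: (bochner_integrable_ae ou (gramian_density_ae _ bQ)).
apply: (bochner_integrable_family hG ou compression_family).
have := integrableZl measurableT K fm.
apply: le_integrable => //.
  by apply/measurable_EFinP; exact: measurable_rtr compression_family.
move=> l _ /=; rewrite lee_fin !ger0_norm ?mulr_ge0 ?(family_rtr_ge0 ff)//.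
  have h := compression_trace oe ou (@lQ l) K0 (@QK l) (pf l) (family_trace ff l).
  have c := rtr_cvg (compression_positive oe (@lQ l) K0 (@QK l) (pf l)) h.
  exact: le_lim_seq c (cvg_cst _) h.
exact: family_rtr_ge0 compression_family l.
Qed.

End operator_families.

Section dual_families.
Context {R : realType} {H : hilbertType R} {d : measure_display} {L : measurableType d}.

Lemma dual_vec_adjoint (x : H) : is_adjoint (dual_vec x) (fun c : R[i] => c *: x).
Proof. by move=> y c; rewrite hdotZr mulrC. Qed.

Lemma dual_vec_linear (x : H) : linear (dual_vec x).
Proof. exact: is_adjoint_linear (dual_vec_adjoint x). Qed.

Lemma sqn_complex (c : R[i]) : sqn c = csq c.
Proof. by rewrite /sqn /rdot (_ : hdot c c = c * c^*)// csqE. Qed.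

Lemma dual_vec_sqn_bounded (x : H) : sqn_bounded (dual_vec x) (sqn x).
Proof. by move=> y; rewrite sqn_complex mulrC; exact: CS_hdot. Qed.

Variables (e : nat -> H) (u : nat -> R[i]) (oe : onb e) (ou : onb u).
Variables (z : nat -> H) (dz : dense_seq z) (f : L -> H).
Hypothesis mf : wmeas f.

Lemma wmeas_dual_vec x : wmeas (fun l => dual_vec (f l) x).
Proof.
move=> c; under eq_fun do rewrite (is_adjoint_rdot (dual_vec_adjoint (f _))) rdotC.
apply: wmeasZ => //; exact: measurable_cst.
Qed.

(** Values [hdot x (f l)] are approximated by [hdot x (z n)]; the added 1 in [sqn x + 1] permits the
    division when [x = 0]. *)
Lemma borel_dual_vec x : borel_measurable (fun l => dual_vec (f l) x).
Proof.
apply: (pettis (z := fun n => hdot x (z n)) ou) (wmeas_dual_vec x) => l r r0.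
have s0 : 0 < sqn x + 1 by rewrite ltr_wpDl// sqn_ge0.
have [n hn] := dz (f l) (divr_gt0 r0 s0); exists n.
rewrite /dual_vec sqn_complex -hdotBr (le_lt_trans (CS_hdot _ _))//.
apply: (@le_lt_trans _ _ ((sqn x + 1) * sqn (f l - z n))).
  by rewrite ler_wpM2r ?sqn_ge0// lerDl.
by rewrite mulrC -ltr_pdivlMr.
Qed.

End dual_families.

Lemma trace0 {R : realType} {H : hilbertType R} : trace (0 : H -> H) = 0.
Proof.
have h (p : R[i] -> R) : p 0 = 0 -> rsum (hbasis H) (fun b => p (hdot ((0 : H -> H) b) b)) = 0.
  move=> p0; rewrite /rsum !esum1 ?subrr// => b _;
  by rewrite hdot0l p0 ?oppr0 maxxx.
by rewrite /trace (h _ erefl) (h (@complex.Im R) erefl).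
Qed.

Theorem lemma4p10 (R : realType) (H0 : hilbertType R) (N : option nat)
    (d : measure_display) (L : measurableType d)
    (nu : set L -> H0 -> H0) (mu : {sigma_finite_measure set L -> \bar R})
    (H0_separable : separable_space H0) (H0_dim : hilbert_dim H0 N)
    (N_ge1 : below N 0) (nu_povm : tc_povm nu)
    (nu_mu : povm_variation nu `<< mu) :
  exists (sigma : nat -> L -> R) (phi : nat -> L -> H0),
    (forall n, below N n ->
      [/\ measurable_fun setT (sigma n), forall l, 0 <= sigma n l &
          borel_measurable (phi n)]) /\
    (* (i) *)
    (forall l,
      (forall m n, (m <= n)%N -> below N n -> sigma n l <= sigma m l) /\
      (\sum_(0 <= n <oo | below N n) (sigma n l)%:E < +oo)%E) /\
    (* (ii) *)
    (forall l m n, below N m -> below N n ->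
      hdot (phi m l) (phi n l) = (m == n)%:R) /\
    (* (iii) *)
    (exists f : L -> H0 -> H0,
      (forall l,
        (\sum_(0 <= n <oo | below N n)
          trace_norm ((sigma n l)%:C *: tensor (phi n l) (phi n l)) < +oo)%E /\
        trace_norm (f l - \sum_(0 <= k < n | below N k)
          (sigma k l)%:C *: tensor (phi k l) (phi k l))
          @[n --> \oo] --> (0 : \bar R)) /\
      is_density nu mu f) /\
    (* (iv) *)
    ((forall n, below N n -> L2 nu (fun l => total_op (dual_vec (phi n l)))) /\
     forall m n, below N m -> below N n -> m <> n ->
       L2_dot nu (fun l => total_op (dual_vec (phi m l)))
                 (fun l => total_op (dual_vec (phi n l))) = 0) /\
    (* (v) *)
    ((forall n, below N n ->
       L2 nu (fun l => total_op (tensor (phi n l) (phi n l)))) /\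
     forall m n, below N m -> below N n -> m <> n ->
       gramian nu (fun l => total_op (tensor (phi m l) (phi m l)))
                  (fun l => total_op (tensor (phi n l) (phi n l))) = 0) /\
    (* (vi) *)
    (exists P : L -> H0 -> H0,
      (forall l, bounded_op (P l) /\
        forall x, \sum_(0 <= k < n | below N k)
          tensor (phi k l) (phi k l) x @[n --> \oo] --> P l x) /\
      L2_eq nu (fun l => total_op (P l)) (fun l => total_op idfun)).
Proof.
have hH := hbasisP H0_dim; have [e oe eN] := hilbert_dim_onb H0_dim.
have hC := hbasisP (complex_dim R); have [u ou _] := hilbert_dim_onb (complex_dim R).
have [z dz] := separable_dense_seq H0_separable.
have [m nu_m] := povm_variation_measure hH oe nu_povm.
have [f [ff fm nuf]] := povm_operator_density hH oe nu_povm nu_m.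
have pf l : positive_op (f l) by case: ff.
have ft l := family_trace ff l.
have hsnu A : measurable A -> hs e (nu A).
  move=> mA; apply: (hs_positive oe (nu_povm.1 A mA).1).
  exact: (povm_trace hH oe nu_povm mA).
(* That [f] is a density makes [get] return one, and any two agree almost everywhere. *)
have rnf : {ae m, forall l, rn_density nu l = f l}.
  apply: (density_unique hH oe ff nuf).
  by rewrite /rn_density nu_m; apply: getI (is_density_family hH oe ff fm hsnu nuf).
have mm : m `<< mu by rewrite -nu_m.
have [r [r0 mr rm]] := nonneg_change_of_measure mm.
(* The decomposition is that of [f], the density with respect to the variation. The factor [r]
   enters [sigma] only, so (iv) to (vi) never meet it. *)
pose tau n l := eigval e (f l) n; pose phi n l := eigenvec e (f l) n.
pose sigma n l := r l * tau n l.
have tau0 n l : 0 <= tau n l by exact: eigval_ge0 (pf l) (ft l) n.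
have sigma0 n l : 0 <= sigma n l by rewrite mulr_ge0.
have op l : ons (phi ^~ l) by exact: eigenvec_ons (pf l) (ft l).
have phiN n l : (phi n l != 0) = below N n.
  exact: (eigenvec_neq0 oe (pf l) (ft l) n eN).
have phi0 n l : ~~ below N n -> phi n l = 0.
  by rewrite -(phiN n l) negbK => /eqP.
have phi1 n l : sqn (phi n l) <= 1 by exact: ons_sqn_le1 (op l).
have wphi n : wmeas (phi n) by exact: (wmeas_eigenvec oe dz ff).
have borel (g : L -> H0) : wmeas g -> borel_measurable g.
  by apply: (pettis (z := z) oe) => l; exact: dz.
have wtensor n x : wmeas (fun l => tensor (phi n l) (phi n l) x).
  exact: (wmeas_tensor oe).
have Ldual n : L2 nu (fun l => total_op (dual_vec (phi n l))).
  apply: (L2_total_op oe ou hH hC nu_m ff fm rnf (K := 1)) => //.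
  - by move=> l; exact: dual_vec_linear.
  - by move=> l x; rewrite (le_trans (dual_vec_sqn_bounded _ _))// ler_wpM2r// sqn_ge0.
  - by move=> x; exact: wmeas_dual_vec.
  - by move=> x; exact: (borel_dual_vec ou dz).
have Ltensor n : L2 nu (fun l => total_op (tensor (phi n l) (phi n l))).
  apply: (L2_total_op oe oe hH hH nu_m ff fm rnf (K := 1)) => //.
  - by move=> l; exact: tensor_linear.
  - move=> l x; rewrite (le_trans (tensor_sqn_bounded _ _ _))// ler_wpM2r ?sqn_ge0//.
    by rewrite mulr_ile1 ?sqn_ge0.
  - by move=> x; exact: borel.
have fphi n l : f l (phi n l) = (tau n l)%:C *: phi n l.
  exact: eigenvecE (pf l) (ft l) n.
have phi_orth i j l : i <> j -> hdot (phi i l) (phi j l) = 0.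
  by move=> /eqP/negbTE ij; rewrite (op l) ij.
have hP l := ons_projection (op l).
have [P hP'] := choice hP.
(* By padding, the terms of index not below [N] vanish, and the restricted sums are the plain
   ones. *)
have sumN (V : nmodType) (t : nat -> V) n : (forall k, ~~ below N k -> t k = 0) ->
    \sum_(0 <= k < n | below N k) t k = \sum_(0 <= k < n) t k.
  move=> t0; rewrite big_mkcond; apply: eq_bigr => k _.
  by case: ifP => // /negbT/t0.
have bP l : bounded_op (P l) by case: (hP' l) => _ [].
have lP l : linear (P l) by exact: (bP l).1.
have wP x : wmeas (fun l => P l x).
  apply: (@wmeas_lim _ _ _ _ (fun n l => \sum_(0 <= k < n) tensor (phi k l) (phi k l) x)).
    by move=> n; apply: wmeas_sum.
  by move=> l; case: (hP' l).
have LP : L2 nu (fun l => total_op (P l)).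
  apply: (L2_total_op oe oe hH hH nu_m ff fm rnf (K := 1)) => //.
  - by move=> l; case: (hP' l).
  - by move=> x; exact: borel.
have LI : L2 nu (fun l : L => total_op (idfun : H0 -> H0)).
  apply: (L2_total_op oe oe hH hH nu_m ff fm rnf (K := 1)) => //.
  - by move=> l x; rewrite mul1r.
  - by move=> x; exact: wmeas_cst.
  - by move=> x; apply: borel; exact: wmeas_cst.
have sumsg l : (\sum_(0 <= n <oo | below N n) (sigma n l)%:E < +oo)%E.
  rewrite eseries_mkcond (eq_eseriesr (g := fun n => (sigma n l)%:E)); last first.
    move=> n _; case: ifP => // /negbT/(phi0 n l) p0; rewrite /sigma /tau.
    by rewrite -(eigval_sqn oe (pf l) (ft l) n) -/(phi n l) p0 sqn0 !mulr0.
  apply: (@le_lt_trans _ _ (r l * rtr e (f l))%:E); last exact: ltry.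
  apply/nneseries_le => // n; rewrite -mulr_sumr ler_wpM2l//.
  exact: eigval_sum_le oe (pf l) (ft l) n.
exists sigma, phi; split.
  move=> n _; split=> //; last exact: borel.
  by apply: measurable_funM => //; exact: (measurable_eigval oe dz ff).
split.
  move=> l; split=> [i j ij _|].
    by apply: ler_wpM2l => //; exact: (eigval_nonincreasing (pf l) (ft l) ij).
  exact: sumsg.
split.
  by move=> l i j bi bj; rewrite (op l) phiN bj andbT.
split.
  exists (fun l x => (r l)%:C *: f l x); split; last first.
    exact: (is_density_scale oe r0 mr ff hH rm fm nuf hsnu).
  move=> l; split.
    apply: le_lt_trans (sumsg l); apply: lee_nneseries => n _.
      by rewrite (trace_norm_ge0 oe).
    rewrite (le_trans (trace_norm_tensor oe hH _ (sigma0 n l)))// lee_fin.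
    by rewrite ler_piMr.
  (* The n-th remainder is [r l] times the n-th deflation of [f l]. *)
  under eq_fun => n.
    rewrite (_ : (_ - _)%R = fun x => (r l)%:C *: (deflation e (f l) n).1 x).
      over.
    apply/funext => x; rewrite deflationE scalerBr scaler_sumr.
    rewrite (sumN _ (fun k => (sigma k l)%:C *: tensor (phi k l) (phi k l))); last first.
      move=> k /(phi0 k l) ->; apply/funext => y.
      rewrite [LHS](_ : _ = (sigma k l)%:C *: (hdot y 0 *: (0 : H0)))//.
      by rewrite !scaler0.
    congr (_ - _); rewrite fct_sumE; apply: eq_bigr => k _.
    by rewrite scalerA -rmorphM.
  exact: (deflation_trace_norm oe (pf l) (ft l) hH (r0 l)).
split.
  split; first by move=> n _; exact: Ldual.
  move=> i j _ _ ij; rewrite /L2_dot (gramian_eq0 oe ou hC nu_m ff rnf) ?trace0//.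
    move=> l; apply/bounded_opP; first exact: dual_vec_linear.
    by exists (sqn (phi j l)); [exact: sqn_ge0|exact: dual_vec_sqn_bounded].
  move=> l c; rewrite (adjointE (dual_vec_adjoint _)) (linZ (positive_linear (pf l))).
  by rewrite fphi /dual_vec 2!hdotZl phi_orth ?mulr0//; exact/nesym.
split.
  split; first by move=> n _; exact: Ltensor.
  move=> i j _ _ ij; apply: (gramian_eq0 oe oe hH nu_m ff rnf).
    by move=> l; exact: tensor_bounded.
  move=> l x; rewrite (adjointE (tensor_adjoint _ _)) /tensor.
  rewrite (linZ (positive_linear (pf l))) fphi 2!hdotZl phi_orth ?mulr0 ?scale0r//.
  exact/nesym.
exists P; split.
  move=> l; split=> // x; have [cP _ _ _] := hP' l.
  apply: eq_cvg_seq (cP x) => n; rewrite (sumN _ (fun k => tensor (phi k l) (phi k l) x))//.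
  by move=> k /(phi0 k l) ->; rewrite /tensor scaler0.
split=> //; rewrite /L2_norm.
have -> : gramian nu (fun l => sub_op (total_op (P l)) (total_op idfun))
    (fun l => sub_op (total_op (P l)) (total_op idfun)) = 0.
  (* [gramian] depends on [opval] only, so the difference can be treated as a total operator; it
     vanishes on the range of [f l], which [P l] fixes. *)
  apply: (gramian_eq0 oe oe hH nu_m ff rnf (Q := fun l => P l - idfun)
    (Q' := fun l => P l - idfun)).
    move=> l; have [_ _ P1 _] := hP' l.
    apply/bounded_opP; first last.
      exists 4 => // x; rewrite (le_trans (sqnB_le _ _))//=.
      by have := P1 x; lra.
    move=> a x y /=; rewrite /GRing.add /= /GRing.opp /=.
    by rewrite lP opprD addrACA scalerBr.
  move=> l x; have [cP _ _ Pu] := hP' l.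
  apply/eqP; rewrite subr_eq0; apply/eqP.
  exact: (eigenvec_range oe (pf l) (ft l) cP Pu).
by rewrite (trace_norm0 hH oe) sqrtr0.
Qed.
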